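(* Let $(\mathfrak{g},\mathcal{Q})$ be a quadratic Lie algebra and $\mathfrak{k}\subset\mathfrak{g}$ a quadratic subalgebra, i.e. a Lie subalgebra such that the restriction of $\mathcal{Q}$ to $\mathfrak{k}$ is non-degenerate. Let $\mathfrak{p}$ be the orthogonal complement of $\mathfrak{k}$, so that $\mathfrak{g}=\mathfrak{k}\oplus\mathfrak{p}$, and for $\mu\in\mathfrak{k}$ put $\mathrm{ad}_\mu^{\mathfrak{k}}=\mathrm{ad}_\mu|_{\mathfrak{k}}$ and $\mathrm{ad}_\mu^{\mathfrak{p}}=\mathrm{ad}_\mu|_{\mathfrak{p}}$. Suppose that for $\mu$ in an open dense subset of $\mathfrak{k}$ the operator $\mathrm{ad}_\mu^{\mathfrak{p}}$ is invertible. Define meromorphic functions $\mathfrak{r}^{\mathfrak{k}}:\mathfrak{k}\to\wedge^2\mathfrak{k}$ and $\mathfrak{r}^{\mathfrak{p}}:\mathfrak{k}\to\wedge^2\mathfrak{p}$ by $$\mathfrak{r}^{\mathfrak{k}}(\mu)=\lambda(f(\mathrm{ad}_\mu^{\mathfrak{k}})),\qquad \mathfrak{r}^{\mathfrak{p}}(\mu)=\tfrac12\lambda\big(\coth(\mathrm{ad}_\mu^{\mathfrak{p}}/2)\big),$$ where $f(z)=\frac12\coth(z/2)-\frac1z$. Then $\mathfrak{r}=\mathfrak{r}^{\mathfrak{k}}+\mathfrak{r}^{\mathfrak{p}}$ solves the classical dynamical Yang-Baxter equation for $\mathfrak{k}\subset\mathfrak{g}$ with coupling constant $\epsilon=\frac14$: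 $$\sum_i\frac{\partial\mathfrak{r}}{\partial\mu_i}\wedge e_i+\frac12[\mathfrak{r},\mathfrak{r}]^{\mathfrak{g}}=\frac14\,\Theta .$$
   Context: A quadratic Lie algebra is a finite-dimensional real Lie algebra $\mathfrak{g}$ with Lie bracket $[\cdot,\cdot]^{\mathfrak{g}}$ and an invariant non-degenerate quadratic form $\mathcal{Q}$, with associated bilinear form $B(\mu,\mu')=\frac12(\mathcal{Q}(\mu+\mu')-\mathcal{Q}(\mu)-\mathcal{Q}(\mu'))$; invariance means that each $\mathrm{ad}_\mu$ is skew-adjoint for $B$. For a subspace $V\subset\mathfrak{g}$ on which $B$ is non-degenerate, with basis $e_a$ and $B$-dual basis $e^a\in V$, and $A\in\mathfrak{o}(V)$ (skew-adjoint endomorphism of $V$), $\lambda(A)=\frac12\sum_aA(e_a)\wedge e^a\in\wedge^2V$; this is applied with $V=\mathfrak{k}$ and $V=\mathfrak{p}$. Functions of operators are defined by functional calculus ($f$ is extended holomorphically to $z=0$). $\mathfrak{k}^*$ is identified with $\mathfrak{k}$ via $B|_{\mathfrak{k}}$. In the equation, $e_i$ is a basis of $\mathfrak{k}$, $e^i\in\mathfrak{k}$ the $B$-dual basis, and $\mu_i$ are the coordinates $\mu=\sum_i\mu_ie^i$; the equation is an identity of meromorphic functions on $\mathfrak{k}$ with values in $\wedge^3\mathfrak{g}$. $[\cdot,\cdot]^{\mathfrak{g}}$ on $\wedge\mathfrak{g}$ is the Schouten bracket extending the Lie bracket; for a basis $e_a$ of $\mathfrak{g}$ and $\mathfrak{r}=\frac12\sum_{ab}\mathfrak{r}^{ab}e_a\wedge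 e_b$, $[\mathfrak{r},\mathfrak{r}]^{\mathfrak{g}}=\sum_{abckl}\mathfrak{r}^{ak}f_{kl}^b\mathfrak{r}^{lc}\,e_a\wedge e_b\wedge e_c$, where $[e_k,e_l]^{\mathfrak{g}}=\sum_bf_{kl}^be_b$. $\Theta\in\wedge^3\mathfrak{g}$ is the cubic element $\Theta=-\frac16\sum_{abc}B(e^a,[e^b,e^c]^{\mathfrak{g}})\,e_a\wedge e_b\wedge e_c$ (with $e_a$ a basis of $\mathfrak{g}$, $e^a$ its $B$-dual basis). *)

(* Defs.v *)
From HB Require Import structures.
From mathcomp Require Import all_boot all_order all_algebra.
From mathcomp Require Import complex ring.
From mathcomp Require Import all_classical all_reals all_analysis.

Set Implicit Arguments.
Unset Strict Implicit.
Unset Printing Implicit Defensive.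

Import Order.TTheory GRing.Theory Num.Theory.
Import numFieldNormedType.Exports.

Local Open Scope classical_set_scope.
Local Open Scope ring_scope.

Section QuadraticLie.
Context {R : realType} {g : vectType R}.

Definition polar (Q : g -> R) (x y : g) : R :=
  2^-1 * (Q (x + y) - Q x - Q y).

Definition quadratic_form (Q : g -> R) : Prop :=
  (forall (a : R) (x : g), Q (a *: x) = a ^+ 2 * Q x) /\
  bilinear_for *%R *%R (polar Q).

Definition lie_bracket (br : {bilinear g -> g -> g}) : Prop :=
  (forall x : g, br x x = 0) /\
  (forall x y z : g, br x (br y z) + br y (br z x) + br z (br x y) = 0).

Definition nondegenerate_on (B : g -> g -> R) (V : {vspace g}) : Prop :=
  forall x : g, x \in V -> (forall y : g, y \in V -> B x y = 0) -> x = 0.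

Definition invariant (br : {bilinear g -> g -> g}) (B : g -> g -> R) : Prop :=
  forall mu x y : g, B (br mu x) y = - B x (br mu y).

Definition quadratic_lie_algebra (br : {bilinear g -> g -> g}) (Q : g -> R) :
    Prop :=
  [/\ lie_bracket br, quadratic_form Q,
      nondegenerate_on (polar Q) fullv & invariant br (polar Q)].

Definition quadratic_subalgebra (br : {bilinear g -> g -> g}) (Q : g -> R)
    (k : {vspace g}) : Prop :=
  (forall x y : g, x \in k -> y \in k -> br x y \in k) /\
  nondegenerate_on (polar Q) k.

Definition orthogonal_complement (B : g -> g -> R) (k p : {vspace g}) : Prop :=
  forall x : g, (x \in p) <-> (forall y : g, y \in k -> B x y = 0).

Definition dual_bases (B : g -> g -> R) (V : {vspace g}) (n : nat)
    (e e' : n.-tuple g) : Prop :=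
  [/\ basis_of V e, (forall i : 'I_n, tnth e' i \in V) &
      forall i j : 'I_n, B (tnth e i) (tnth e' j) = (i == j)%:R].

(* The restriction of [ad mu] to a subspace [V]; when [V] is stable under
   [ad mu] the projection [vsproj V] is only a change of type. *)
Definition ad_on (br : {bilinear g -> g -> g}) (V : {vspace g}) (mu : g) :
    'End(subvs_of V) :=
  linfun (fun x : subvs_of V => vsproj V (br mu (vsval x))).

End QuadraticLie.

(* Elements of the second and third exterior powers of [g] are represented by
   the alternating forms they define on the dual of [g], with x1 /\ ... /\ xn
   sent to (a1, ..., an) |-> det (a_i x_j). *)

Section Exterior.
Context {R : realType} {g : vectType R}.

Definition ext2 := {scalar g} -> {scalar g} -> R.
Definition ext3 := {scalar g} -> {scalar g} -> {scalar g} -> R.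

Definition wedge (x y : g) : ext2 := fun a b => a x * b y - a y * b x.

Definition wedge2v (w : ext2) (z : g) : ext3 :=
  fun a b c => w a b * c z + w b c * a z + w c a * b z.

Definition wedge3 (x y z : g) : ext3 := wedge2v (wedge x y) z.

Lemma wedge3_det (x y z : g) (a b c : {scalar g}) :
  wedge3 x y z a b c =
  \det (\matrix_(i < 3, j < 3)
          (tnth [tuple a : {scalar g}; b; c] i) (tnth [tuple x; y; z] j)).
Proof.
rewrite (expand_det_row _ ord0) !big_ord_recl big_ord0 /cofactor.
rewrite !(expand_det_row _ ord0) !big_ord_recl !big_ord0 /cofactor !det_mx11.
rewrite !mxE !(tnth_nth a) !(tnth_nth x) /=.
rewrite /wedge3 /wedge2v /wedge; ring.
Qed.

Definition lambda (V : {vspace g}) (n : nat) (e e' : n.-tuple g)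
    (A : 'End(subvs_of V)) : ext2 :=
  fun a b => 2^-1 *
    \sum_(i < n) wedge (vsval (A (vsproj V (tnth e i)))) (tnth e' i) a b.

(* The components in r = 1/2 sum_ab r^{ab} E_a /\ E_b are
   r^{ab} = r (coord E a) (coord E b). *)
Definition schouten (br : {bilinear g -> g -> g}) (n : nat) (E : n.-tuple g)
    (r : ext2) : ext3 :=
  fun x y z =>
    \sum_(a < n) \sum_(b < n) \sum_(c < n) \sum_(k < n) \sum_(l < n)
      r (coord E a) (coord E k) *
      coord E b (br (tnth E k) (tnth E l)) *
      r (coord E l) (coord E c) *
      wedge3 (tnth E a) (tnth E b) (tnth E c) x y z.

Definition cubic (br : {bilinear g -> g -> g}) (B : g -> g -> R)
    (n : nat) (E E' : n.-tuple g) : ext3 :=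
  fun x y z => - 6^-1 *
    \sum_(a < n) \sum_(b < n) \sum_(c < n)
      B (tnth E' a) (br (tnth E' b) (tnth E' c)) *
      wedge3 (tnth E a) (tnth E b) (tnth E c) x y z.

End Exterior.

Arguments ext2 {R} g.
Arguments ext3 {R} g.

Section ComplexFunctions.
Context {R : realType}.

(* [R[i]], presented so that its normed structure over itself is inferred *)
Definition cplx : numFieldType := R[i].

Definition cexp (z : R[i]) : R[i] :=
  let: (x +i* y)%C := z in ((expR x * cos y) +i* (expR x * sin y))%C.

Definition ccoth (z : R[i]) : R[i] :=
  (cexp z + cexp (- z)) / (cexp z - cexp (- z)).

(* The value at 0 is the limit of 1/2 coth(z/2) - 1/z. *)
Definition fdyn (z : R[i]) : R[i] :=
  if z == 0 then 0 else 2^-1 * ccoth (z / 2) - z^-1.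

Definition holomorphic_at (f : R[i] -> R[i]) (z : R[i]) : Prop :=
  \forall w \near (z : cplx), derivable (f : cplx -> cplx) w 1.

End ComplexFunctions.

Section FunctionalCalculus.
Context {R : realType} {W : vectType R}.

Definition complex_spectrum (A : 'End(W)) : set R[i] :=
  [set z | eigenvalue
     (map_mx (real_complex R) (passmx.mxof (vbasis {:W}) (vbasis {:W}) A)) z].

Definition poly_lfun (q : {poly R}) (A : 'End(W)) : 'End(W) :=
  \sum_(j < size q) q`_j *: iter j (fun X : 'End(W) => (A \o X)%VF) \1%VF.

(* f(A) is defined when f is holomorphic near the spectrum of A. *)
Definition calculus_defined (f : R[i] -> R[i]) (A : 'End(W)) : Prop :=
  forall z : R[i], complex_spectrum A z -> holomorphic_at f z.

(* f(A) = q(A) for any polynomial q with the same Taylor expansion as f, up to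
   an order at least the size of the Jordan blocks (here \dim W), at each
   complex eigenvalue of A; q(A) does not depend on q. If f commutes with
   complex conjugation, as [ccoth] and [fdyn] do, then q can be taken with real
   coefficients. *)
Definition calculus (f : R[i] -> R[i]) (A : 'End(W)) : 'End(W) :=
  xget 0 [set X | exists q : {poly R},
    (forall z : R[i], complex_spectrum A z ->
     forall j : nat, (j < \dim {:W})%N ->
       (map_poly (real_complex R) q)^`(j).[z] =
       derive1n j (f : @cplx R -> @cplx R) z) /\
    X = poly_lfun q A].

End FunctionalCalculus.

Section DynamicalRMatrix.
Context {R : realType} {g : vectType R}.
Variables (br : {bilinear g -> g -> g}) (k p : {vspace g}).

Definition of_coords (m : nat) (e' : m.-tuple g) (mu : 'rV[R]_m) : g :=
  \sum_(i < m) mu ord0 i *: tnth e' i.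

Definition rk (m : nat) (e e' : m.-tuple g) (mu : g) : ext2 g :=
  lambda e e' (calculus fdyn (ad_on br k mu)).

Definition rp (l : nat) (u u' : l.-tuple g) (mu : g) : ext2 g :=
  fun a b => 2^-1 * lambda u u' (calculus ccoth (2^-1 *: ad_on br p mu)) a b.

(* The points where both functional calculi are defined: the complement of the
   poles of [rk] and [rp] *)
Definition regular (mu : g) : Prop :=
  calculus_defined fdyn (ad_on br k mu) /\
  calculus_defined ccoth (2^-1 *: ad_on br p mu).

(* The derivative is taken after evaluation at each pair of covectors, i.e.
   componentwise. *)
Definition partial2 (m : nat) (i : 'I_m) (r : 'rV[R]_m -> ext2 g)
    (mu : 'rV[R]_m) : ext2 g :=
  fun a b => 'D_(delta_mx ord0 i) (fun nu => r nu a b : R^o) mu.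

Definition cdybe_lhs (m n : nat) (e : m.-tuple g) (E : n.-tuple g)
    (r : 'rV[R]_m -> ext2 g) (mu : 'rV[R]_m) : ext3 g :=
  fun a b c =>
    \sum_(i < m) wedge2v (partial2 i r mu) (tnth e i) a b c +
    2^-1 * schouten br E (r mu) a b c.

End DynamicalRMatrix.

(* Main.v *)
Require Import Defs.
From HB Require Import structures.
From mathcomp Require Import all_boot all_order all_algebra.
From mathcomp Require Import complex ring lra.
From mathcomp Require Import all_classical all_reals all_analysis.

Set Implicit Arguments.
Unset Strict Implicit.
Unset Printing Implicit Defensive.

Import Order.TTheory GRing.Theory Num.Theory.
Import numFieldNormedType.Exports.

Local Open Scope classical_set_scope.
Local Open Scope ring_scope.

(** * Entrywise limits of matrices *)

Section MatrixLimits.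
Context {R : realType} {T : Type}.
Implicit Types (F : set_system T).

Definition mxcvg F m n (f : T -> 'M[R]_(m, n)) (L : 'M[R]_(m, n)) : Prop :=
  forall i j, f t i j @[t --> F] --> L i j.

Lemma cvg_sumr F (FF : Filter F) (I : Type) (s : seq I) (P : pred I)
    (f : I -> T -> R) (l : I -> R) :
  (forall i, f i t @[t --> F] --> l i) ->
  \sum_(i <- s | P i) f i t @[t --> F] --> \sum_(i <- s | P i) l i.
Proof.
move=> fl; elim: s => [|i s IHs].
  rewrite big_nil; under eq_cvg do rewrite big_nil; exact: cvg_cst.
rewrite big_cons; under eq_cvg do rewrite big_cons.
by case: ifP => // _; apply: cvgD.
Qed.

Lemma cvg_prodr F (FF : Filter F) (I : Type) (s : seq I) (P : pred I)
    (f : I -> T -> R) (l : I -> R) :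
  (forall i, f i t @[t --> F] --> l i) ->
  \prod_(i <- s | P i) f i t @[t --> F] --> \prod_(i <- s | P i) l i.
Proof.
move=> fl; elim: s => [|i s IHs].
  rewrite big_nil; under eq_cvg do rewrite big_nil; exact: cvg_cst.
rewrite big_cons; under eq_cvg do rewrite big_cons.
by case: ifP => // _; apply: cvgM.
Qed.

Section Filter.
Context {F : set_system T} {FF : Filter F}.

Lemma mxcvg_cst m n (L : 'M[R]_(m, n)) : mxcvg F (fun=> L) L.
Proof. by move=> i j; apply: cvg_cst. Qed.

Lemma mxcvgD m n (f g : T -> 'M[R]_(m, n)) L M :
  mxcvg F f L -> mxcvg F g M -> mxcvg F (fun t => f t + g t) (L + M).
Proof.
move=> fL gM i j; rewrite mxE; under eq_cvg do rewrite mxE; exact: cvgD.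
Qed.

Lemma mxcvgZ m n (a : T -> R) (f : T -> 'M[R]_(m, n)) (b : R) L :
  a t @[t --> F] --> b -> mxcvg F f L ->
  mxcvg F (fun t => a t *: f t) (b *: L).
Proof.
move=> ab fL i j; rewrite mxE; under eq_cvg do rewrite mxE; exact: cvgM.
Qed.

Lemma mxcvgN m n (f : T -> 'M[R]_(m, n)) L :
  mxcvg F f L -> mxcvg F (fun t => - f t) (- L).
Proof.
move=> fL i j; rewrite mxE; under eq_cvg do rewrite mxE; exact: cvgN.
Qed.

Lemma mxcvgB m n (f g : T -> 'M[R]_(m, n)) L M :
  mxcvg F f L -> mxcvg F g M -> mxcvg F (fun t => f t - g t) (L - M).
Proof. by move=> fL gM; apply: mxcvgD => //; apply: mxcvgN. Qed.

Lemma mxcvgM m n p (f : T -> 'M[R]_(m, n)) (g : T -> 'M[R]_(n, p)) L M :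
  mxcvg F f L -> mxcvg F g M -> mxcvg F (fun t => f t *m g t) (L *m M).
Proof.
move=> fL gM i j; rewrite mxE; under eq_cvg do rewrite mxE.
by apply: cvg_sumr => k; apply: cvgM.
Qed.

Lemma mxcvg_sum m n (I : Type) (s : seq I) (P : pred I)
    (f : I -> T -> 'M[R]_(m, n)) L :
  (forall i, mxcvg F (f i) (L i)) ->
  mxcvg F (fun t => \sum_(i <- s | P i) f i t) (\sum_(i <- s | P i) L i).
Proof.
move=> fL i j; rewrite summxE; under eq_cvg do rewrite summxE.
by apply: cvg_sumr => k; apply: fL.
Qed.

Lemma mxcvgX n (f : T -> 'M[R]_n) L k :
  mxcvg F f L -> mxcvg F (fun t => f t ^+ k) (L ^+ k).
Proof.
move=> fL; elim: k => [|k IHk]; first exact: mxcvg_cst.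
rewrite exprS; have := mxcvgM fL IHk.
by congr mxcvg; apply/funext => t; rewrite exprS.
Qed.

Lemma mxcvg_det n (f : T -> 'M[R]_n) L :
  mxcvg F f L -> \det (f t) @[t --> F] --> \det L.
Proof.
move=> fL; apply: cvg_sumr => s; apply: cvgM; first exact: cvg_cst.
by apply: cvg_prodr => i; apply: fL.
Qed.

Lemma mxcvg_inv n (f : T -> 'M[R]_n) L : L \in unitmx ->
  mxcvg F f L -> mxcvg F (fun t => invmx (f t)) (invmx L).
Proof.
move=> Lu fL i j; have detL : \det L != 0 by rewrite -unitfE -unitmxE.
have dfL := mxcvg_det fL.
rewrite /invmx Lu mxE.
have : (\det (f t))^-1 * (\adj (f t)) i j @[t --> F] -->
       (\det L)^-1 * (\adj L) i j.
  apply: cvgM; first exact: cvgV.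
  rewrite mxE; under eq_cvg do rewrite mxE.
  apply: cvgM; first exact: cvg_cst.
  apply: mxcvg_det => k l; rewrite !mxE; under eq_cvg do rewrite !mxE.
  exact: fL.
have eqf : {near F, (fun t => (\det (f t))^-1 * (\adj (f t)) i j) =1
    (fun t => (if f t \in unitmx then (\det (f t))^-1 *: \adj (f t) else f t)
              i j)}.
  have nz : \forall t \near F, \det (f t) != 0 by exact: cvgr_neq0 detL.
  near=> t; have detf : \det (f t) != 0 by near: t.
  by rewrite unitmxE unitfE detf [in RHS]mxE.
by apply: cvg_trans; exact: near_eq_cvg.
Unshelve. all: by end_near.
Qed.

Lemma mxcvg_unit_near n (f : T -> 'M[R]_n) L : L \in unitmx ->
  mxcvg F f L -> \forall t \near F, f t \in unitmx.
Proof.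
rewrite unitmxE unitfE => L0 fL; have nz := cvgr_neq0 _ (mxcvg_det fL) L0.
by near=> t; rewrite unitmxE unitfE; near: t; exact: nz.
Unshelve. all: by end_near. Qed.

End Filter.

Lemma mxcvg_unique F (FF : ProperFilter F) m n (f : T -> 'M[R]_(m, n)) L M :
  mxcvg F f L -> mxcvg F f M -> L = M.
Proof.
move=> fL fM; apply/matrixP => i j.
exact: (cvg_unique _ (fL i j) (fM i j)).
Qed.

End MatrixLimits.

Arguments mxcvg_cst {R T F FF m n} L.

Arguments mxcvg_unique {R T F FF m n f L M} _ _.

(** * Entire functions of real matrices *)

Section RealSeries.
Context {R : realType}.

(** Dominated convergence for series: limits can be taken termwise under a
    summable bound that does not depend on the parameter. *)
Lemma cvg_dominated_series (T : Type) (F : set_system T) (FF : Filter F)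
    (u : nat -> T -> R) (l b : nat -> R) :
  cvgn (series b) -> (forall n, `|l n| <= b n) ->
  (\forall t \near F, forall n, `|u n t| <= b n) ->
  (forall n, u n t @[t --> F] --> l n) ->
  limn (series (u^~ t)) @[t --> F] --> limn (series l).
Proof.
move=> cb lb ub ul.
have cvg_dom (v : nat -> R) : (forall n, `|v n| <= b n) -> cvgn (series v).
  move=> vb; apply: normed_cvg; apply: series_le_cvg cb => [n|n|n]; [exact: normr_ge0| |exact: vb].
  exact: le_trans (normr_ge0 _) (vb n).
have tail (v : nat -> R) n : (forall n, `|v n| <= b n) ->
    `|limn (series v) - series v n| <= limn (series b) - series b n.
  move=> vb; have cv := cvg_dom _ vb.
  have h1 : `|series v m - series v n| @[m --> \oo] -->
      `|limn (series v) - series v n|.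
    apply: cvg_norm; apply: cvgB => //; exact: cvg_cst.
  have h2 : series b m - series b n @[m --> \oo] -->
      limn (series b) - series b n.
    apply: cvgB => //; exact: cvg_cst.
  rewrite -(cvg_lim _ h1)// -(cvg_lim _ h2)//.
  apply: ler_lim; [by apply/cvg_ex; eexists; exact: h1
                  |by apply/cvg_ex; eexists; exact: h2|].
  near=> m; have nm : (n <= m)%N by near: m; exact: nbhs_infty_ge.
  rewrite !sub_series_geq//; apply: le_trans (ler_norm_sum _ _ _) _.
  exact: ler_sum.
apply/cvgrPdist_le => e e0.
have e4 : 0 < e / 3 by rewrite divr_gt0.
have : series b n @[n --> \oo] --> limn (series b) by [].
move=> /cvgrPdist_le /(_ _ e4) [n _ bn].
have {bn} bn : limn (series b) - series b n <= e / 3.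
  by apply: le_trans (ler_norm _) _; apply: bn => /=.
have ulS : series (u^~ t) n @[t --> F] --> series l n.
  by apply: cvg_sumr.
move/cvgrPdist_le: ulS => /(_ _ e4) ulS.
near=> t.
have ut : forall k, `|u k t| <= b k by near: t.
have := tail _ n lb; have := tail _ n ut.
have : `|series l n - series (u^~ t) n| <= e / 3 by near: t.
rewrite !ler_norml => /andP[? ?] /andP[? ?] /andP[? ?].
by apply/andP; split; lra.
Unshelve. all: by end_near. Qed.

(** The growth condition on coefficients that is used for all the entire
    functions below; it makes the power series converge on every matrix. *)
Definition entire (c : nat -> R) : Prop :=
  exists2 K, 0 <= K & forall n, `|c n| <= K / n`!%:R.

Lemma entireD c d : entire c -> entire d -> entire (fun n => c n + d n).
Proof.
move=> [K K0 cK] [L L0 dL]; exists (K + L); first exact: addr_ge0.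
move=> n; rewrite mulrDl; apply: le_trans (ler_normD _ _) _; exact: lerD.
Qed.

Lemma entireZ a c : entire c -> entire (fun n => a * c n).
Proof.
move=> [K K0 cK]; exists (`|a| * K); first exact: mulr_ge0.
by move=> n; rewrite normrM -mulrA ler_wpM2l.
Qed.

Definition coef_diff (c : nat -> R) (k : nat) : R := k.+1%:R * c k.+1.

Lemma entire_diff c : entire c -> entire (coef_diff c).
Proof.
move=> [K K0 cK]; exists K => // n; rewrite /coef_diff.
have n0 : 0 < n.+1%:R :> R by rewrite ltr0n.
rewrite normrM ger0_norm ?ler0n// mulrC -ler_pdivlMr//.
by have := cK n.+1; rewrite factS natrM invfM [X in K * X]mulrC mulrA.
Qed.

End RealSeries.

Section MatrixSeries.
Context {R : realType}.

Definition mxentire_sum n (c : nat -> R) (A : 'M[R]_n) (N : nat) : 'M[R]_n :=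
  \sum_(k < N) c k *: A ^+ k.

Definition mxentire n (c : nat -> R) (A : 'M[R]_n) : 'M[R]_n :=
  \matrix_(i, j) limn (series (fun k => c k * (A ^+ k) i j)).

Definition mxmono m n (A : 'M[R]_m) (B : 'M[R]_n) (H : 'M[R]_(m, n)) (N : nat)
    : 'M[R]_(m, n) :=
  \sum_(k < N) A ^+ k *m H *m B ^+ (N.-1 - k).

Definition mxslope_sum m n (c : nat -> R) (A : 'M[R]_m) (B : 'M[R]_n)
    (H : 'M[R]_(m, n)) (N : nat) : 'M[R]_(m, n) :=
  \sum_(k < N) c k *: mxmono A B H k.

(** The divided difference of an entire function, with its first argument
    acting on the left of [H] and its second one on the right. It is the
    derivative at [A] in the direction [H] when [A = B]. *)
Definition mxslope m n (c : nat -> R) (A : 'M[R]_m) (B : 'M[R]_n)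
    (H : 'M[R]_(m, n)) : 'M[R]_(m, n) :=
  \matrix_(i, j) limn (series (fun k => c k * mxmono A B H k i j)).

Definition mxbound m n (A : 'M[R]_(m, n)) (a : R) : Prop :=
  forall i j, `|A i j| <= a.

Lemma mxboundM m n p (A : 'M[R]_(m, n)) (B : 'M[R]_(n, p)) a b :
  0 <= a -> mxbound A a -> mxbound B b -> mxbound (A *m B) (n%:R * a * b).
Proof.
move=> a0 Aa Bb i j; rewrite mxE; apply: le_trans (ler_norm_sum _ _ _) _.
apply: (@le_trans _ _ (\sum_(k < n) a * b)).
  by apply: ler_sum => k _; rewrite normrM ler_pM.
by rewrite sumr_const card_ord -mulrA mulr_natl.
Qed.

Lemma mxboundX n (A : 'M[R]_n) a k : 0 <= a -> mxbound A a ->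
  mxbound (A ^+ k) ((n%:R * a) ^+ k).
Proof.
move=> a0 Aa; elim: k => [|k IHk] i j.
  rewrite !expr0 mxE; case: (_ == _); rewrite ?normr0 ?normr1 ?ler01//.
by rewrite !exprS; apply: mxboundM.
Qed.

Lemma mxbound_mono m n (A : 'M[R]_m) (B : 'M[R]_n) (H : 'M[R]_(m, n)) a h K :
  0 <= a -> 0 <= h -> mxbound A a -> mxbound B a -> mxbound H h ->
  m%:R * a <= K -> n%:R * a <= K -> 1 <= K ->
  forall N, mxbound (mxmono A B H N) (m%:R * n%:R * h * (2 * K) ^+ N).
Proof.
move=> a0 h0 Aa Ba Hh mK nK K1 N i j.
have K0 : 0 <= K by exact: le_trans K1.
rewrite /mxmono summxE; apply: le_trans (ler_norm_sum _ _ _) _.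
apply: (@le_trans _ _ (\sum_(k < N) m%:R * n%:R * h * K ^+ N)).
  apply: ler_sum => k _.
  have Xle p (C : 'M[R]_p) q : mxbound C a -> p%:R * a <= K ->
      mxbound (C ^+ q) (K ^+ q).
    move=> Ca pK i1 j1; apply: le_trans (mxboundX q a0 Ca i1 j1) _.
    by apply: lerXn2r; rewrite ?nnegrE ?mulr_ge0.
  have b1 := mxboundM (exprn_ge0 k K0) (Xle _ _ k Aa mK) Hh.
  have b0 : 0 <= m%:R * K ^+ k * h by rewrite !mulr_ge0 ?exprn_ge0.
  have := mxboundM b0 b1 (Xle _ _ (N.-1 - k)%N Ba nK) i j.
  move=> /le_trans; apply.
  rewrite [leLHS](_ : _ = m%:R * n%:R * h * K ^+ (k + (N.-1 - k))); last first.
    by rewrite exprD; ring.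
  rewrite ler_wpM2l ?mulr_ge0//; apply: ler_weXn2l => //.
  by clear b0 b1; case: N k => [|N] [k kN] //=; rewrite subnKC.
rewrite sumr_const card_ord -[_ *+ N]mulr_natr -mulrA ler_wpM2l ?mulr_ge0//.
rewrite exprMn mulrC ler_wpM2r ?exprn_ge0//.
by rewrite -natrX ler_nat ltnW// ltn_expl.
Qed.

Lemma mxbound_ex m n (A : 'M[R]_(m, n)) : exists2 a, 0 <= a & mxbound A a.
Proof.
exists (\sum_i \sum_j `|A i j|); first by rewrite !sumr_ge0// => *; rewrite sumr_ge0.
move=> i j; rewrite (bigD1 i)//= (bigD1 j)//=.
rewrite -addrA lerDl addr_ge0// ?sumr_ge0// => k _; exact: sumr_ge0.
Qed.

Lemma cvg_entire_bound (c : nat -> R) a K L : 0 <= L ->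
  (forall n, `|c n| <= L / n`!%:R) ->
  0 <= K ->
  exists2 d, cvgn (series d) &
    forall n x, `|x| <= a * K ^+ n -> 0 <= a -> `|c n * x| <= d n.
Proof.
move=> L0 cL K0; exists (L * a *: exp_coeff K).
  by apply: is_cvg_seriesZ; exact: is_cvg_series_exp_coeff.
move=> n x xa a0; rewrite normrM.
apply: le_trans (ler_pM _ _ (cL n) xa) _ => //.
rewrite [leRHS](_ : _ = (L * a) * (K ^+ n / n`!%:R))//.
by rewrite le_eqVlt; apply/orP; left; apply/eqP; ring.
Qed.

End MatrixSeries.

Section MatrixSeriesTheory.
Context {R : realType}.
Implicit Types (c d : nat -> R).

Local Notation scvgM := (mxcvgM (FF := eventually_filter)).
Local Notation scvgD := (mxcvgD (FF := eventually_filter)).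
Local Notation scvgB := (mxcvgB (FF := eventually_filter)).
Local Notation scvgZ a := (mxcvgZ (FF := eventually_filter)
  (@cvg_cst _ a _ _ eventually_filter)).
Local Notation scvg_cst := (mxcvg_cst (FF := eventually_filter)).
Local Notation scvg_unique := (mxcvg_unique (FF := eventually_filter)).

Lemma mxbound_near (T : Type) (F : set_system T) (FF : Filter F) m n
    (f : T -> 'M[R]_(m, n)) L : mxcvg F f L ->
  exists a, [/\ 0 <= a, mxbound L a & \forall t \near F, mxbound (f t) a].
Proof.
move=> fL; have [a a0 La] := mxbound_ex L.
exists (a + 1); split=> [|i j|]; first exact: addr_ge0.
  by apply: le_trans (La i j) _; rewrite lerDl.
have near1 (i : 'I_m) (j : 'I_n) : \forall t \near F, `|f t i j| <= a + 1.
  have /cvgrPdist_le /(_ _ (@ltr01 R)) := fL i j; apply: filterS => t ft.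
  rewrite -[f t i j](subKr (L i j)); apply: le_trans (ler_normB _ _) _.
  by apply: lerD.
by apply: filter_forall => i; apply: filter_forall => j; exact: near1.
Qed.

Lemma mxentire_cvg c n (A : 'M[R]_n) : entire c ->
  mxcvg \oo (mxentire_sum c A) (mxentire c A).
Proof.
move=> [L L0 cL] i j; have [a a0 Aa] := mxbound_ex A.
have [d cd dP] := cvg_entire_bound 1 L0 cL (mulr_ge0 (ler0n R n) a0).
rewrite mxE.
have -> : (fun t => mxentire_sum c A t i j) =
    series (fun k => c k * (A ^+ k) i j).
  apply/funext => N; rewrite /mxentire_sum summxE /series/= big_mkord.
  by apply: eq_bigr => k _; rewrite mxE.
apply: normed_cvg; apply: series_le_cvg cd => [k|k|k]; first exact: normr_ge0.
  by apply: le_trans (dP k 0 _ _); rewrite ?normr_ge0// normr0 mul1r exprn_ge0// mulr_ge0.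
by apply: dP; rewrite // mul1r; exact: mxboundX.
Qed.

Arguments mxentire_cvg [c n] A.

Lemma mxentire_continuous (T : Type) (F : set_system T) (FF : Filter F) c n
    (f : T -> 'M[R]_n) L : entire c -> mxcvg F f L ->
  mxcvg F (fun t => mxentire c (f t)) (mxentire c L).
Proof.
move=> [l l0 cl] fL i j; rewrite mxE; under eq_cvg do rewrite mxE.
have [a [a0 La fa]] := mxbound_near FF fL.
have [d cd dP] := cvg_entire_bound 1 l0 cl (mulr_ge0 (ler0n R n) a0).
apply: (cvg_dominated_series FF cd) => [k||k].
- by apply: dP; rewrite // mul1r; exact: mxboundX.
- apply: filterS fa => t fa k.
  by apply: dP; rewrite // mul1r; exact: mxboundX.
- apply: cvgM; first exact: cvg_cst.
  exact: mxcvgX.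
Qed.

Lemma mxslope_bound c m n a h : entire c -> 0 <= a -> 0 <= h ->
  exists2 d, cvgn (series d) & forall (A : 'M[R]_m) (B : 'M[R]_n) H k i j,
    mxbound A a -> mxbound B a -> mxbound H h ->
    `|c k * mxmono A B H k i j| <= d k.
Proof.
move=> [l l0 cl] a0 h0; pose K := m%:R * a + n%:R * a + 1.
have ma0 : 0 <= m%:R * a by rewrite mulr_ge0.
have na0 : 0 <= n%:R * a by rewrite mulr_ge0.
have K0 : 0 <= 2 * K by rewrite mulr_ge0// /K; lra.
have [d cd dP] := cvg_entire_bound (m%:R * n%:R * h) l0 cl K0.
exists d => // A B H k i j Aa Ba Hh; apply: dP; last by rewrite !mulr_ge0.
by apply: (mxbound_mono a0) => //; rewrite /K; lra.
Qed.

Lemma mxslope_cvg c m n (A : 'M[R]_m) (B : 'M[R]_n) H : entire c ->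
  mxcvg \oo (mxslope_sum c A B H) (mxslope c A B H).
Proof.
move=> ec i j; have [a a0 Aa] := mxbound_ex A; have [b b0 Bb] := mxbound_ex B.
have [h h0 Hh] := mxbound_ex H.
have [d cd dP] := mxslope_bound m n ec (addr_ge0 a0 b0) h0.
have bd k : `|c k * mxmono A B H k i j| <= d k.
  apply: dP => // i1 j1; first by apply: le_trans (Aa i1 j1) _; rewrite lerDl.
  by apply: le_trans (Bb i1 j1) _; rewrite lerDr.
rewrite mxE.
have -> : (fun t => mxslope_sum c A B H t i j) =
    series (fun k => c k * mxmono A B H k i j).
  apply/funext => N; rewrite /mxslope_sum summxE /series/= big_mkord.
  by apply: eq_bigr => k _; rewrite mxE.
apply: normed_cvg; apply: series_le_cvg cd => [k|k|k]; first exact: normr_ge0.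
  exact: le_trans (normr_ge0 _) (bd k).
exact: bd.
Qed.

Arguments mxslope_cvg [c m n] A B H.

Lemma mxslope_continuous (T : Type) (F : set_system T) (FF : Filter F) c m n
    (f : T -> 'M[R]_m) (g : T -> 'M[R]_n) A B H : entire c ->
  mxcvg F f A -> mxcvg F g B ->
  mxcvg F (fun t => mxslope c (f t) (g t) H) (mxslope c A B H).
Proof.
move=> ec fA gB i j; rewrite mxE; under eq_cvg do rewrite mxE.
have [a [a0 Aa fa]] := mxbound_near FF fA.
have [b [b0 Bb gb]] := mxbound_near FF gB.
have [h h0 Hh] := mxbound_ex H.
have [d cd dP] := mxslope_bound m n ec (addr_ge0 a0 b0) h0.
have wa p (C : 'M[R]_p) : mxbound C a -> mxbound C (a + b).
  by move=> Ca i1 j1; apply: le_trans (Ca i1 j1) _; rewrite lerDl.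
have wb p (C : 'M[R]_p) : mxbound C b -> mxbound C (a + b).
  by move=> Ca i1 j1; apply: le_trans (Ca i1 j1) _; rewrite lerDr.
apply: (cvg_dominated_series FF cd) => [k||k].
- by apply: dP => //; [exact: wa|exact: wb].
- near=> t => k; apply: dP => //; [apply: wa|apply: wb]; by near: t.
- apply: cvgM; first exact: cvg_cst.
  apply: mxcvg_sum => q; apply: mxcvgM; last exact: mxcvgX.
  by apply: mxcvgM; [exact: mxcvgX|exact: mxcvg_cst].
Unshelve. all: by end_near. Qed.

Lemma mxXS n (A : 'M[R]_n) k : A ^+ k.+1 = A *m A ^+ k.
Proof. exact: exprS. Qed.

Lemma mxXSr n (A : 'M[R]_n) k : A ^+ k.+1 = A ^+ k *m A.
Proof. exact: exprSr. Qed.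

Lemma mxX_intertwine m n (A : 'M[R]_m) (B : 'M[R]_n) S k :
  A *m S = S *m B -> A ^+ k *m S = S *m B ^+ k.
Proof.
move=> AS; elim: k => [|k IHk]; first by rewrite !expr0 mul1mx mulmx1.
by rewrite !mxXSr -mulmxA AS mulmxA IHk -mulmxA.
Qed.

Lemma mxentire_intertwine c m n (A : 'M[R]_m) (B : 'M[R]_n) S : entire c ->
  A *m S = S *m B -> mxentire c A *m S = S *m mxentire c B.
Proof.
move=> ec AS.
have h1 := scvgM (mxentire_cvg A ec) (scvg_cst S).
have h2 := scvgM (scvg_cst S) (mxentire_cvg B ec).
apply: (scvg_unique h1); move: h2; congr mxcvg; apply/funext => N.
rewrite /mxentire_sum mulmx_suml mulmx_sumr; apply: eq_bigr => k _.
by rewrite -scalemxAl (mxX_intertwine k AS) -scalemxAr.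
Qed.

Lemma mxentire_comm c d n (A : 'M[R]_n) : entire c -> entire d ->
  mxentire c A *m mxentire d A = mxentire d A *m mxentire c A.
Proof.
move=> ec ed; apply: mxentire_intertwine => //; apply/esym.
exact: mxentire_intertwine.
Qed.

Lemma mxslopeP c m n (A : 'M[R]_m) (B : 'M[R]_n) (a : R)
    (H H' : 'M[R]_(m, n)) : entire c ->
  mxslope c A B (a *: H + H') = a *: mxslope c A B H + mxslope c A B H'.
Proof.
move=> ec; apply: (scvg_unique (mxslope_cvg A B _ ec)).
have := scvgD (scvgZ a (mxslope_cvg A B H ec))
  (mxslope_cvg A B H' ec).
congr mxcvg; apply/funext => N.
rewrite /mxslope_sum scaler_sumr -big_split; apply: eq_bigr => k _ /=.
rewrite /mxmono scalerA mulrC -scalerA -scalerDr scaler_sumr -big_split.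
congr (_ *: _); apply: eq_bigr => q _ /=.
by rewrite mulmxDr mulmxDl -scalemxAr -scalemxAl.
Qed.

(** The divided difference telescopes on commutators; [H = 1] gives
    [c(A) - c(B)] as the divided difference in the direction [A - B]. *)
Lemma mxslope_commutator c m n (A : 'M[R]_m) (B : 'M[R]_n) H : entire c ->
  mxslope c A B (A *m H - H *m B) = mxentire c A *m H - H *m mxentire c B.
Proof.
move=> ec; apply: (scvg_unique (mxslope_cvg A B _ ec)).
have h1 := scvgM (mxentire_cvg A ec) (scvg_cst H).
have h2 := scvgM (scvg_cst H) (mxentire_cvg B ec).
have := scvgB h1 h2; congr mxcvg; apply/funext => N.
rewrite /mxentire_sum /mxslope_sum mulmx_suml mulmx_sumr -sumrB.
apply: eq_bigr => k _; rewrite -scalemxAl -scalemxAr -scalerBr.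
congr (_ *: _); rewrite /mxmono; case: {k}(nat_of_ord k) => [|k].
  by rewrite big_ord0 !expr0 mul1mx mulmx1 subrr.
have := telescope_sumr (fun i => A ^+ i *m H *m B ^+ (k.+1 - i)) (leq0n k.+1).
rewrite subnn subn0 !expr0 mul1mx mulmx1 big_mkord => <-.
apply: eq_bigr => i _ /=; rewrite subSS subSn; last by rewrite -ltnS.
by rewrite mulmxBr mulmxBl mxXSr mxXS !mulmxA.
Qed.

Lemma mxslope_diff c n (A B : 'M[R]_n) : entire c ->
  mxslope c A B (A - B) = mxentire c A - mxentire c B.
Proof.
move=> ec; have := mxslope_commutator A B 1%:M ec.
by rewrite !mulmx1 !mul1mx.
Qed.

Lemma eq_mxentire c d n (A : 'M[R]_n) : c =1 d -> mxentire c A = mxentire d A.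
Proof. by move=> /funext ->. Qed.

Lemma mxentireD c d n (A : 'M[R]_n) : entire c -> entire d ->
  mxentire (fun k => c k + d k) A = mxentire c A + mxentire d A.
Proof.
move=> ec ed; apply: (scvg_unique (mxentire_cvg A (entireD ec ed))).
have := scvgD (mxentire_cvg A ec) (mxentire_cvg A ed).
congr mxcvg; apply/funext => N; rewrite /mxentire_sum -big_split.
by apply: eq_bigr => k _; rewrite scalerDl.
Qed.

Lemma mxentireZ a c n (A : 'M[R]_n) : entire c ->
  mxentire (fun k => a * c k) A = a *: mxentire c A.
Proof.
move=> ec; apply: (scvg_unique (mxentire_cvg A (entireZ a ec))).
have := scvgZ a (mxentire_cvg A ec).
congr mxcvg; apply/funext => N; rewrite /mxentire_sum scaler_sumr.
by apply: eq_bigr => k _; rewrite scalerA.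
Qed.

Lemma mxentire_shift c d n (A : 'M[R]_n) : entire c -> entire d ->
  d 0%N = 0 -> (forall k, d k.+1 = c k) ->
  A *m mxentire c A = mxentire d A.
Proof.
move=> ec ed d0 dS.
have h := scvgM (scvg_cst A) (mxentire_cvg A ec).
apply: (scvg_unique h) => i j.
have -> : (fun N => (A *m mxentire_sum c A N) i j) =
    [sequence mxentire_sum d A N.+1 i j]_N.
  apply/funext => N /=; congr (fun_of_matrix _ i j).
  rewrite /mxentire_sum big_ord_recl d0 scale0r add0r mulmx_sumr.
  apply: eq_bigr => k _.
  by rewrite /bump/= dS mxXS -scalemxAr.
by rewrite (cvg_shiftS (fun N => mxentire_sum d A N i j)); exact: mxentire_cvg.
Qed.

Lemma mxentire_scale t c n (A : 'M[R]_n) :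
  mxentire c (t *: A) = mxentire (fun k => t ^+ k * c k) A.
Proof.
apply/matrixP => i j; rewrite !mxE; congr (limn (series _)).
apply/funext => k; rewrite -mulrA mulrCA; congr (_ * _).
elim: k i j => [|k IHk] i j; first by rewrite !expr0 mul1r.
rewrite !exprS !mxE mulr_sumr; apply: eq_bigr => q _.
by rewrite mxE IHk -!mulrA; congr (_ * _); rewrite mulrCA.
Qed.

End MatrixSeriesTheory.

Arguments mxentire_cvg {R c n} A.
Arguments mxslope_cvg {R c m n} A B H.

(** * Quotients of entire functions *)

Section MatrixQuotient.
Context {R : realType}.
Variables (num den : nat -> R).
Hypotheses (enum : entire num) (eden : entire den).

Definition mxquot n (A : 'M[R]_n) : 'M[R]_n :=
  invmx (mxentire den A) *m mxentire num A.

(** The divided difference of the quotient, by the rule for the derivative of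
    a quotient. *)
Definition mxquot_slope m n (A : 'M[R]_m) (B : 'M[R]_n) (H : 'M[R]_(m, n)) :=
  invmx (mxentire den A) *m
    (mxslope num A B H - mxslope den A B H *m mxquot B).

Lemma mxquot_intertwine m n (A : 'M[R]_m) (B : 'M[R]_n) S :
  mxentire den A \in unitmx -> mxentire den B \in unitmx ->
  A *m S = S *m B -> mxquot A *m S = S *m mxquot B.
Proof.
move=> uA uB AS.
have E : S *m invmx (mxentire den B) = invmx (mxentire den A) *m S.
  rewrite -[LHS](mulKmx uA) [mxentire den A *m _]mulmxA.
  by rewrite (mxentire_intertwine eden AS) mulmxK.
by rewrite /mxquot -mulmxA (mxentire_intertwine enum AS) !mulmxA E.
Qed.

Lemma mxquot_slope_commutator m n (A : 'M[R]_m) (B : 'M[R]_n) H :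
  mxentire den A \in unitmx -> mxentire den B \in unitmx ->
  mxquot_slope A B (A *m H - H *m B) = mxquot A *m H - H *m mxquot B.
Proof.
move=> uA uB; rewrite /mxquot_slope !mxslope_commutator//.
rewrite mulmxBl -[H *m mxentire den B *m _]mulmxA [mxentire den B *m _]mulmxA.
rewrite mulmxV// mul1mx opprB addrA subrK mulmxBr !mulmxA mulVmx// mul1mx.
by [].
Qed.

Lemma mxquot_slope_diff n (A B : 'M[R]_n) :
  mxentire den A \in unitmx -> mxentire den B \in unitmx ->
  mxquot_slope A B (A - B) = mxquot A - mxquot B.
Proof.
move=> uA uB; have := mxquot_slope_commutator 1%:M uA uB.
by rewrite !mulmx1 !mul1mx.
Qed.

Lemma mxquot_slopeP m n (A : 'M[R]_m) (B : 'M[R]_n) (a : R)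
    (H H' : 'M[R]_(m, n)) :
  mxquot_slope A B (a *: H + H') =
  a *: mxquot_slope A B H + mxquot_slope A B H'.
Proof.
rewrite /mxquot_slope !mxslopeP// scalemxAr -mulmxDr; congr (_ *m _).
by rewrite mulmxDl -scalemxAl scalerBr opprD addrACA.
Qed.

Lemma mxquot_slope0 m n (A : 'M[R]_m) (B : 'M[R]_n) : mxquot_slope A B 0 = 0.
Proof.
have := mxquot_slopeP A B 1 0 0; rewrite !scale1r addr0 => E.
by apply: (addrI (mxquot_slope A B 0)); rewrite addr0 -E.
Qed.

Lemma mxquot_slope_sum m n (A : 'M[R]_m) (B : 'M[R]_n) (I : Type) (s : seq I)
    (a : I -> R) (H : I -> 'M[R]_(m, n)) :
  mxquot_slope A B (\sum_(i <- s) a i *: H i) =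
  \sum_(i <- s) a i *: mxquot_slope A B (H i).
Proof.
elim: s => [|i s IHs]; first by rewrite !big_nil mxquot_slope0.
by rewrite !big_cons mxquot_slopeP IHs.
Qed.

Section Continuity.
Context {T : Type} {F : set_system T} {FF : Filter F}.

Lemma mxquot_continuous n (f : T -> 'M[R]_n) A :
  mxentire den A \in unitmx -> mxcvg F f A ->
  mxcvg F (fun t => mxquot (f t)) (mxquot A).
Proof.
move=> uA fA; apply: mxcvgM; last exact: mxentire_continuous.
by apply: mxcvg_inv => //; exact: mxentire_continuous.
Qed.

Lemma mxquot_slope_continuous m n (f : T -> 'M[R]_m) (g : T -> 'M[R]_n) A B H :
  mxentire den A \in unitmx -> mxentire den B \in unitmx ->
  mxcvg F f A -> mxcvg F g B ->
  mxcvg F (fun t => mxquot_slope (f t) (g t) H) (mxquot_slope A B H).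
Proof.
move=> uA uB fA gB; apply: mxcvgM.
  by apply: mxcvg_inv => //; exact: mxentire_continuous.
apply: mxcvgB; first exact: mxslope_continuous.
by apply: mxcvgM; [exact: mxslope_continuous|exact: mxquot_continuous].
Qed.

Lemma mxentire_unit_near n (f : T -> 'M[R]_n) A :
  mxentire den A \in unitmx -> mxcvg F f A ->
  \forall t \near F, mxentire den (f t) \in unitmx.
Proof.
by move=> uA fA; apply: (mxcvg_unit_near uA); exact: mxentire_continuous.
Qed.

End Continuity.

End MatrixQuotient.

(** * The hyperbolic functions of half the argument *)

Section Hyperbolic.
Context {R : realType}.

(** Coefficients of [exp (z / 2)], of its even part [cosh (z / 2)] and of its
    odd part [sinh (z / 2)]. *)
Definition exp2 (k : nat) : R := 2 ^- k / k`!%:R.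
Definition cosh2 (k : nat) : R := if odd k then 0 else exp2 k.
Definition sinh2 (k : nat) : R := if odd k then exp2 k else 0.

(** [sinhc2] is [sinh (z / 2) / (z / 2)] and [fnum2] is
    [(cosh (z / 2) - sinhc2 z) / z], so that [fnum2 / sinhc2] is
    [coth (z / 2) / 2 - 1 / z]. Both are entire, which removes the singularity
    of the quotient at 0. *)
Definition sinhc2 (k : nat) : R := 2 * sinh2 k.+1.
Definition fnum2 (k : nat) : R := cosh2 k.+1 - sinhc2 k.+1.

Lemma exp2_le k : `|exp2 k| <= 1 / k`!%:R.
Proof.
rewrite /exp2 normrM !normfV !ger0_norm ?ler0n ?exprn_ge0//.
by rewrite ler_wpM2r ?invr_ge0 ?ler0n// invf_le1 ?exprn_ege1 ?exprn_gt0// ler1n.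
Qed.

Lemma entire_exp2 : entire exp2.
Proof. by exists 1 => //; exact: exp2_le. Qed.

Lemma entire_cosh2 : entire cosh2.
Proof.
exists 1 => // k; rewrite /cosh2; case: ifP => _; last exact: exp2_le.
by rewrite normr0 divr_ge0.
Qed.

Lemma entire_sinh2 : entire sinh2.
Proof.
exists 1 => // k; rewrite /sinh2; case: ifP => _; first exact: exp2_le.
by rewrite normr0 divr_ge0.
Qed.

Lemma entire_succ (c : nat -> R) : entire c -> entire (fun k => c k.+1).
Proof.
move=> [K K0 cK]; exists K => // k; apply: le_trans (cK k.+1) _.
rewrite ler_wpM2l// lef_pV2 ?posrE ?ltr0n ?fact_gt0// ler_nat.
by rewrite factS leq_pmull.
Qed.

Lemma entire_sinhc2 : entire sinhc2.
Proof. by apply: entireZ; exact: entire_succ entire_sinh2. Qed.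

Lemma entire_fnum2 : entire fnum2.
Proof.
have e1 := entire_succ entire_cosh2.
have := entireD e1 (entireZ (-1) (entire_succ entire_sinhc2)).
by congr entire; apply/funext => k; rewrite mulN1r.
Qed.

Hint Resolve entire_exp2 entire_cosh2 entire_sinh2 entire_sinhc2 entire_fnum2
  : core.

Variable n : nat.
Implicit Types A : 'M[R]_n.

Lemma mx_exp2E A : mxentire exp2 A = mxentire cosh2 A + mxentire sinh2 A.
Proof.
rewrite -mxentireD//; apply: eq_mxentire => k; rewrite /cosh2 /sinh2.
by case: ifP; rewrite ?add0r ?addr0.
Qed.

Lemma mx_sinhc2M A : A *m mxentire sinhc2 A = 2 *: mxentire sinh2 A.
Proof.
rewrite -mxentireZ//; apply: mxentire_shift => //; first exact: entireZ.
by rewrite /sinh2 mulr0.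
Qed.

Lemma mx_fnum2M A :
  A *m mxentire fnum2 A = mxentire cosh2 A - mxentire sinhc2 A.
Proof.
rewrite -[X in _ - X]scale1r -scaleNr -mxentireZ// -mxentireD//; last exact: entireZ.
apply: mxentire_shift => //; first by apply: entireD => //; exact: entireZ.
  by rewrite /sinhc2 /cosh2 /sinh2 /exp2/= fact0 (_ : 1`! = 1%N)// expr0 expr1; field.
by move=> k; rewrite mulN1r.
Qed.

Lemma mxentireN c A : mxentire c (- A) = mxentire (fun k => (-1) ^+ k * c k) A.
Proof. by rewrite -mxentire_scale scaleN1r. Qed.

Lemma mxentireN_even c A : (forall k, odd k -> c k = 0) ->
  mxentire c (- A) = mxentire c A.
Proof.
move=> c0; rewrite mxentireN; apply: eq_mxentire => k.
by rewrite -signr_odd; case: (boolP (odd k)) => [/c0 ->|_]; rewrite ?mulr0// mul1r.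
Qed.

Lemma mxentireN_odd c A : entire c -> (forall k, ~~ odd k -> c k = 0) ->
  mxentire c (- A) = - mxentire c A.
Proof.
move=> ec c0; rewrite mxentireN -[RHS]scaleN1r -mxentireZ//; apply: eq_mxentire => k.
by rewrite -signr_odd; case: (boolP (odd k)) => [|/c0 ->]; rewrite ?mulr0// expr1.
Qed.

Lemma cosh2_odd k : odd k -> cosh2 k = 0.
Proof. by rewrite /cosh2 => ->. Qed.

Lemma sinh2_even k : ~~ odd k -> sinh2 k = 0.
Proof. by rewrite /sinh2 => /negbTE ->. Qed.

Lemma sinhc2_odd k : odd k -> sinhc2 k = 0.
Proof. by rewrite /sinhc2 /sinh2 /= => ->; rewrite mulr0. Qed.

Lemma fnum2_even k : ~~ odd k -> fnum2 k = 0.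
Proof.
by move=> k0; rewrite /fnum2 cosh2_odd ?sinhc2_odd ?subrr//= k0.
Qed.

Definition fmx A : 'M[R]_n := mxquot fnum2 sinhc2 A.

Lemma fmxN A : fmx (- A) = - fmx A.
Proof.
rewrite /fmx /mxquot mxentireN_even; last exact: sinhc2_odd.
by rewrite mxentireN_odd ?mulmxN//; exact: fnum2_even.
Qed.

End Hyperbolic.

#[global] Hint Resolve entire_exp2 entire_cosh2 entire_sinh2 entire_sinhc2
  entire_fnum2 : core.

(** * The derivative of an entire function *)

Section Caratheodory.
Context {R : realType}.

Lemma caratheodory_derive (f phi : R -> R) (s : R) :
  (forall t, f t - f s = (t - s) * phi t) -> phi t @[t --> s] --> phi s ->
  is_derive (s : R^o) 1 (f : R^o -> R^o) (phi s).
Proof.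
move=> fphi cphi.
have h : (fun h : R^o => h^-1 *: (f (h *: 1 + s) - f s)) h @[h --> 0^'] --> phi s.
  have c0 : phi (h + s) @[h --> 0^'] --> phi s.
    apply: (@cvg_comp _ _ _ (fun h : R => h + s) phi _ (nbhs s)) => //.
    apply: cvg_within_filter.
    have : h + s @[h --> (0 : R)] --> 0 + s.
      by apply: cvgD; [exact: cvg_id|exact: cvg_cst].
    by rewrite add0r.
  apply: cvg_trans c0; apply: near_eq_cvg; near=> h.
  have h0 : h != 0 by near: h; exact: nbhs_dnbhs_neq.
  by rewrite fphi /= /GRing.scale/= mulr1 addrK mulrA mulVf// mul1r.
split; first by apply/cvg_ex; exists (phi s).
exact: cvg_lim h.
Unshelve. all: by end_near. Qed.

End Caratheodory.

Section Diagonal.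
Context {R : realType}.
Implicit Types c : nat -> R.

Lemma mxslope_diag c n (A H : 'M[R]_n) : entire c -> A *m H = H *m A ->
  mxslope c A A H = mxentire (coef_diff c) A *m H.
Proof.
move=> ec AH.
have XH k := mxX_intertwine k AH.
have monoE k : mxmono A A H k.+1 = k.+1%:R *: (A ^+ k *m H).
  rewrite /mxmono (eq_bigr (fun=> A ^+ k *m H)).
    by rewrite sumr_const card_ord scaler_nat.
  move=> [i ik] _ /=; rewrite -mulmxA -XH mulmxA; congr (_ *m _).
  by rewrite -[_ *m _]exprD subnKC// -ltnS.
have h := mxcvgM (FF := eventually_filter)
  (mxentire_cvg A (entire_diff ec)) (mxcvg_cst (FF := eventually_filter) H).
apply: (mxcvg_unique (FF := eventually_filter) _ h) => i j.
have := mxslope_cvg A A H ec i j.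
rewrite -(cvg_shiftS (fun N => mxslope_sum c A A H N i j)).
have -> // : [sequence mxslope_sum c A A H N.+1 i j]_N =
    (fun N => (mxentire_sum (coef_diff c) A N *m H) i j).
apply/funext => N /=; congr (fun_of_matrix _ i j).
rewrite /mxslope_sum big_ord_recl /mxmono big_ord0 scaler0 add0r.
rewrite /mxentire_sum mulmx_suml; apply: eq_bigr => k _.
rewrite -/(mxmono A A H _) /= monoE -scalemxAl scalerA /coef_diff.
by rewrite [_ * c _]mulrC.
Qed.

Lemma mxslope_line c n (A : 'M[R]_n) (t s : R) : entire c ->
  mxentire c (t *: A) - mxentire c (s *: A) =
  (t - s) *: mxslope c (t *: A) (s *: A) A.
Proof.
move=> ec; rewrite -mxslope_diff// -scalerBl.
rewrite -[X in mxslope _ _ _ X]addr0 mxslopeP//.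
suff -> : mxslope c (t *: A) (s *: A) 0 = 0 by rewrite addr0.
have := mxslope_commutator (t *: A) (s *: A) 0 ec.
by rewrite !mulmx0 !mul0mx !subrr.
Qed.

Lemma coef_diff_exp2 : coef_diff (@exp2 R) =1 fun k => 2^-1 * exp2 k.
Proof.
move=> k; rewrite /coef_diff /exp2 factS exprS natrM.
have k0 : k.+1%:R != 0 :> R by rewrite pnatr_eq0.
have f0 : k`!%:R != 0 :> R by rewrite pnatr_eq0 -lt0n fact_gt0.
have t0 : 2 ^+ k != 0 :> R by rewrite expf_neq0.
move: k0 f0 t0; move: (k.+1%:R) (k`!%:R) (2 ^+ k) => a b d a0 b0 d0.
by field; rewrite b0 d0 a0.
Qed.

Lemma mxslope_exp2 n (A : 'M[R]_n) (s : R) :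
  mxslope exp2 (s *: A) (s *: A) A = 2^-1 *: (A *m mxentire exp2 (s *: A)).
Proof.
have sA : s *: A *m A = A *m (s *: A) by rewrite -scalemxAl -scalemxAr.
rewrite mxslope_diag// (eq_mxentire _ coef_diff_exp2) mxentireZ//.
by rewrite -scalemxAl (mxentire_intertwine entire_exp2 sA).
Qed.

Lemma mxentire_exp2_0 n : mxentire exp2 (0 : 'M[R]_n) = 1%:M.
Proof.
apply/matrixP => i j; rewrite !mxE; apply: (@cvg_lim _ _ _ eventually) => //.
rewrite -cvg_shiftS; apply: cvg_near_cst; near=> N.
rewrite /series/= big_nat_recl//= big1_seq ?addr0.
  by rewrite /exp2 !expr0 fact0 invr1 !mul1r mxE.
by move=> k _; rewrite expr0n/= mxE mulr0.
Unshelve. all: by end_near. Qed.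

End Diagonal.

(** * Quadratic Lie algebras in coordinates *)

Section Trilinear.
Context {R : realType} {n : nat}.
Variables (G : 'M[R]_n) (ad : {linear 'cV[R]_n -> 'M[R]_n}).
Implicit Types (x y z : 'cV[R]_n) (A : 'M[R]_n).

Definition form x y : R := (x^T *m G *m y) 0 0.
Definition cform x y z : R := form x (ad y *m z).

Lemma formDl x x' y : form (x + x') y = form x y + form x' y.
Proof. by rewrite /form linearD/= !mulmxDl mxE. Qed.

Lemma formZl a x y : form (a *: x) y = a * form x y.
Proof. by rewrite /form linearZ/= -!scalemxAl mxE. Qed.

Lemma formDr x y y' : form x (y + y') = form x y + form x y'.
Proof. by rewrite /form mulmxDr mxE. Qed.

Lemma formZr a x y : form x (a *: y) = a * form x y.
Proof. by rewrite /form -scalemxAr mxE. Qed.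

Lemma formNl x y : form (- x) y = - form x y.
Proof. by rewrite -scaleN1r formZl mulN1r. Qed.

Lemma formNr x y : form x (- y) = - form x y.
Proof. by rewrite -scaleN1r formZr mulN1r. Qed.

Lemma cformDl x x' y z : cform (x + x') y z = cform x y z + cform x' y z.
Proof. exact: formDl. Qed.

Lemma cformDm x y y' z : cform x (y + y') z = cform x y z + cform x y' z.
Proof. by rewrite /cform linearD/= mulmxDl formDr. Qed.

Lemma cformDr x y z z' : cform x y (z + z') = cform x y z + cform x y z'.
Proof. by rewrite /cform mulmxDr formDr. Qed.

Lemma cformZl a x y z : cform (a *: x) y z = a * cform x y z.
Proof. exact: formZl. Qed.

Lemma cformZm a x y z : cform x (a *: y) z = a * cform x y z.
Proof. by rewrite /cform linearZ/= -scalemxAl formZr. Qed.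

Lemma cformZr a x y z : cform x y (a *: z) = a * cform x y z.
Proof. by rewrite /cform -scalemxAr formZr. Qed.

Lemma cformNl x y z : cform (- x) y z = - cform x y z.
Proof. by rewrite -scaleN1r cformZl mulN1r. Qed.

Lemma cformNm x y z : cform x (- y) z = - cform x y z.
Proof. by rewrite -scaleN1r cformZm mulN1r. Qed.

Lemma cformNr x y z : cform x y (- z) = - cform x y z.
Proof. by rewrite -scaleN1r cformZr mulN1r. Qed.

Definition cformE := (cformDl, cformDm, cformDr, cformNl, cformNm, cformNr,
  cformZl, cformZm, cformZr).

Lemma cformB x y z x' y' z' : cform x y z - cform x' y' z' =
  cform (x - x') y z + cform x' (y - y') z + cform x' y' (z - z').
Proof. by rewrite !cformE; ring. Qed.

Section Continuity.
Context {T : Type} {F : set_system T} {FF : Filter F}.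

Lemma cvg_form (x y : T -> 'cV[R]_n) x0 y0 : mxcvg F x x0 -> mxcvg F y y0 ->
  form (x t) (y t) @[t --> F] --> form x0 y0.
Proof.
move=> xx yy; apply: mxcvgM => //; apply: mxcvgM; last exact: mxcvg_cst.
by move=> i j; rewrite mxE; under eq_cvg do rewrite mxE; exact: xx.
Qed.

Lemma mxcvg_ad (y : T -> 'cV[R]_n) y0 : mxcvg F y y0 ->
  mxcvg F (fun t => ad (y t)) (ad y0).
Proof.
have adE u : ad u = \sum_i u i 0 *: ad (delta_mx i 0).
  rewrite {1}(matrix_sum_delta u) linear_sum; apply: eq_bigr => i _.
  by rewrite big_ord1 linearZ.
move=> yy; rewrite adE; under eq_fun do rewrite adE.
apply: mxcvg_sum => i; apply: mxcvgZ; [exact: yy|exact: mxcvg_cst].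
Qed.

Lemma cvg_cform (x y z : T -> 'cV[R]_n) x0 y0 z0 :
  mxcvg F x x0 -> mxcvg F y y0 -> mxcvg F z z0 ->
  cform (x t) (y t) (z t) @[t --> F] --> cform x0 y0 z0.
Proof.
move=> xx yy zz; apply: cvg_form => //; apply: mxcvgM => //; exact: mxcvg_ad.
Qed.

End Continuity.

(** If the matrices [a], [b], [c] act as a derivation of the trilinear form,
    their exponentials act as an automorphism: the derivative of
    [cform (exp (t a / 2) x) (exp (t b / 2) y) (exp (t c / 2) z)] in [t] is
    zero. *)
Lemma cform_exp2 (a b c : 'M[R]_n) :
  (forall x y z, cform (a *m x) y z + cform x (b *m y) z + cform x y (c *m z) = 0) ->
  forall x y z,
    cform (mxentire exp2 a *m x) (mxentire exp2 b *m y) (mxentire exp2 c *m z) =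
    cform x y z.
Proof.
move=> abc x y z.
pose e (m : 'M[R]_n) t := mxentire exp2 (t *: m).
pose sl (m : 'M[R]_n) t s := mxslope exp2 (t *: m) (s *: m) m.
have slE m t s : e m t - e m s = (t - s) *: sl m t s by exact: mxslope_line.
have slss m s : sl m s s = 2^-1 *: (m *m e m s) by exact: mxslope_exp2.
have cline (m : 'M[R]_n) (s : R) : mxcvg (nbhs s) (fun t : R => t *: m) (s *: m).
  by apply: mxcvgZ; [exact: cvg_id|exact: mxcvg_cst].
have ec m (s : R) : mxcvg (nbhs s) (e m) (e m s).
  by apply: mxentire_continuous => //; exact: cline.
pose f t := cform (e a t *m x) (e b t *m y) (e c t *m z).
have df (s : R) : is_derive (s : R^o) 1 (f : R^o -> R^o) 0.
  pose phi t := cform (sl a t s *m x) (e b t *m y) (e c t *m z)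
    + cform (e a s *m x) (sl b t s *m y) (e c t *m z)
    + cform (e a s *m x) (e b s *m y) (sl c t s *m z).
  have {1}-> : 0 = phi s.
    rewrite /phi !slss -!scalemxAl !cformE -!mulrDr -!mulmxA.
    by rewrite abc mulr0.
  apply: caratheodory_derive => [t|].
    rewrite /f cformB -!mulmxBl !slE -!scalemxAl cformZl cformZm cformZr.
    by rewrite /phi !mulrDr.
  have slc m : mxcvg (nbhs s) (sl m ^~ s) (sl m s s).
    by apply: mxslope_continuous => //; exact: mxcvg_cst.
  have sC m v : mxcvg (nbhs s) (fun t => sl m t s *m v) (sl m s s *m v).
    by apply: mxcvgM; [exact: slc|exact: mxcvg_cst].
  have eC m v : mxcvg (nbhs s) (fun t => e m t *m v) (e m s *m v).
    by apply: mxcvgM; [exact: ec|exact: mxcvg_cst].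
  have kC m v : mxcvg (nbhs s) (fun t => e m s *m v) (e m s *m v).
    exact: mxcvg_cst.
  apply: cvgD; [apply: cvgD|].
  - by apply: cvg_cform; [exact: sC|exact: eC|exact: eC].
  - by apply: cvg_cform; [exact: kC|exact: sC|exact: eC].
  - by apply: cvg_cform; [exact: kC|exact: kC|exact: sC].
have : f 1 = f 0 by apply: is_derive_0_is_cst.
rewrite /f /e !scale1r => ->; rewrite !scale0r.
by rewrite !mxentire_exp2_0 !mul1mx.
Qed.

End Trilinear.

(** * The dynamical Yang-Baxter equation for the whole Lie algebra *)

Section Adjoint.
Context {R : realType} {n : nat}.
Implicit Types (A B : 'M[R]_n).

Lemma mxentire_tr c A : mxentire c A^T = (mxentire c A)^T.
Proof.
have XT k : A^T ^+ k = (A ^+ k)^T.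
  elim: k => [|k IHk]; first by rewrite !expr0 trmx1.
  by rewrite mxXS IHk -trmx_mul -mxXSr.
apply/matrixP => i j; rewrite !mxE; congr (limn (series _)).
by apply/funext => k; rewrite XT mxE.
Qed.

Lemma mxquot_tr num den A : entire num -> entire den ->
  mxentire den A \in unitmx -> mxquot num den A^T = (mxquot num den A)^T.
Proof.
move=> en ed u; rewrite /mxquot !mxentire_tr trmx_mul trmx_inv.
have c := mxentire_comm A en ed; move: (congr1 trmx c); rewrite !trmx_mul => {}c.
have uT : (mxentire den A)^T \in unitmx by rewrite unitmx_tr.
apply: (canLR (mulKmx uT)); rewrite mulmxA c -mulmxA.
by rewrite mulmxV// mulmx1.
Qed.

Lemma form_mxquot (G : 'M[R]_n) num den A B : entire num -> entire den ->
  mxentire den A \in unitmx -> mxentire den B \in unitmx ->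
  (forall x y, form G (A *m x) y = form G x (B *m y)) ->
  forall x y, form G (mxquot num den A *m x) y =
              form G x (mxquot num den B *m y).
Proof.
move=> en ed uA uB AB x y.
have {}AB : A^T *m G = G *m B.
  apply/matrixP => i j; have := AB (delta_mx i 0) (delta_mx j 0).
  rewrite /form trmx_mul trmx_delta -[_ *m A^T *m G]mulmxA.
  rewrite [_ *m (B *m _)]mulmxA -[_ *m G *m B]mulmxA.
  by rewrite -!rowE -!colE !mxE.
have uAT : mxentire den A^T \in unitmx by rewrite mxentire_tr unitmx_tr.
rewrite /form trmx_mul -mxquot_tr// -[x^T *m _ *m G]mulmxA.
by rewrite (mxquot_intertwine en ed uAT uB AB) !mulmxA.
Qed.

End Adjoint.

(** A nonzero polynomial has no zero in a punctured neighbourhood of 0. *)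
Lemma poly_neq0_near (R : realType) (p : {poly R}) : p != 0 ->
  \forall t \near (0 : R)^', p.[t] != 0.
Proof.
move=> p0; have [k [q q0 ->]] := multiplicity_XsubC p 0.
rewrite p0/= in q0.
have qc : q.[t] @[t --> (0 : R)^'] --> q.[0].
  apply: cvg_within_filter; elim/poly_ind: q {q0} => [|q c IHq].
    by rewrite horner0; under eq_cvg do rewrite horner0; exact: cvg_cst.
  rewrite hornerMXaddC; under eq_cvg do rewrite hornerMXaddC.
  by apply: cvgD; [apply: cvgM => //; exact: cvg_id|exact: cvg_cst].
have q0' : \forall t \near (0 : R)^', q.[t] != 0 by exact: cvgr_neq0 q0.
near=> t; rewrite hornerM horner_exp hornerXsubC subr0 mulf_neq0//.
  by near: t.
by rewrite expf_neq0//; near: t; exact: nbhs_dnbhs_neq.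
Unshelve. all: by end_near. Qed.

Lemma scalar_shift_unit_near (R : realType) n (A : 'M[R]_n) (a : R) : a != 0 ->
  \forall t \near (0 : R)^', A + (a * t)%:M \in unitmx.
Proof.
move=> a0.
have p0 : char_poly (- A) \Po (a *: 'X) != 0.
  rewrite -size_poly_eq0 size_comp_poly2 ?size_poly_eq0 ?monic_neq0//.
    exact: char_poly_monic.
  by rewrite size_scale// size_polyX.
apply: filterS (poly_neq0_near p0) => t.
rewrite horner_comp hornerZ hornerX /char_poly -horner_evalE -det_map_mx unitmxE unitfE.
suff -> : map_mx (horner_eval (a * t)) (char_poly_mx (- A)) =
    A + (a * t)%:M by [].
apply/matrixP => i j; rewrite !mxE /horner_eval.
by rewrite hornerD hornerN hornerC hornerMn hornerX opprK addrC.
Qed.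

Section CoreIdentity.
Context {R : realType} {n : nat}.
Variables (G : 'M[R]_n) (ad : {linear 'cV[R]_n -> 'M[R]_n}).
Hypotheses (GT : G^T = G)
  (adC : forall x y, ad x *m y = - (ad y *m x))
  (adJ : forall x y, ad (ad x *m y) = ad x *m ad y - ad y *m ad x)
  (adG : forall x y z, form G (ad x *m y) z = - form G y (ad x *m z)).
Implicit Types (x y z mu : 'cV[R]_n).
Local Notation B := (form G).
Local Notation C := (cform G ad).

Lemma formC x y : B x y = B y x.
Proof.
have := congr1 (fun M : 'M[R]_1 => M 0 0) (trmx_mul (x^T *m G) y).
by rewrite mxE trmx_mul trmxK GT mulmxA.
Qed.

Lemma cform_rot x y z : C x y z = C y z x.
Proof. by rewrite /cform -formC adC formNl adG opprK formC -/(cform _ _ _ _ _). Qed.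

Lemma cform_swap x y z : C x y z = - C x z y.
Proof. by rewrite /cform adC formNr. Qed.

Lemma cform_derivation mu x y z :
  C (ad mu *m x) y z + C x (ad mu *m y) z + C x y (ad mu *m z) = 0.
Proof.
rewrite /cform adG adJ mulmxBl -!mulmxA formDr formNr; ring.
Qed.

Section Shifted.
Variables (mu : 'cV[R]_n) (s : R).
Local Notation A := (ad mu).
Local Notation a := (A + s%:M).
Hypotheses (ua : a \in unitmx) (ufa : mxentire sinhc2 a \in unitmx).

(** With [x = 2 sinh(a/2) x'], the vector [xp] is [cosh(a/2) x'] and [xs] is
    [x / a]; so [f(a) x = xp - xs], while [xp + x/2] and [xp - x/2] are the
    images of [x'] by [exp(a/2)] and [exp(-a/2)]. *)
Lemma half_exponential_split x : exists xp xs x' : 'cV[R]_n,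
  [/\ a *m xs = x, fmx a *m x = xp - xs,
      mxentire exp2 a *m x' = xp + 2^-1 *: x &
      mxentire exp2 (- a) *m x' = xp - 2^-1 *: x].
Proof.
pose x' := invmx (mxentire sinhc2 a) *m (invmx a *m x).
have xsE : mxentire sinhc2 a *m x' = invmx a *m x by rewrite mulKVmx.
have axs : a *m (mxentire sinhc2 a *m x') = x by rewrite xsE mulKVmx.
have xE : 2^-1 *: x = mxentire sinh2 a *m x'.
  rewrite -[in LHS]axs mulmxA mx_sinhc2M -scalemxAl scalerA mulVf ?scale1r//.
exists (mxentire cosh2 a *m x'), (mxentire sinhc2 a *m x'), x'; split=> //.
- have aC c : entire c -> mxentire c a *m a = a *m mxentire c a.
    by move=> ec; apply: mxentire_intertwine.
  rewrite -[in LHS]axs (mulmxA a) -aC// -mulmxA (mulmxA (fmx a)).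
  rewrite /fmx /mxquot -[_ *m mxentire sinhc2 a]mulmxA mxentire_comm//.
  by rewrite mulKmx// (mulmxA _ a) aC// mx_fnum2M mulmxBl.
- by rewrite mx_exp2E mulmxDl xE.
- rewrite mx_exp2E mulmxDl xE mxentireN_even; last exact: cosh2_odd.
  by rewrite mxentireN_odd ?mulNmx//; exact: sinh2_even.
Qed.

End Shifted.

Section Regularised.
Variable mu : 'cV[R]_n.
Local Notation A := (ad mu).
Local Notation a e := (A + e%:M).
Local Notation K e e' y :=
  (mxquot_slope fnum2 sinhc2 (a (- e)) (a e') (ad y)).

Lemma ad_shift (e e1 e2 : R) y : e + e1 + e2 = 0 ->
  ad (a e *m y) = a (- e1) *m ad y - ad y *m a e2.
Proof.
move=> e0; have -> : e = - e1 - e2 by lra.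
rewrite mulmxDl linearD/= adJ mul_scalar_mx linearZ/= mulmxDl mulmxDr.
rewrite mul_scalar_mx mul_mx_scalar opprD addrACA scalerBl.
by rewrite scaleNr.
Qed.

Lemma form_fmx_shift (e : R) :
  mxentire sinhc2 (a e) \in unitmx -> mxentire sinhc2 (a (- e)) \in unitmx ->
  forall x y, B (fmx (a e) *m x) y = - B x (fmx (a (- e)) *m y).
Proof.
move=> u u' x y; have aN : - a (- e) = - A + e%:M.
  by rewrite opprD raddfN/= opprK.
rewrite -formNr -mulNmx -fmxN aN /fmx; apply: form_mxquot => //.
  by rewrite -aN mxentireN_even//; exact: sinhc2_odd.
move=> {}x {}y; rewrite !mulmxDl formDl formDr adG mulNmx formNr.
by rewrite !mul_scalar_mx formZl formZr.
Qed.

(** In the direction [(A + e) y], the divided difference of [f] is the explicit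
    commutator of [f] with [ad y]. *)
Lemma slope_shift (e e1 e2 : R) x y z : e + e1 + e2 = 0 ->
  mxentire sinhc2 (a e1) \in unitmx -> mxentire sinhc2 (a (- e1)) \in unitmx ->
  mxentire sinhc2 (a e2) \in unitmx ->
  B z (K e1 e2 (a e *m y) *m x) =
  C x y (fmx (a e1) *m z) + C (fmx (a e2) *m x) y z.
Proof.
move=> e0 u1 u1' u2; have -> : K e1 e2 (a e *m y) =
    fmx (a (- e1)) *m ad y - ad y *m fmx (a e2).
  by rewrite (ad_shift _ e0); exact: mxquot_slope_commutator.
move: (form_fmx_shift u1 u1'); move: (fmx (a e1)) (fmx (a (- e1))) (fmx (a e2)) => F1 F1' F2 adj.
rewrite mulmxBl formDr formNr -mulmxA -[ad y *m _ *m x]mulmxA.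
rewrite -[B z (F1' *m _)]opprK -adj -/(C (F1 *m z) y x) -/(C z y (F2 *m x)).
rewrite (cform_rot _ y) cform_swap -cform_rot opprK.
by rewrite [C z y _]cform_swap opprK (cform_rot z).
Qed.

(** When all three operators are invertible the identity is algebraic: the
    terms without [1/z] are the addition formula of the hyperbolic cotangent,
    and the terms with [1/z] cancel. *)
Lemma regularised_identity (ex ey ez : R) x y z : ex + ey + ez = 0 ->
  (forall e, e \in [:: ex; ey; ez] ->
    [/\ a e \in unitmx, mxentire sinhc2 (a e) \in unitmx &
        mxentire sinhc2 (a (- e)) \in unitmx]) ->
  B z (K ez ex y *m x) + B y (K ey ez x *m z) + B x (K ex ey z *m y)
  + C x (fmx (a ey) *m y) (fmx (a ez) *m z)
  + C y (fmx (a ez) *m z) (fmx (a ex) *m x)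
  + C z (fmx (a ex) *m x) (fmx (a ey) *m y) + 4^-1 * C x y z = 0.
Proof.
move=> e0 eu.
have [ux fx fx'] : [/\ a ex \in unitmx, mxentire sinhc2 (a ex) \in unitmx &
    mxentire sinhc2 (a (- ex)) \in unitmx] by apply: eu; rewrite !inE eqxx.
have [uy fy fy'] : [/\ a ey \in unitmx, mxentire sinhc2 (a ey) \in unitmx &
    mxentire sinhc2 (a (- ey)) \in unitmx] by apply: eu; rewrite !inE eqxx orbT.
have [uz fz fz'] : [/\ a ez \in unitmx, mxentire sinhc2 (a ez) \in unitmx &
    mxentire sinhc2 (a (- ez)) \in unitmx] by apply: eu; rewrite !inE eqxx !orbT.
have [xp [xs [x' [xsE xfE xP xN]]]] := half_exponential_split ux fx x.
have [yp [ys [y' [ysE yfE yP yN]]]] := half_exponential_split uy fy y.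
have [zp [zs [z' [zsE zfE zP zN]]]] := half_exponential_split uz fz z.
have der u v w : C (a ex *m u) v w + C u (a ey *m v) w + C u v (a ez *m w) = 0.
  have d := cform_derivation mu u v w.
  rewrite !mulmxDl !mul_scalar_mx !cformE.
  have -> : ez = - ex - ey by lra.
  by move: d; move: (C _ _ _) (C _ _ _) (C _ _ _) (C _ _ _) => p q r t; nra.
have derN u v w :
    C (- a ex *m u) v w + C u (- a ey *m v) w + C u v (- a ez *m w) = 0.
  by rewrite !mulNmx !cformE -!opprD der oppr0.
have cayley : C (xp + 2^-1 *: x) (yp + 2^-1 *: y) (zp + 2^-1 *: z) =
    C (xp - 2^-1 *: x) (yp - 2^-1 *: y) (zp - 2^-1 *: z).
  by rewrite -xP -yP -zP -xN -yN -zN (cform_exp2 der) (cform_exp2 derN).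
have tx : B y (K ey ez x *m z) = C (fmx (a ez) *m z) xs y + C z xs (fmx (a ey) *m y).
  by rewrite -{1}xsE slope_shift// 1?addrC//; lra.
have ty : B z (K ez ex y *m x) = C (fmx (a ex) *m x) ys z + C x ys (fmx (a ez) *m z).
  by rewrite -{1}ysE slope_shift// 1?addrC//; lra.
have tz : B x (K ex ey z *m y) = C (fmx (a ey) *m y) zs x + C y zs (fmx (a ex) *m x).
  by rewrite -{1}zsE slope_shift// 1?addrC//; lra.
have ds : C x ys zs + C xs y zs + C xs ys z = 0.
  by have := der xs ys zs; rewrite xsE ysE zsE.
move: tx ty tz; move: (B z _) (B y _) (B x _) => bz by_ bx -> -> ->.
rewrite xfE yfE zfE.
rewrite (cform_rot (zp - zs)) (cform_rot z) -(cform_rot x (yp - ys)).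
rewrite -(cform_rot (xp - xs)) -(cform_rot (xp - xs)) (cform_rot z).
move: cayley ds; clear; rewrite !cformE.
set c1 := C x y z; set c2 := C x y zp; set c3 := C x y zs.
lra.
Qed.

End Regularised.

(** The singular case [A = ad mu] is a limit of regularised ones, since both
    sides are continuous in the shifts. *)
Lemma core_identity mu x y z : mxentire sinhc2 (ad mu) \in unitmx ->
  let K w := mxquot_slope fnum2 sinhc2 (ad mu) (ad mu) (ad w) in
  let F := fmx (ad mu) in
  B z (K y *m x) + B y (K x *m z) + B x (K z *m y)
  + C x (F *m y) (F *m z) + C y (F *m z) (F *m x) + C z (F *m x) (F *m y)
  + 4^-1 * C x y z = 0.
Proof.
move=> uf K F; set A := ad mu in uf K F *.
have shc (k : R) : mxcvg (0 : R)^' (fun t => A + (k * t)%:M) A.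
  move=> i j; rewrite -[A i j]addr0.
  under eq_cvg do rewrite mxE [_%:M _ _]mxE.
  apply: cvgD; first exact: cvg_cst.
  case: (i == j); last by under eq_cvg do rewrite mulr0n; exact: cvg_cst.
  under eq_cvg do rewrite mulr1n.
  suff : k * t @[t --> (0 : R)^'] --> k * 0 by rewrite mulr0.
  by apply: cvgM; [exact: cvg_cst|exact: cvg_within].
have unear (k : R) : \forall t \near (0 : R)^',
    mxentire sinhc2 (A + (k * t)%:M) \in unitmx.
  by apply: mxentire_unit_near (shc k).
have fc (k : R) v : mxcvg (0 : R)^' (fun t => fmx (A + (k * t)%:M) *m v) (F *m v).
  apply: mxcvgM; last exact: mxcvg_cst.
  by apply: mxquot_continuous => //; exact: shc.
have Kc (k k' : R) w u v : B u (mxquot_slope fnum2 sinhc2 (A + (k * t)%:M)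
    (A + (k' * t)%:M) (ad w) *m v) @[t --> (0 : R)^'] --> B u (K w *m v).
  apply: cvg_form; first exact: mxcvg_cst.
  apply: mxcvgM; last exact: mxcvg_cst.
  by apply: mxquot_slope_continuous => //; exact: shc.
have cc (k k' : R) u v w : C u (fmx (A + (k * t)%:M) *m v)
    (fmx (A + (k' * t)%:M) *m w) @[t --> (0 : R)^'] --> C u (F *m v) (F *m w).
  by apply: cvg_cform => //; exact: mxcvg_cst.
pose phi (t : R) :=
  B z (mxquot_slope fnum2 sinhc2 (A + (2 * t)%:M) (A + (1 * t)%:M) (ad y) *m x)
  + B y (mxquot_slope fnum2 sinhc2 (A + (-1 * t)%:M) (A + (- 2 * t)%:M) (ad x) *m z)
  + B x (mxquot_slope fnum2 sinhc2 (A + (-1 * t)%:M) (A + (1 * t)%:M) (ad z) *m y)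
  + C x (fmx (A + (1 * t)%:M) *m y) (fmx (A + (- 2 * t)%:M) *m z)
  + C y (fmx (A + (- 2 * t)%:M) *m z) (fmx (A + (1 * t)%:M) *m x)
  + C z (fmx (A + (1 * t)%:M) *m x) (fmx (A + (1 * t)%:M) *m y)
  + 4^-1 * C x y z.
have phic : phi t @[t --> (0 : R)^'] --> B z (K y *m x) + B y (K x *m z)
    + B x (K z *m y) + C x (F *m y) (F *m z) + C y (F *m z) (F *m x)
    + C z (F *m x) (F *m y) + 4^-1 * C x y z.
  apply: cvgD; last exact: cvg_cst.
  do 3!(apply: cvgD; last exact: cc).
  by do 2!(apply: cvgD; last exact: Kc); exact: Kc.
suff phi0 : phi t @[t --> (0 : R)^'] --> (0 : R).
  exact: (cvg_unique _ phic phi0).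
apply: cvg_near_cst.
have n1 : (1 : R) != 0 by exact: oner_neq0.
have n2 : (- 2 : R) != 0 by rewrite oppr_eq0 pnatr_eq0.
apply: filterS (filterI (filterI (scalar_shift_unit_near A n1)
    (scalar_shift_unit_near A n2)) (filterI (filterI (unear 1) (unear (-1)))
    (filterI (unear (-2)) (unear 2)))) => t [[s1 s2] [[u1 u1'] [u2 u2']]].
have t2 : 2 * t = - (- 2 * t) by lra.
have t1 : -1 * t = - (1 * t) by lra.
move: u1' u2'; rewrite /phi t1 t2 => u1' u2'.
apply: regularised_identity; first by lra.
move=> e; rewrite !inE orbA orbb => /orP[] /eqP ->.
  by split; [exact: s1|exact: u1|exact: u1'].
by split; [exact: s2|exact: u2|exact: u2'].
Qed.

End CoreIdentity.

(** * Slopes and differentials *)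

Section CaratheodoryRow.
Context {R : realType} {m : nat}.

Lemma row_coord_cvg (mu : 'rV[R]_m) (i : 'I_m) :
  (nu : 'rV[R]_m) 0 i @[nu --> mu] --> mu 0 i.
Proof. exact: (@coord_continuous R 1 m 0 i mu). Qed.

Lemma row_coord_le (h : 'rV[R]_m) (i : 'I_m) : `|h 0 i| <= `|h|.
Proof.
rewrite [leRHS]mx_normrE.
exact: (le_bigmax _ (fun ij : 'I_1 * 'I_m => `|h ij.1 ij.2|) (0, i)).
Qed.

(** Caratheodory's criterion: slopes that are continuous at the point are the
    partial derivatives there. *)
Lemma caratheodory_differentiable (g : 'rV[R]_m -> R) (mu : 'rV[R]_m)
    (phi : 'I_m -> 'rV[R]_m -> R) :
  (\forall nu \near mu,
     g nu - g mu = \sum_i (nu 0 i - mu 0 i) * phi i nu) ->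
  (forall i, phi i nu @[nu --> mu] --> phi i mu) ->
  differentiable (g : _ -> R^o) mu /\
  forall i, 'D_(delta_mx 0 i) (g : _ -> R^o) mu = phi i mu.
Proof.
move=> gphi phic.
pose L (h : 'rV[R]_m) : R^o := \sum_i h 0 i * phi i mu.
have Llin : linear L.
  move=> a u v; rewrite /L scaler_sumr -big_split; apply: eq_bigr => i _ /=.
  by rewrite !mxE mulrDl /GRing.scale/= mulrA.
pose LL : {linear 'rV[R]_m -> R^o} :=
  HB.pack L (GRing.isLinear.Build R _ _ _ L Llin).
have LLc : continuous LL.
  move=> x; apply: (@cvg_sumr R _ _ (nbhs_filter (x : 'rV[R]_m))) => i.
  by apply: cvgM; [exact: row_coord_cvg|exact: cvg_cst].
have dg : (g : _ -> R^o) \o shift mu = cst (g mu : R^o) + LL +o_ (0 : 'rV[R]_m) id.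
  apply/eqaddoP => e e0.
  pose d := e / m.+1%:R.
  have d0 : 0 < d by rewrite divr_gt0.
  have near1 i : \forall nu \near mu, `|phi i nu - phi i mu| <= d.
    have /cvgrPdist_le /(_ _ d0) := phic i.
    by apply: filterS => nu; rewrite distrC.
  have near2 : \forall nu \near mu, forall i, `|phi i nu - phi i mu| <= d.
    exact: (filter_forall (nbhs_filter mu) near1).
  have sh (P : 'rV[R]_m -> Prop) : (\forall nu \near mu, P nu) ->
      \forall h \near (0 : 'rV[R]_m), P (mu + h).
    by move=> /(nbhs0P (P : set 'rV[R]_m) mu).1.
  near=> h.
  have n2 : forall i, `|phi i (h + mu) - phi i mu| <= d.
    rewrite [h + mu]addrC; near: h; exact: (sh (fun nu => forall i, `|phi i nu - phi i mu| <= d)).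
  have n1 : g (h + mu) - g mu =
      \sum_i ((h + mu) 0 i - mu 0 i) * phi i (h + mu).
    rewrite [h + mu]addrC; near: h; exact: (sh (fun nu => g nu - g mu =
      \sum_i (nu 0 i - mu 0 i) * phi i nu)).
  have -> : ((g : _ -> R^o) \o shift mu - (cst (g mu : R^o) + LL)) h =
      \sum_i h 0 i * (phi i (h + mu) - phi i mu).
    transitivity ((g (h + mu) - g mu) - L h).
      by rewrite opprD addrA.
    rewrite n1 -sumrB; apply: eq_bigr => i _.
    by rewrite mxE addrK mulrBr.
  apply: le_trans (ler_norm_sum _ _ _) _.
  apply: (@le_trans _ _ (\sum_(i < m) `|h| * d)).
    by apply: ler_sum => i _; rewrite normrM ler_pM// row_coord_le.
  rewrite sumr_const card_ord -[_ *+ m]mulr_natr -mulrA [leRHS]mulrC.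
  rewrite ler_wpM2l// /d mulrAC ler_pdivrMr ?ltr0n//.
  by rewrite ler_wpM2l ?ler_nat// ltW.
have dE := diff_unique LLc dg.
have dif : differentiable (g : _ -> R^o) mu by apply/diff_locallyP; rewrite dE.
split=> // i; rewrite deriveE// dE /= /L (bigD1 i)//= mxE !eqxx mul1r.
rewrite big1 ?addr0// => j ji; rewrite mxE eqxx/=.
by rewrite (negbTE ji) mul0r.
Unshelve. all: by end_near. Qed.

End CaratheodoryRow.

(** * The dynamical Yang-Baxter equation for a quadratic subalgebra *)

Section Dressing.
Context {R : realType} {n : nat}.
Variables (G : 'M[R]_n) (ad : {linear 'cV[R]_n -> 'M[R]_n}).
Hypotheses (GT : G^T = G)
  (adC : forall x y, ad x *m y = - (ad y *m x))
  (adJ : forall x y, ad (ad x *m y) = ad x *m ad y - ad y *m ad x)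
  (adG : forall x y z, form G (ad x *m y) z = - form G y (ad x *m z)).
Variables (Pk Pp : 'M[R]_n).
Hypotheses (PkDPp : Pk + Pp = 1%:M)
  (Pkp : forall x y, form G (Pk *m x) (Pp *m y) = 0).
Variables (mu : 'cV[R]_n) (J : 'M[R]_n).
Local Notation A := (ad mu).
Hypotheses (AJ : A *m J = Pp) (PpJ : Pp *m J = J).
Hypothesis uA : mxentire sinhc2 A \in unitmx.
Implicit Types (x y z : 'cV[R]_n).
Local Notation B := (form G).
Local Notation C := (cform G ad).
Local Notation F := (fmx A).
Local Notation K w := (mxquot_slope fnum2 sinhc2 A A (ad w)).

Lemma form_fmx x y : B (F *m x) y = - B x (F *m y).
Proof.
have a0 : A + (0 : R)%:M = A by rewrite raddf0 addr0.
have := @form_fmx_shift R n G ad adG mu 0; rewrite oppr0 a0 => h.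
exact: h.
Qed.

Lemma form_inverse x y : B (J *m x) y = - B x (J *m y).
Proof.
have split (v : 'cV[R]_n) : v = Pk *m v + Pp *m v by rewrite -mulmxDl PkDPp mul1mx.
have pk v w : B (Pp *m v) (Pk *m w) = 0 by rewrite formC.
rewrite [in LHS](split y) formDr -{1}PpJ -mulmxA pk add0r -AJ.
rewrite -[A *m J *m y]mulmxA -[LHS]opprK -adG mulmxA AJ.
by rewrite [in RHS](split x) formDl -{2}PpJ -mulmxA Pkp add0r.
Qed.

(** The part of a direction in [p] is [A (J y)], for which the divided
    difference of [f] is a commutator; this expresses the derivative of
    [f + J] along the part in [k] through the divided difference along the
    whole direction. *)
Lemma form_dressed_slope x y z :
  B z ((K (Pk *m y) - J *m ad (Pk *m y) *m J) *m x) =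
  B z (K y *m x) + C (F *m z) (J *m y) x + C z (J *m y) (F *m x)
  + C (J *m z) (Pk *m y) (J *m x).
Proof.
have -> : K y = K (Pk *m y) + (F *m ad (J *m y) - ad (J *m y) *m F).
  have -> : F *m ad (J *m y) - ad (J *m y) *m F = K (Pp *m y).
    by rewrite -AJ -mulmxA adJ; apply/esym; exact: mxquot_slope_commutator.
  have {1}-> : y = 1 *: (Pk *m y) + Pp *m y.
    by rewrite scale1r -mulmxDl PkDPp mul1mx.
  by rewrite linearP/= mxquot_slopeP// scale1r.
move: (form_fmx); move: F (K (Pk *m y)) => F' K' skewF.
rewrite /cform !mulmxDl !mulNmx !formDr !formNr skewF form_inverse -!mulmxA.
ring.
Qed.

Lemma dressed_identity x y z :
  let D w := K (Pk *m w) - J *m ad (Pk *m w) *m J in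
  let r := F + J in
  B z (D y *m x) + B y (D x *m z) + B x (D z *m y)
  + C x (r *m y) (r *m z) + C y (r *m z) (r *m x) + C z (r *m x) (r *m y)
  = - (4^-1 * C x y z).
Proof.
move=> D r; have := core_identity GT adC adJ adG x y z uA.
rewrite /= /D /r !form_dressed_slope.
move: (K x) (K y) (K z) F => Kx Ky Kz F'.
have flip u v w : C u v w = - C v u w.
  by rewrite (cform_rot GT adC adG) (cform_swap _ adC) -(cform_rot GT adC adG).
have rot := cform_rot GT adC adG.
have sp (v : 'cV[R]_n) : v = Pk *m v + A *m (J *m v).
  by rewrite mulmxA AJ -mulmxDl PkDPp mul1mx.
have ex : C x (J *m y) (J *m z) =
    C (Pk *m x) (J *m y) (J *m z) + C (A *m (J *m x)) (J *m y) (J *m z).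
  by rewrite -cformDl -sp.
have ey : C (J *m x) y (J *m z) =
    C (J *m x) (Pk *m y) (J *m z) + C (J *m x) (A *m (J *m y)) (J *m z).
  by rewrite -cformDm -sp.
have ez : C (J *m x) (J *m y) z =
    C (J *m x) (J *m y) (Pk *m z) + C (J *m x) (J *m y) (A *m (J *m z)).
  by rewrite -cformDr -sp.
have der := cform_derivation adJ adG mu (J *m x) (J *m y) (J *m z).
rewrite !mulmxDl !cformE.
move: (J *m x) (J *m y) (J *m z) (F' *m x) (F' *m y) (F' *m z)
  (B z _) (B y _) (B x _) ex ey ez der => jx jy jz fx fy fz b1 b2 b3 ex ey ez der.
have odd u v w : C u v w = - C w v u by rewrite flip -rot.
rewrite (odd fz) (odd z jy) (odd jz) (odd fy) (odd y jx) (odd jy).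
rewrite (odd fx jz) (odd x jz fy) (odd jx (Pk *m z)).
rewrite (rot z jx fy) (rot fz jx y) (rot jz (Pk *m x)).
rewrite -(rot fx y jz) -(rot x fy jz) -(rot jx jy (Pk *m z)).
rewrite -(rot jx y fz) -(rot jx y jz) (rot z fx jy) (rot z jx jy).
lra.
Qed.

End Dressing.

(** * Entire functions of a matrix as polynomials *)

Section PolyEval.
Context {R : realType}.
Implicit Types (p q : {poly R}).

Definition peval q n (A : 'M[R]_n) : 'M[R]_n := \sum_(i < size q) q`_i *: A ^+ i.

Lemma peval_horner q n (A : 'M[R]_n.+1) : peval q A = horner_mx A q.
Proof.
rewrite -[in RHS](coefK q) poly_def linear_sum; apply: eq_bigr => i _.
by rewrite linearZ/= rmorphXn/= horner_mx_X.
Qed.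

Lemma peval_wide q n (A : 'M[R]_n) N : (size q <= N)%N ->
  peval q A = \sum_(i < N) q`_i *: A ^+ i.
Proof.
move=> qN; rewrite /peval (big_ord_widen _ (fun i => q`_i *: A ^+ i) qN).
rewrite big_mkcond; apply: eq_bigr => i _; case: ltnP => // qi.
by rewrite nth_default// scale0r.
Qed.

Lemma pevalM p q n (A : 'M[R]_n) : peval (p * q) A = peval p A *m peval q A.
Proof.
by case: n A => [|n] A; [apply/matrixP => -[]
  |rewrite !peval_horner rmorphM].
Qed.

Lemma pevalD p q n (A : 'M[R]_n) : peval (p + q) A = peval p A + peval q A.
Proof.
by case: n A => [|n] A; [apply/matrixP => -[]
  |rewrite !peval_horner rmorphD].
Qed.

Lemma peval_char_poly n (A : 'M[R]_n) : peval (char_poly A) A = 0.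
Proof.
by case: n A => [|n] A; [apply/matrixP => -[]
  |rewrite peval_horner Cayley_Hamilton].
Qed.

Lemma peval_mod p q r n (A : 'M[R]_n) :
  peval r A = 0 -> r %| p - q -> peval p A = peval q A.
Proof.
move=> r0 /dvdpP[s pq]; rewrite -[p](subrK q) pq pevalD pevalM r0 mulmx0.
by rewrite add0r.
Qed.

Definition psum (c : nat -> R) (N : nat) : {poly R} := \poly_(i < N) c i.

Lemma peval_psum c N n (A : 'M[R]_n) : peval (psum c N) A = mxentire_sum c A N.
Proof.
rewrite (peval_wide _ (size_poly _ _)); apply: eq_bigr => i _.
by rewrite coef_poly ltn_ord.
Qed.

Lemma psum_deriv c N : (psum c N.+1)^`() = psum (coef_diff c) N.
Proof.
apply/polyP => i; rewrite coef_deriv !coef_poly ltnS; case: ifP => _.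
  by rewrite /coef_diff mulr_natl.
by rewrite mul0rn.
Qed.

Lemma psum_derivn c N j :
  (psum c (N + j))^`(j) = psum (iter j coef_diff c) N.
Proof.
elim: j c => [|j IHj] c; first by rewrite addn0 derivn0.
by rewrite addnS derivSn psum_deriv IHj iterSr.
Qed.

Section Reduction.
Variables (Psi : {poly R}) (D : nat).
Hypotheses (sPsi : size Psi = D.+2).

(** Multiplication by ['X] on polynomials modulo [Psi]. *)
Definition mulX_mod : 'M[R]_D.+1 :=
  lin1_mx (fun v : 'rV[R]_D.+1 => poly_rV (('X * rVpoly v) %% Psi)).

Lemma mulX_modE v : rVpoly (v *m mulX_mod) = ('X * rVpoly v) %% Psi.
Proof.
pose f (v : 'rV[R]_D.+1) : 'rV[R]_D.+1 := poly_rV (('X * rVpoly v) %% Psi).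
have lin : linear f.
  move=> a x y; rewrite /f linearP/= mulrDr -scalerAr modpD modpZl.
  exact: linearP.
pose L : {linear 'rV[R]_D.+1 -> 'rV[R]_D.+1} :=
  HB.pack f (GRing.isLinear.Build R _ _ _ f lin).
rewrite [v *m mulX_mod](mul_rV_lin1 L) /= poly_rV_K//.
have P0 : Psi != 0 by rewrite -size_poly_gt0 sPsi.
by rewrite -ltnS -sPsi ltn_modp.
Qed.

Lemma mulX_modX k : rVpoly (poly_rV 1 *m mulX_mod ^+ k) = 'X^k %% Psi.
Proof.
elim: k => [|k IHk].
  rewrite !expr0 mulmx1 poly_rV_K ?size_poly1// modp_small//.
  by rewrite size_poly1 sPsi.
rewrite mxXSr mulmxA mulX_modE IHk exprS.
by rewrite modp_mul.
Qed.

(** The polynomial of degree at most [D] that agrees with the entire function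
    modulo [Psi]: the limit of the remainders of the partial sums. *)
Definition reduction (c : nat -> R) : {poly R} :=
  rVpoly (poly_rV 1 *m mxentire c mulX_mod).

Definition reduction_sum (c : nat -> R) (N : nat) : {poly R} :=
  rVpoly (poly_rV 1 *m mxentire_sum c mulX_mod N).

Lemma reduction_sumE c N : reduction_sum c N = psum c N %% Psi.
Proof.
rewrite /reduction_sum /mxentire_sum mulmx_sumr linear_sum /psum poly_def.
elim: N => [|N IHN]; first by rewrite !big_ord0 mod0p.
rewrite !big_ord_recr/= IHN modpD; congr (_ + _).
by rewrite -scalemxAr linearZ/= mulX_modX modpZl.
Qed.

Lemma reduction_coef_cvg c i : entire c ->
  (reduction_sum c N)`_i @[N --> \oo] --> (reduction c)`_i.
Proof.
move=> ec; rewrite !coef_rVpoly; under eq_cvg do rewrite coef_rVpoly.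
case: insubP => [j _ _|_]; last exact: cvg_cst.
have : mxcvg \oo (fun N => poly_rV 1 *m mxentire_sum c mulX_mod N)
    (poly_rV 1 *m mxentire c mulX_mod).
  by apply: mxcvgM; [exact: mxcvg_cst|exact: mxentire_cvg].
exact.
Qed.

Lemma peval_reduction_derivn_cvg c j n (A : 'M[R]_n) : entire c ->
  mxcvg \oo (fun N => peval (reduction_sum c N)^`(j) A)
    (peval (reduction c)^`(j) A).
Proof.
move=> ec; have sz (v : 'rV[R]_D.+1) : (size (rVpoly v)^`(j) <= D.+1)%N.
  apply/leq_sizeP => i Di; rewrite coef_derivn nth_default ?mul0rn//.
  rewrite (leq_trans (size_poly _ _))//.
  exact: leq_trans Di (leq_addl _ _).
rewrite (peval_wide _ (sz _)).
under eq_fun do rewrite (peval_wide _ (sz _)).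
apply: mxcvg_sum => i; apply: mxcvgZ; last exact: mxcvg_cst.
have E (q : {poly R}) : q^`(j)`_i = q`_(j + i) * ((j + i) ^_ j)%:R.
  by rewrite coef_derivn mulr_natr.
rewrite E; under eq_cvg do rewrite E.
by apply: cvgM; [exact: reduction_coef_cvg|exact: cvg_cst].
Qed.

Lemma peval_reduction c n (A : 'M[R]_n) : entire c -> peval Psi A = 0 ->
  peval (reduction c) A = mxentire c A.
Proof.
move=> ec PA; have h := @peval_reduction_derivn_cvg c 0 n A ec.
rewrite derivn0 in h; apply: (mxcvg_unique (FF := eventually_filter) h).
have := mxentire_cvg A ec; congr (mxcvg _ _ _); apply/funext => N.
rewrite derivn0 -peval_psum; apply/esym/(peval_mod PA).
rewrite reduction_sumE -dvdpNr opprB.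
by rewrite [X in X - _](divp_eq _ Psi) addrK dvdp_mull.
Qed.

End Reduction.

End PolyEval.

(** * Entire functions of a complex variable *)

Section ComplexMatrix.
Context {R : realType}.
Implicit Types (z w : R[i]).
Local Notation Re := complex.Re.
Local Notation Im := complex.Im.

(** Complex numbers as real matrices of order 2; this makes the functions of a
    complex variable a special case of the functions of a real matrix. *)
Definition cmx z : 'M[R]_2 :=
  \matrix_(i, j) if i == j then Re z else if i == 0 then Im z else - Im z.

Definition cmx_inv (M : 'M[R]_2) : R[i] := (M 0 0 +i* M 0 1)%C.

Lemma cmxK : cancel cmx cmx_inv.
Proof. by case=> x y; rewrite /cmx_inv !mxE. Qed.

Lemma matrix2P (M N : 'M[R]_2) : M 0 0 = N 0 0 -> M 0 1 = N 0 1 ->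
  M 1 0 = N 1 0 -> M 1 1 = N 1 1 -> M = N.
Proof.
have E (i : 'I_2) : i = 0 \/ i = 1.
  by case: i => -[|[|//]] p; [left|right]; apply: val_inj.
by move=> *; apply/matrixP => i j; case: (E i) => ->; case: (E j) => ->.
Qed.

Lemma cmxM z w : cmx (z * w) = cmx z *m cmx w.
Proof.
by case: z w => [a b] [c d]; apply: matrix2P;
  rewrite !mxE !big_ord_recl big_ord0 !mxE /=; ring.
Qed.

Lemma cmxD z w : cmx (z + w) = cmx z + cmx w.
Proof.
by case: z w => [a b] [c d]; apply: matrix2P; rewrite !mxE /=; ring.
Qed.

Lemma cmxN z : cmx (- z) = - cmx z.
Proof. by case: z => [a b]; apply: matrix2P; rewrite !mxE /=; ring. Qed.

Lemma cmx_real (a : R) : cmx a%:C%C = a%:M.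
Proof. by apply: matrix2P; rewrite !mxE /= ?oppr0. Qed.

Lemma cmxX z k : cmx (z ^+ k) = cmx z ^+ k.
Proof.
elim: k => [|k IHk]; first by rewrite !expr0 -[1]/(1%:C%C) cmx_real.
by rewrite exprS cmxM IHk mxXS.
Qed.

Lemma cmx_sum (I : Type) (s : seq I) (f : I -> R[i]) :
  cmx (\sum_(i <- s) f i) = \sum_(i <- s) cmx (f i).
Proof.
apply: (big_morph cmx cmxD); apply: matrix2P; by rewrite !mxE /= ?oppr0.
Qed.

Local Notation toC := (real_complex R).

Lemma cmx_horner (q : {poly R}) z : cmx (map_poly toC q).[z] = peval q (cmx z).
Proof.
rewrite horner_coef size_map_poly cmx_sum; apply: eq_bigr => i _.
by rewrite coef_map cmxM cmxX cmx_real mul_scalar_mx.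
Qed.

Lemma cmx_commute (M : 'M[R]_2) : cmx 'i%C *m M = M *m cmx 'i%C ->
  M = cmx (cmx_inv M).
Proof.
move=> MI; have e i j := congr1 (fun N : 'M[R]_2 => N i j) MI.
have := e 0 0; have := e 0 1.
rewrite !mxE !big_ord_recl !big_ord0 !mxE /= => h1 h2.
have E1 : lift ord0 (ord0 : 'I_1) = 1 :> 'I_2 by apply: val_inj.
rewrite !E1 /= in h1 h2.
by apply: matrix2P; rewrite !mxE //=; lra.
Qed.

Definition centire (c : nat -> R) z : R[i] := cmx_inv (mxentire c (cmx z)).

Lemma cmx_centire c z : entire c -> cmx (centire c z) = mxentire c (cmx z).
Proof.
move=> ec; rewrite -cmx_commute//; apply/esym; apply: mxentire_intertwine => //.
by rewrite -!cmxM mulrC.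
Qed.

Lemma cmx_inj : injective cmx.
Proof. exact: can_inj cmxK. Qed.

End ComplexMatrix.

Section ComplexTopology.
Context {R : realType}.
Implicit Types (z w : R[i]).
Local Notation Re := complex.Re.
Local Notation Im := complex.Im.
Local Notation C := (@cplx R).

Lemma cnorm_le z : `|z| <= (`|Re z| + `|Im z|)%:C%C.
Proof.
rewrite normc_def lecR -(ler_pXn2r (n := 2))// ?nnegrE ?sqrtr_ge0 ?addr_ge0//.
rewrite sqr_sqrtr ?addr_ge0 ?sqr_ge0// sqrrD !real_normK ?num_real//.
by rewrite -addrA lerD2l lerDr mulrn_wge0 ?mulr_ge0.
Qed.

Lemma Re_norm_le z (e : R) : `|z| <= e%:C%C -> `|Re z| <= e.
Proof.
move=> ze; have := le_trans (normc_ge_Re z) ze.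
by rewrite lecE/= => /andP[_].
Qed.

Lemma Im_norm_le z (e : R) : `|z| <= e%:C%C -> `|Im z| <= e.
Proof.
have -> : Im z = - Re (z * 'i%C) by rewrite ReiNIm opprK.
move=> ze; rewrite normrN; apply: Re_norm_le; rewrite normrM.
suff -> : `|'i%C : R[i]| = 1 by rewrite mulr1.
by rewrite normc_def/= expr0n expr1n add0r sqrtr1.
Qed.

Lemma cplx_cvg (T : Type) (F : set_system T) (FF : Filter F) (f : T -> C) (l : C) :
  Re (f t) @[t --> F] --> Re l -> Im (f t) @[t --> F] --> Im l ->
  f t @[t --> F] --> l.
Proof.
move=> /cvgrPdist_le rf /cvgrPdist_le jf; apply/cvgrPdist_le => -[e e'].
rewrite ltcE/= => /andP[/eqP -> e0] {e'}.
have e2 : 0 < e / 2 by rewrite divr_gt0.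
have := rf _ e2; have := jf _ e2; apply: filterS2 => t i r.
apply: le_trans (cnorm_le _) _.
rewrite -[(e +i* 0)%C]/(e%:C%C) lecR.
move: i r; case: l (f t) {rf jf} => [a b] [c d] /=; lra.
Qed.

Lemma Re_cvg (l : C) : Re z @[z --> l] --> Re l.
Proof.
apply/(cvgrPdist_le (FF := nbhs_filter l)) => e e0.
have eC : 0 < (e%:C%C : C) by rewrite ltcR.
have /(cvgrPdist_le (FF := nbhs_filter l)) /(_ _ eC) := @cvg_id _ (nbhs l).
by apply: filterS => z /Re_norm_le; case: l z {eC} => [a b] [c d].
Qed.

Lemma Im_cvg (l : C) : Im z @[z --> l] --> Im l.
Proof.
apply/(cvgrPdist_le (FF := nbhs_filter l)) => e e0.
have eC : 0 < (e%:C%C : C) by rewrite ltcR.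
have /(cvgrPdist_le (FF := nbhs_filter l)) /(_ _ eC) := @cvg_id _ (nbhs l).
by apply: filterS => z /Im_norm_le; case: l z {eC} => [a b] [c d].
Qed.

End ComplexTopology.

Section ComplexDerivative.
Context {R : realType}.
Implicit Types (c : nat -> R).
Local Notation Re := complex.Re.
Local Notation Im := complex.Im.
Local Notation C := (@cplx R).

Lemma mxslope_comm c n (A B H S : 'M[R]_n) : entire c -> A *m H = H *m A ->
  mxslope c A B (H *m S) = H *m mxslope c A B S.
Proof.
move=> ec AH.
have XH k := mxX_intertwine k AH.
apply: (mxcvg_unique (FF := eventually_filter) (mxslope_cvg A B _ ec)).
have : mxcvg \oo (fun N => H *m mxslope_sum c A B S N) (H *m mxslope c A B S).
  by apply: mxcvgM; [exact: mxcvg_cst|exact: mxslope_cvg].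
congr mxcvg; apply/funext => N; rewrite /mxslope_sum mulmx_sumr.
apply: eq_bigr => k _; rewrite -scalemxAr; congr (_ *: _).
rewrite /mxmono mulmx_sumr; apply: eq_bigr => i _.
by rewrite !mulmxA XH.
Qed.

Lemma cmx_cvg (w : C) : mxcvg (0 : C)^' (fun h : C => cmx (h + w)) (cmx w).
Proof.
have hc : h + w @[h --> (0 : C)^'] --> w.
  apply: cvg_within_filter.
  have : h + w @[h --> (0 : C)] --> 0 + w.
    by apply: (cvgD (FF := nbhs_filter (0 : C))); [exact: cvg_id|exact: (cvg_cst _ (FF := nbhs_filter (0 : C)))].
  by rewrite add0r.
have hr : Re (h + w) @[h --> (0 : C)^'] --> Re w.
  exact: (@cvg_comp _ _ _ (fun h : C => h + w) (@complex.Re R : C -> R) _ _ _ hc (@Re_cvg R w)).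
have hi : Im (h + w) @[h --> (0 : C)^'] --> Im w.
  exact: (@cvg_comp _ _ _ (fun h : C => h + w) (@complex.Im R : C -> R) _ _ _ hc (@Im_cvg R w)).
move=> i j; rewrite mxE; under eq_cvg do rewrite mxE.
by case: ifP => _ //; case: ifP => _ //; exact: cvgN.
Qed.

Lemma centire_slope_cvg c (w : C) : entire c ->
  (fun h : C => h^-1 * (centire c (h + w) - centire c w)) h @[h --> (0 : C)^'] -->
  (centire (coef_diff c) w : C).
Proof.
move=> ec; pose S (h : C) := mxslope c (cmx (h + w)) (cmx w) 1%:M.
have SE (h : C) : h != 0 ->
    h^-1 * (centire c (h + w) - centire c w) = cmx_inv (S h).
  move=> h0; apply: (mulfI h0); rewrite mulrA mulfV// mul1r; apply: cmx_inj.
  have hS : cmx h *m S h = cmx (centire c (h + w) - centire c w).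
    rewrite cmxD cmxN !cmx_centire// -mxslope_diff//.
    rewrite -mxslope_comm//; last by rewrite -!cmxM mulrC.
    by rewrite mulmx1 -cmxN -cmxD addrK.
  rewrite cmxM -hS; congr (_ *m _).
  have -> : S h = cmx (h^-1 * (centire c (h + w) - centire c w)).
    by rewrite cmxM -hS mulmxA -cmxM mulVf// -[1]/(1%:C%C) cmx_real mul1mx.
  by rewrite cmxK.
have Sc : mxcvg (0 : C)^' S (mxentire (coef_diff c) (cmx w)).
  rewrite -[mxentire _ _]mulmx1 -mxslope_diag// ?mulmx1 ?mul1mx//.
  by apply: mxslope_continuous => //; [exact: cmx_cvg|exact: mxcvg_cst].
have : cmx_inv (S h) @[h --> (0 : C)^'] --> (centire (coef_diff c) w : C).
  by apply: cplx_cvg => /=; exact: Sc.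
apply: cvg_trans; apply: near_eq_cvg; near=> h.
by rewrite SE//; near: h; exact: nbhs_dnbhs_neq.
Unshelve. all: by end_near. Qed.

Lemma centire_derivable c (w : C) : entire c ->
  derivable (centire c : C -> C) w 1.
Proof.
move=> ec; apply/cvg_ex; exists (centire (coef_diff c) w : C).
rewrite (_ : (fun h => _) =
    (fun h : C => h^-1 * (centire c (h + w) - centire c w))).
  exact: centire_slope_cvg.
by apply/funext => h; rewrite /= /GRing.scale/= mulr1.
Qed.

Lemma centire_derive c (w : C) : entire c ->
  derive1 (centire c : C -> C) w = centire (coef_diff c) w.
Proof. by move=> ec; apply: cvg_lim; [|exact: centire_slope_cvg]. Qed.

(** Real derivative of [exp (t A / 2)]. *)
Lemma mxentire_exp2_derive n (A : 'M[R]_n) i j (s : R) :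
  is_derive (s : R^o) 1 (fun t => mxentire exp2 (t *: A) i j : R^o)
    (2^-1 * (A *m mxentire exp2 (s *: A)) i j).
Proof.
have cline : mxcvg (nbhs s) (fun t : R => t *: A) (s *: A).
  by apply: mxcvgZ; [exact: cvg_id|exact: mxcvg_cst].
have -> : 2^-1 * (A *m mxentire exp2 (s *: A)) i j =
    mxslope exp2 (s *: A) (s *: A) A i j by rewrite mxslope_exp2 [RHS]mxE.
apply: (@caratheodory_derive _ _ (fun t => mxslope exp2 (t *: A) (s *: A) A i j)).
  by move=> t; have /matrixP/(_ i j) := mxslope_line A t s entire_exp2; rewrite !mxE.
by apply: mxslope_continuous => //; exact: mxcvg_cst.
Qed.

(** The power series of the exponential has the values of the exponential:
    its product with [exp (- t z / 2)] has derivative zero in the real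
    variable [t]. *)
Lemma centire_exp2 (z : R[i]) : centire exp2 z = cexp (z / 2).
Proof.
case: z => x y; set z := (x +i* y)%C.
pose a := x / 2; pose b := y / 2.
have -> : cexp (z / 2) = (expR a * cos b +i* (expR a * sin b))%C.
  rewrite [z / 2](_ : _ = (a +i* b)%C)//.
  have t0 : 2 != 0 :> R[i] by rewrite pnatr_eq0.
  apply: (canLR (mulfK t0)); rewrite mulr_natr mulr2n.
  by apply/eqP; rewrite eq_complex /= -!splitr !eqxx.
pose U (t : R) : R := mxentire exp2 (t *: cmx z) 0 0.
pose V (t : R) : R := mxentire exp2 (t *: cmx z) 0 1.
have tz (t : R) : t *: cmx z = cmx (t%:C%C * z) by rewrite cmxM cmx_real mul_scalar_mx.
have ent (t : R) : mxentire exp2 (t *: cmx z) = cmx (U t +i* V t)%C.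
  by rewrite tz -(cmx_centire _ entire_exp2); congr cmx; rewrite /U /V tz.
have dU (t : R) : is_derive (t : R^o) 1 (U : R^o -> R^o) (a * U t - b * V t).
  have := mxentire_exp2_derive (cmx z) 0 0 t; rewrite ent.
  rewrite !mxE !big_ord_recl big_ord0 !mxE /= => h.
  by rewrite [_ - _](_ : _ = 2^-1 * (x * U t + (y * - V t + 0)))// /a /b; ring.
have dV (t : R) : is_derive (t : R^o) 1 (V : R^o -> R^o) (a * V t + b * U t).
  have := mxentire_exp2_derive (cmx z) 0 1 t; rewrite ent.
  rewrite !mxE !big_ord_recl big_ord0 !mxE /= => h.
  by rewrite [_ + _](_ : _ = 2^-1 * (x * V t + (y * U t + 0)))// /a /b; ring.
pose e (t : R) : R := expR (- a * t); pose c (t : R) : R := cos (b * t).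
pose q (t : R) : R := sin (b * t).
have dlin (k t : R) : is_derive (t : R^o) 1 (fun t : R^o => k * t : R^o) k.
  by apply: (@caratheodory_derive _ _ (fun=> k)) => [u|]; [ring|exact: cvg_cst].
have de t : is_derive (t : R^o) 1 (e : R^o -> R^o) (e t * (- a)).
  exact: (@is_derive1_comp _ expR (fun t : R^o => - a * t : R^o)).
have dc t : is_derive (t : R^o) 1 (c : R^o -> R^o) (- q t * b).
  exact: (@is_derive1_comp _ cos (fun t : R^o => b * t : R^o)).
have dq t : is_derive (t : R^o) 1 (q : R^o -> R^o) (c t * b).
  exact: (@is_derive1_comp _ sin (fun t : R^o => b * t : R^o)).
pose M (t : R) : R := e t * (c t * U t + q t * V t).
pose N (t : R) : R := e t * (c t * V t - q t * U t).
have dM (t : R) : is_derive (t : R^o) 1 (M : R^o -> R^o) 0.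
  apply: (@is_derive_eq _ _ _ (e * (c * U + q * V) : R^o -> R^o)).
  by rewrite /GRing.scale/=; rewrite !fctE; ring.
have dN (t : R) : is_derive (t : R^o) 1 (N : R^o -> R^o) 0.
  apply: (@is_derive_eq _ _ _ (e * (c * V - q * U) : R^o -> R^o)).
  by rewrite /GRing.scale/=; rewrite !fctE; ring.
have M1 : M 1 = M 0 by apply: is_derive_0_is_cst.
have N1 : N 1 = N 0 by apply: is_derive_0_is_cst.
have U0 : U 0 = 1 by rewrite /U scale0r mxentire_exp2_0 mxE.
have V0 : V 0 = 0 by rewrite /V scale0r mxentire_exp2_0 mxE.
have eb : expR a * expR (- a) = 1 by rewrite expRN mulfV// gt_eqF// expR_gt0.
move: M1 N1; rewrite /M /N /e /c /q U0 V0 !mulr1 !mulr0 cos0 sin0 expR0.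
rewrite ?mul0r ?mul1r ?mulr1 ?addr0 ?subr0.
have -> : centire exp2 z = (U 1 +i* V 1)%C.
  by rewrite /centire /cmx_inv /U /V !scale1r.
have cs := cos2Dsin2 b.
move: (U 1) (V 1) => u v M1 N1.
have M2 : cos b * u + sin b * v = expR a.
  by rewrite -[LHS]mul1r -eb -mulrA M1 mulr1.
have N2 : cos b * v - sin b * u = 0.
  by rewrite -[LHS]mul1r -eb -mulrA N1 mulr0.
have -> : u = expR a * cos b.
  transitivity (cos b * (cos b * u + sin b * v) -
      sin b * (cos b * v - sin b * u)).
    by rewrite -[LHS]mul1r -cs; ring.
  by rewrite M2 N2 mulr0 subr0 mulrC.
have -> // : v = expR a * sin b.
transitivity (sin b * (cos b * u + sin b * v) +
    cos b * (cos b * v - sin b * u)).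
  by rewrite -[LHS]mul1r -cs; ring.
by rewrite M2 N2 mulr0 addr0 mulrC.
Qed.

End ComplexDerivative.

(** * Taylor expansions and polynomials *)

Section Jets.
Context {K : numFieldType}.
Implicit Types (f g : K -> K) (q r : {poly K}) (a : K).

(** [jet d f q a]: near [a] the function [f] has derivatives of order less
    than [d], and they have at [a] the values of those of [q]. The recursion on
    the derivative makes the class stable under products and inverses. *)
Fixpoint jet d f q a : Prop :=
  if d is d'.+1 then
    [/\ f a = q.[a], \forall w \near a, derivable f w 1 &
        jet d' (derive1 f) q^`() a]
  else True.

Lemma jet_derive d f q a j : jet d f q a -> (j < d)%N ->
  q^`(j).[a] = derive1n j f a.
Proof.
elim: d f q j => [|d IHd] f q [|j] // [fa _ jf] jd; first by rewrite -fa.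
by rewrite derivSn (IHd _ _ _ jf jd) /derive1n iterSr.
Qed.

Lemma jetW d f q a : jet d.+1 f q a -> jet d f q a.
Proof.
elim: d f q => [|d IHd] f q //= [fa df [dfa ddf jf]].
by split=> //; apply: IHd.
Qed.

Lemma jet_near d f g q a : {near a, f =1 g} -> jet d f q a -> jet d g q a.
Proof.
elim: d f g q => [|d IHd] f g q //= fg [fa df jf]; split.
- by rewrite -(nbhs_singleton fg).
- near=> w; apply: (@near_eq_derivable _ _ _ f).
    by near: w; exact: (near_join fg).
  by near: w.
- apply: IHd jf; near=> w; rewrite !derive1E; apply: near_eq_derive.
  by near: w; exact: (near_join fg).
Unshelve. all: by end_near. Qed.

Lemma jetD d f g q r a : jet d f q a -> jet d g r a ->
  jet d (fun w => f w + g w) (q + r) a.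
Proof.
elim: d f g q r => [|d IHd] f g q r //= [fa df jf] [ga dg jg]; split.
- by rewrite fa ga hornerD.
- by near=> w; apply: derivableD; [near: w; exact: df|near: w; exact: dg].
- rewrite derivD; apply: jet_near (IHd _ _ _ _ jf jg).
  near=> w; rewrite !derive1E deriveD; [by []|near: w; exact: df|].
  by near: w; exact: dg.
Unshelve. all: by end_near. Qed.

Lemma jetM d f g q r a : jet d f q a -> jet d g r a ->
  jet d (fun w => f w * g w) (q * r) a.
Proof.
elim: d f g q r => [|d IHd] f g q r //= jF jG.
have [fa df jf] := jF; have [ga dg jg] := jG; split.
- by rewrite fa ga hornerM.
- near=> w; apply: derivableM; [near: w; exact: df|near: w; exact: dg].
- have jf' := jetW jF; have jg' := jetW jG.
  rewrite derivM; apply: jet_near (jetD (IHd _ _ _ _ jf jg') (IHd _ _ _ _ jf' jg)).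
  near=> w; rewrite !derive1E deriveM; [|near: w; exact: df|near: w; exact: dg].
  by rewrite /GRing.scale/= [RHS]addrC [X in _ = X + _]mulrC.
Unshelve. all: by end_near. Qed.

Lemma jetN d f q a : jet d f q a -> jet d (fun w => - f w) (- q) a.
Proof.
elim: d f q => [|d IHd] f q //= [fa df jf]; split.
- by rewrite fa hornerN.
- near=> w; apply: derivableN; by near: w.
- rewrite derivN; apply: jet_near (IHd _ _ jf).
  near=> w; rewrite !derive1E deriveN//; by near: w.
Unshelve. all: by end_near. Qed.

Lemma dvdp_deriv d q a : ('X - a%:P) ^+ d.+1 %| q -> ('X - a%:P) ^+ d %| q^`().
Proof.
move=> /dvdpP[s ->]; rewrite derivM deriv_exp/= derivXsubC mul1r dvdp_add//.
  by rewrite exprS dvdp_mull// dvdp_mull.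
by rewrite dvdp_mull// -mulr_natl dvdp_mull.
Qed.

Lemma dvdp_root_pow d q a : (0 < d)%N -> ('X - a%:P) ^+ d %| q -> q.[a] = 0.
Proof.
move=> d0 h; apply/eqP; rewrite -/(root q a) -dvdp_XsubCl.
by apply: dvdp_trans h; rewrite -(prednK d0) exprS dvdp_mulr.
Qed.

Lemma jet_mod d f q r a : ('X - a%:P) ^+ d %| q - r -> jet d f q a ->
  jet d f r a.
Proof.
elim: d f q r => [|d IHd] f q r //= qr [fa df jf]; split=> //.
  by apply/eqP; rewrite fa -subr_eq0 -hornerN -hornerD (dvdp_root_pow _ qr).
by apply: IHd jf; rewrite -derivB dvdp_deriv.
Qed.

Lemma jetV d g r s a : g a != 0 -> ('X - a%:P) ^+ d %| s * r - 1 ->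
  jet d g r a -> jet d (fun w => (g w)^-1) s a.
Proof.
move=> ga0; elim: d s => [|d IHd] s //= sr jG.
have [ga dg jg] := jG; have jg' := jetW jG.
have js : jet d (fun w => (g w)^-1) s a.
  by apply: IHd jg'; apply: dvdp_trans sr; rewrite exprS dvdp_mull.
have g0 : \forall w \near a, g w != 0.
  have dga := nbhs_singleton dg.
  have : g w @[w --> a] --> g a.
    exact/differentiable_continuous/derivable1_diffP.
  by move/cvgr_neq0; exact.
split.
- have := dvdp_root_pow (ltn0Sn d) sr; rewrite hornerD hornerM hornerN hornerC.
  move/eqP; rewrite subr_eq0 -ga => /eqP sg.
  by apply: (mulIf ga0); rewrite sg mulVf.
- by near=> w; apply: derivableV; near: w.
- have h := jetN (jetM (jetM js js) jg).
  apply: (@jet_mod _ _ (- (s * s * r^`())) _ a); last first.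
    apply: jet_near h; near=> w; rewrite !derive1E deriveV//; [|by near: w|by near: w].
    by rewrite /GRing.scale/= mulNr expr2 invfM.
  have /dvdp_deriv := sr; rewrite derivB derivC subr0 derivM => h1.
  have h2 : ('X - a%:P) ^+ d %| s * r - 1.
    by apply: dvdp_trans sr; rewrite exprS dvdp_mull.
  have -> : - (s * s * r^`()) - s^`() =
      s^`() * (s * r - 1) - s * (s^`() * r + s * r^`()) by ring.
  by rewrite dvdp_sub// dvdp_mull.
Unshelve. all: by end_near. Qed.

(** In characteristic 0, vanishing derivatives detect the multiplicity of a
    root. *)
Lemma dvdp_derivn0 d p a : (forall j, (j < d)%N -> p^`(j).[a] = 0) ->
  ('X - a%:P) ^+ d %| p.
Proof.
elim: d p => [|d IHd] p p0; first by rewrite expr0 dvd1p.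
have [->|pn0] := eqVneq p 0; first by rewrite dvdp0.
have [k [q q0 pE]] := multiplicity_XsubC p a; rewrite pn0/= in q0.
case: k pE => [|k] pE.
  have := p0 0%N isT; rewrite derivn0 pE expr0 mulr1 => /eqP.
  by rewrite -/(root q a) (negbTE q0).
rewrite pE dvdp_mull// dvdp_exp2l// ltnS leqNgt; apply/negP => kd.
have h : ('X - a%:P) ^+ d %| p^`().
  by apply: IHd => j jd; rewrite -derivSn; exact: p0.
have E : p^`() = (q^`() * ('X - a%:P) + q *+ k.+1) * ('X - a%:P) ^+ k.
  rewrite pE derivM deriv_exp derivXsubC mul1r mulrDl -mulrA -exprS.
  by rewrite mulrnAr mulrnAl.
have := dvdp_trans (dvdp_exp2l ('X - a%:P) kd) h.
rewrite E exprS dvdp_mul2r ?expf_neq0 ?polyXsubC_eq0//.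
rewrite dvdp_addr ?dvdp_mull// dvdp_XsubCl -scaler_nat rootZ ?pnatr_eq0//.
by rewrite (negbTE q0).
Qed.

End Jets.

Section EntireJets.
Context {R : realType}.
Local Notation C := (@cplx R).
Local Notation toC := (real_complex R).
Implicit Types (c num den : nat -> R).

Lemma jet_centire d c (q : {poly C}) (a : C) : entire c ->
  (forall j, (j < d)%N -> q^`(j).[a] = centire (iter j coef_diff c) a) ->
  jet d (centire c : C -> C) q a.
Proof.
elim: d c q => [|d IHd] c q ec qa //=; split.
- by have := qa 0%N isT; rewrite derivn0 => ->.
- by near=> w; exact: centire_derivable.
- have -> : derive1 (centire c : C -> C) = centire (coef_diff c).
    by apply/funext => w; exact: centire_derive.
  apply: IHd; first exact: entire_diff.
  by move=> j jd; rewrite -derivSn qa// iterSr.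
Unshelve. all: by end_near. Qed.

Lemma dvdp_pow_derivn d (p : {poly C}) (a : C) j : (j < d)%N ->
  ('X - a%:P) ^+ d %| p -> p^`(j).[a] = 0.
Proof.
elim: j d p => [|j IHj] [|d] p // jd h.
  by rewrite derivn0; exact: dvdp_root_pow h.
by rewrite derivSn; apply: (IHj d) => //; exact: dvdp_deriv.
Qed.

(** The derivatives of the remainders of the partial sums converge at the
    multiple roots of [Psi] to those of the entire function. *)
Lemma jet_reduction (Psi : {poly R}) D (sPsi : size Psi = D.+2) c d (a : C) :
  entire c -> ('X - a%:P) ^+ d %| map_poly toC Psi ->
  jet d (centire c : C -> C) (map_poly toC (reduction Psi D c)) a.
Proof.
move=> ec aPsi; apply: jet_centire => // j jd.
have ecj : entire (iter j coef_diff c).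
  by elim: j {jd} => //= j IHj; exact: entire_diff.
rewrite derivn_map; apply: cmx_inj; rewrite cmx_horner cmx_centire//.
have h := @peval_reduction_derivn_cvg R Psi D c j _ (cmx a) ec.
have h2 : mxcvg \oo (fun N => peval (reduction_sum Psi D c (N + j))^`(j) (cmx a))
    (peval (reduction Psi D c)^`(j) (cmx a)).
  move=> k l; have := h k l.
  by rewrite -(cvg_shiftn j).
apply: (mxcvg_unique (FF := eventually_filter) h2).
have := mxentire_cvg (cmx a) ecj; congr (mxcvg _ _ _); apply/funext => N.
rewrite -peval_psum -psum_derivn -!cmx_horner -!derivn_map; congr cmx.
apply/eqP; rewrite -subr_eq0 -hornerN -hornerD -derivnB -rmorphB/=.
apply/eqP; apply: (dvdp_pow_derivn jd); apply: dvdp_trans aPsi _.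
rewrite dvdp_map reduction_sumE//.
by rewrite [X in X - _](divp_eq _ Psi) addrK dvdp_mull.
Qed.

Section Quotient.
Variables (num den : nat -> R) (n : nat) (A : 'M[R]_n.+1).
Hypotheses (enum : entire num) (eden : entire den).
Local Notation chi := (char_poly A).
Local Notation D := (n.+1 * n.+1).-1.
Local Notation Psi := (chi ^+ n.+1).

Let size_Psi : size Psi = D.+2.
Proof.
have P0 : Psi != 0 by rewrite expf_neq0// monic_neq0// char_poly_monic.
by rewrite [LHS]polySpred// size_exp size_char_poly.
Qed.

Let Psi_root (a : C) : root (map_poly toC chi) a ->
  ('X - a%:P) ^+ n.+1 %| map_poly toC Psi.
Proof. by move=> ra; rewrite rmorphXn/= dvdp_exp2r// dvdp_XsubCl. Qed.

Let Psi0 : peval Psi A = 0.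
Proof. by rewrite exprS pevalM peval_char_poly mul0mx. Qed.

Lemma entire_poly c : entire c -> exists q : {poly R},
  peval q A = mxentire c A /\
  forall a : C, root (map_poly toC chi) a ->
    jet n.+1 (centire c : C -> C) (map_poly toC q) a.
Proof.
move=> ec; exists (reduction Psi D c); split; first exact: peval_reduction.
by move=> a ra; apply: jet_reduction => //; exact: Psi_root.
Qed.

Lemma root_eigenvector (a : C) : root (map_poly toC chi) a ->
  exists2 v : 'rV[C]_n.+1, v != 0 &
    forall q : {poly R}, v *m map_mx toC (peval q A) =
      (map_poly toC q).[a] *: v.
Proof.
rewrite map_char_poly -eigenvalue_root_char => /eigenvalueP[v va v0].
exists v => // q; rewrite peval_horner map_horner_mx.
elim/poly_ind: q => [|q c IHq].
  by rewrite !rmorph0 horner0 scale0r mulmx0.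
rewrite !rmorphD !rmorphM/= !map_polyX !map_polyC/= horner_mx_X horner_mx_C.
rewrite mulmxDr [_ * map_mx _ _]/(_ *m _) mulmxA IHq hornerMXaddC.
by rewrite -scalemxAl va mul_mx_scalar scalerA scalerDl.
Qed.

Lemma coprimep_char_poly (q : {poly R}) :
  (forall a : C, root (map_poly toC chi) a -> (map_poly toC q).[a] != 0) ->
  coprimep chi q.
Proof.
move=> h; rewrite -(coprimep_map (real_complex R)); apply/coprimepP => s s1 s2.
rewrite -size_poly_eq1; apply: contraT => /closed_rootP[a sa].
have rs (p : {poly C}) : s %| p -> root p a.
  by rewrite -dvdp_XsubCl => sp; apply: dvdp_trans sp; rewrite dvdp_XsubCl.
by have := h a (rs _ s1); rewrite -/(root (map_poly toC q) a) (rs _ s2).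
Qed.

(** The determinant of [den(A)] vanishes exactly when [den] vanishes at some
    complex eigenvalue. *)
Lemma mxentire_unitP c : entire c ->
  mxentire c A \in unitmx <->
  (forall a : C, root (map_poly toC chi) a -> centire c a != 0).
Proof.
move=> ec; have [q [qA qj]] := entire_poly ec.
have qa (a : C) : root (map_poly toC chi) a -> (map_poly toC q).[a] = centire c a.
  by move=> /qj [-> _ _].
split=> [u a ra|h].
  have [v v0 vq] := root_eigenvector ra; apply/negP => /eqP c0.
  have := vq q; rewrite qa// c0 scale0r qA => v1.
  have uC : map_mx toC (mxentire c A) \in unitmx by rewrite map_unitmx.
  by move: v0; rewrite -(mulmxK uC v) v1 mul0mx eqxx.
have cop : coprimep chi q.
  by apply: coprimep_char_poly => a ra; rewrite qa// h.
have /Bezout_eq1_coprimepP[[u v] /= uv] := cop.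
have : peval (u * chi + v * q) A = 1%:M by rewrite uv peval_horner rmorph1.
rewrite pevalD !pevalM peval_char_poly mulmx0 add0r qA => /mulmx1_unit.
by case.
Qed.

(** If no eigenvalue of [A] is a zero of [den], the quotient of the entire
    functions is a polynomial at [A] and to any order at the eigenvalues. *)
Lemma quotient_poly : mxentire den A \in unitmx -> exists q : {poly R},
  peval q A = mxquot num den A /\
  forall a : C, root (map_poly toC chi) a ->
    jet n.+1 (fun w : C => (centire den w)^-1 * centire num w : C)
      (map_poly toC q) a.
Proof.
move=> uden; have [qn [qnA qnj]] := entire_poly enum.
have [qd [qdA qdj]] := entire_poly eden.
have hden := (mxentire_unitP eden).1 uden.
have cop : coprimep qd Psi.
  rewrite coprimep_sym coprimep_expl//; apply: coprimep_char_poly => a ra.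
  by have [<- _ _] := qdj a ra; exact: hden.
have /Bezout_eq1_coprimepP[[u v] /= uv] := cop.
have uvP : Psi %| u * qd - 1 by rewrite -uv opprD addNKr dvdpNr dvdp_mull.
exists (u * qn); split.
  have uA : peval u A *m mxentire den A = 1%:M.
    by rewrite -qdA -pevalM (peval_mod Psi0 uvP) peval_horner rmorph1.
  rewrite pevalM qnA /mxquot; congr (_ *m _).
  by rewrite -[LHS](mulmxK uden) uA mul1mx.
move=> a ra; rewrite rmorphM/=.
have jV : jet n.+1 (fun w : C => (centire den w)^-1 : C) (map_poly toC u) a.
  apply: (@jetV C _ _ (map_poly toC qd)); [exact: hden| |exact: qdj].
  apply: dvdp_trans (Psi_root ra) _.
  by rewrite -rmorphM/= -[1](rmorph1 (map_poly toC)) -rmorphB/= dvdp_map.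
exact: (@jetM C _ _ (centire num : C -> C) _ _ _ jV (qnj a ra)).
Qed.

End Quotient.

Lemma root_peval0 n (M : 'M[R]_n) q (z : C) : peval q M = 0 ->
  root (map_poly toC (char_poly M)) z -> root (map_poly toC q) z.
Proof.
case: n M => [|n] M; first by rewrite /char_poly det_mx00 rmorph1 (negbTE (root1 _)).
move=> qM rz; have [v v0 vq] := root_eigenvector rz.
have := vq q; rewrite qM map_mx0 mulmx0 => /esym/eqP.
by rewrite scaler_eq0 (negbTE v0) orbF.
Qed.

Lemma mxentire_unit_spectrum n (M : 'M[R]_n) c : entire c ->
  mxentire c M \in unitmx <->
  (forall a : C, root (map_poly toC (char_poly M)) a -> centire c a != 0).
Proof.
case: n M => [|n] M ec; last exact: mxentire_unitP.
split=> [_ a|_]; last by rewrite unitmxE det_mx00 unitr1.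
by rewrite /char_poly det_mx00 rmorph1 (negbTE (root1 _)).
Qed.

End EntireJets.

(** * The hyperbolic cotangent *)

Section Coth.
Context {R : realType}.
Local Notation C := (@cplx R).
Implicit Types (z w : R[i]).

Lemma cexpD z w : cexp (z + w) = cexp z * cexp w.
Proof.
case: z w => [a b] [c d]; rewrite /cexp /= expRD cosD sinD.
by apply/eqP; rewrite eq_complex /=; apply/andP; split; apply/eqP; ring.
Qed.

Lemma cexp0 : cexp (0 : R[i]) = 1.
Proof. by rewrite /cexp /= cos0 sin0 expR0 mulr1 mulr0. Qed.

Lemma cexp_neq0 z : cexp z != 0.
Proof.
apply/eqP => z0; have := cexpD z (- z); rewrite subrr cexp0 z0 mul0r.
by move/eqP; rewrite oner_eq0.
Qed.

Lemma half_exp_pos z : centire cosh2 z + centire sinh2 z = cexp (z / 2).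
Proof.
rewrite -centire_exp2; apply: cmx_inj.
by rewrite cmxD !cmx_centire// mx_exp2E.
Qed.

Lemma half_exp_neg z : centire cosh2 z - centire sinh2 z = cexp (- z / 2).
Proof.
rewrite -centire_exp2; apply: cmx_inj.
rewrite cmxD cmxN !cmx_centire// cmxN mx_exp2E.
rewrite mxentireN_even; last exact: cosh2_odd.
by rewrite mxentireN_odd//; exact: sinh2_even.
Qed.

Lemma sinhc2M z : z * centire sinhc2 z = 2 * centire sinh2 z.
Proof.
apply: cmx_inj; rewrite cmxM cmx_centire// mx_sinhc2M mulr_natl mulr2n.
by rewrite cmxD cmx_centire// scalerDl scale1r.
Qed.

Lemma fnum2M z : z * centire fnum2 z = centire cosh2 z - centire sinhc2 z.
Proof.
by apply: cmx_inj; rewrite cmxM cmxD cmxN !cmx_centire// mx_fnum2M.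
Qed.

Lemma centire0 c : entire c -> centire c (0 : R[i]) = (c 0%N)%:C%C.
Proof.
move=> ec; apply: cmx_inj; rewrite cmx_centire// cmx_real.
have -> : cmx (0 : R[i]) = 0 by apply: matrix2P; rewrite !mxE /= ?oppr0.
have E N : mxentire_sum c (0 : 'M[R]_2) N.+1 = (c 0%N)%:M.
  rewrite /mxentire_sum big_ord_recl big1 ?addr0 => [|k _].
    by rewrite expr0 scalemx1.
  by rewrite expr0n/= scaler0.
apply: (mxcvg_unique (FF := eventually_filter) (mxentire_cvg _ ec)) => i j.
rewrite -(cvg_shiftS (fun N => mxentire_sum c 0 N i j)).
by under eq_fun do rewrite E; exact: cvg_cst.
Qed.

Lemma sinhc2_0 : centire sinhc2 (0 : R[i]) = 1.
Proof.
rewrite centire0// /sinhc2 /sinh2 /exp2/= (_ : 1`! = 1%N)// expr1 divr1.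
by rewrite mulfV ?pnatr_eq0.
Qed.

Lemma fnum2_0 : centire fnum2 (0 : R[i]) = 0.
Proof. by rewrite centire0// fnum2_even. Qed.

Lemma ccothE z :
  ccoth z = centire cosh2 (2 * z) / centire sinh2 (2 * z).
Proof.
have t0 : 2 != 0 :> R[i] by rewrite pnatr_eq0.
have := half_exp_pos (2 * z); have := half_exp_neg (2 * z).
rewrite -mulrN ![2 * _]mulrC !mulfK// /ccoth => <- <-.
set c := centire _ _; set s := centire _ _.
have -> : c + s + (c - s) = 2 * c by ring.
have -> : c + s - (c - s) = 2 * s by ring.
by rewrite invfM mulrACA mulfV// mul1r.
Qed.

Lemma fdynE z : centire sinhc2 z != 0 ->
  fdyn z = (centire sinhc2 z)^-1 * centire fnum2 z.
Proof.
move=> s0; rewrite /fdyn; have [->|z0] := eqVneq z 0.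
  by rewrite fnum2_0 mulr0.
have t0 : 2 != 0 :> R[i] by rewrite pnatr_eq0.
rewrite ccothE (_ : 2 * (z / 2) = z); last by rewrite mulrC divfK.
have := sinhc2M z; have := fnum2M z; move: s0.
set d := centire sinhc2 z; set nu := centire fnum2 z.
set s := centire sinh2 z; set c := centire cosh2 z => d0 e1 e2.
have -> : c = z * nu + d by rewrite e1 subrK.
have -> : s = z * d / 2 by rewrite e2 mulrC mulKf.
by field; rewrite z0 d0.
Qed.

(** Zeros of [sinhc2] are simple zeros of [sinh (z / 2)], so they are isolated
    in every horizontal direction and [fnum2] does not vanish there. *)
Lemma sinhc2_eq0 z : (centire sinhc2 z == 0) = (z != 0) && (cexp z == 1).
Proof.
have [->|z0] := eqVneq z 0; first by rewrite sinhc2_0 oner_eq0.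
have t0 : 2 != 0 :> R[i] by rewrite pnatr_eq0.
have -> : (centire sinhc2 z == 0) = (centire sinh2 z == 0).
  have := congr1 (fun w => w == 0) (sinhc2M z); rewrite !mulf_eq0.
  by rewrite (negbTE z0) (negbTE t0).
have := half_exp_pos z; have := half_exp_neg z.
have E : cexp z = cexp (z / 2) * cexp (z / 2).
  by rewrite -cexpD -splitr.
have E0 : cexp (z / 2) * cexp (- z / 2) = 1.
  by rewrite -cexpD mulNr subrr cexp0.
rewrite E /=; move: E0 => + h1 h2; rewrite -h1 -h2.
set c := centire _ _; set s := centire _ _ => E0.
apply/eqP/eqP => [s0|h].
  by move: E0; rewrite s0 subr0 addr0.
have cs : c + s != 0 by rewrite h2 cexp_neq0.
have : (c + s) * (c - s) = (c + s) * (c + s) by rewrite E0 h.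
move/(mulfI cs)/addrI/eqP; rewrite -subr_eq0 -opprD oppr_eq0 -mulr2n -mulr_natr.
by rewrite mulf_eq0 (negbTE t0) orbF => /eqP.
Qed.

End Coth.

Section Scaling.
Context {K : numFieldType}.
Implicit Types (f : K -> K) (q : {poly K}) (a k : K).

Lemma cvg_slope_scale f k a : k != 0 -> derivable f (k * a) 1 ->
  (fun h : K => h^-1 * (f (k * (h + a)) - f (k * a))) h @[h --> 0^'] -->
  k * derive1 f (k * a).
Proof.
move=> k0 df.
have kh : k * h @[h --> (0 : K)^'] `=>` (0 : K)^'.
  move=> P /= P0; have kc : k * h @[h --> (0 : K)] --> (0 : K).
    suff : k * h @[h --> (0 : K)] --> k * 0 by rewrite mulr0.
    exact: mulrl_continuous.
  have := kc _ P0; apply: (@filterS _ _ (nbhs_filter (0 : K))) => h /= Ph h0.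
  by apply: Ph; rewrite mulf_neq0.
have h1 : (fun h : K => h^-1 * (f (h + k * a) - f (k * a))) h @[h --> 0^'] -->
    derive1 f (k * a).
  move: df; rewrite /derivable; under eq_fun do rewrite [_ *: 1]mulr1.
  exact.
have h2 := cvg_comp _ _ kh h1.
have h3 : k * ((k * h)^-1 * (f (k * h + k * a) - f (k * a)))
    @[h --> (0 : K)^'] --> k * derive1 f (k * a).
  by apply: cvgM h2; exact: cvg_cst.
apply: cvg_trans h3; apply: near_eq_cvg; near=> h.
by rewrite mulrA invfM mulrA mulfV// mul1r -mulrDr.
Unshelve. all: by end_near. Qed.

Lemma derivable_scale f k a : k != 0 -> derivable f (k * a) 1 ->
  derivable (fun w => f (k * w)) a 1.
Proof.
move=> k0 df; apply/cvg_ex; exists (k * derive1 f (k * a)).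
have := cvg_slope_scale k0 df; rewrite [X in X @ _ --> _](_ : _ =
  (fun h : K => h^-1 *: (((fun w => f (k * w)) \o shift a) (h *: 1) - f (k * a))))//.
by apply/funext => h /=; rewrite [h *: 1]mulr1.
Qed.

Lemma derive1_scale f k a : k != 0 -> derivable f (k * a) 1 ->
  derive1 (fun w => f (k * w)) a = k * derive1 f (k * a).
Proof. by move=> k0 df; apply: cvg_lim; [|exact: cvg_slope_scale]. Qed.

End Scaling.

Lemma jet_cst (K : numFieldType) d (c a : K) : jet d (fun=> c) c%:P a.
Proof.
elim: d c => //= d IHd c; split.
- by rewrite hornerC.
- by near=> w; exact: derivable_cst.
- rewrite derivC; have -> : derive1 (fun=> c : K) = (fun=> 0 : K).
    by apply/funext => w; rewrite derive1_cst.
  exact: IHd.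
Unshelve. all: by end_near. Qed.

Lemma jet_scale (K : numFieldType) d (f : K -> K) (q : {poly K}) (k a : K) :
  k != 0 -> jet d f q (k * a) -> jet d (fun w => f (k * w)) (q \Po (k *: 'X)) a.
Proof.
move=> k0; elim: d f q => [|d IHd] f q //= [fa df jf].
have kc : k * w @[w --> a] --> k * a.
  exact: mulrl_continuous.
have df' : \forall w \near a, derivable f (k * w) 1 by exact: kc df.
split.
- by rewrite fa horner_comp hornerZ hornerX.
- by near=> w; apply: derivable_scale => //; near: w; exact: df'.
- rewrite deriv_comp derivZ derivX.
  have jk : jet d (fun=> k : K) (k *: 1) a.
    have : (k *: 1 : {poly K}) = k%:P by rewrite -mul_polyC mulr1.
    by move=> ->; exact: jet_cst.
  apply: jet_near (jetM (IHd _ _ jf) jk).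
  by near=> w; rewrite derive1_scale//; [exact: mulrC|near: w; exact: df'].
Unshelve. all: by end_near. Qed.

Section Holomorphic.
Context {R : realType}.
Local Notation C := (@cplx R).
Local Notation toC := (real_complex R).

Lemma holomorphic_quotient (f num den : C -> C) (a : C) :
  (forall w, derivable num w 1) -> (forall w, derivable den w 1) ->
  (forall w, den w != 0 -> f w = (den w)^-1 * num w) ->
  den a != 0 -> {near a, f =1 (fun w => (den w)^-1 * num w)} /\ holomorphic_at f a.
Proof.
move=> dnum dden fE da.
have dc : den w @[w --> a] --> den a.
  exact/differentiable_continuous/derivable1_diffP.
have nz : \forall w \near a, den w != 0.
  exact: (cvgr_neq0 (FF := nbhs_filter a) _ dc da).
have ne : {near a, f =1 (fun w => (den w)^-1 * num w)}.
  by near=> w; apply: fE; near: w.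
split=> //; near=> w; apply: (@near_eq_derivable _ _ _ (fun w => (den w)^-1 * num w)).
  have : {near w, f =1 (fun w => (den w)^-1 * num w)}.
    by near: w; exact: (near_join ne).
  by apply: filterS => v ->.
apply: derivableM; last exact: dnum.
by apply: derivableV; [near: w; exact: nz|exact: dden].
Unshelve. all: by end_near. Qed.

(** A quotient has a pole, and is not even continuous, at a zero of its
    denominator that is isolated on the horizontal line and is not a zero of
    the numerator. *)
Lemma not_derivable_pole (f num den : C -> C) (a : C) :
  (forall w, derivable num w 1) -> (forall w, derivable den w 1) ->
  (forall w, den w != 0 -> f w = (den w)^-1 * num w) ->
  den a = 0 -> num a != 0 ->
  (forall t : R, t != 0 -> den (t%:C%C + a) != 0) -> ~ derivable f a 1.
Proof.
move=> dnum dden fE da na dt df.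
have cont (h : C -> C) : derivable h a 1 -> h w @[w --> a] --> h a.
  by move=> dh; exact/differentiable_continuous/derivable1_diffP.
have line : (t%:C%C + a : C) @[t --> (0 : R)^'] --> a.
  apply: cplx_cvg => /=.
    apply: cvg_within_filter; have : t + complex.Re a @[t --> (0 : R)] --> 0 + complex.Re a.
      by apply: cvgD; [exact: cvg_id|exact: cvg_cst].
    by rewrite add0r; case: a {da na dt df cont}.
  case: a {da na dt df cont} => x y /=.
  by under eq_fun do rewrite add0r; exact: cvg_cst.
have h1 : f (t%:C%C + a) * den (t%:C%C + a) @[t --> (0 : R)^'] --> f a * den a.
  by apply: cvgM; [exact: (cvg_comp _ _ line (cont _ df))
                  |exact: (cvg_comp _ _ line (cont _ (dden a)))].
have h2 : f (t%:C%C + a) * den (t%:C%C + a) @[t --> (0 : R)^'] --> num a.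
  have h : num (t%:C%C + a) @[t --> (0 : R)^'] --> num a.
    exact: (cvg_comp _ _ line (cont _ (dnum a))).
  apply: cvg_trans h; apply: near_eq_cvg; near=> t.
  have t0 : t != 0 by near: t; exact: nbhs_dnbhs_neq.
  by rewrite fE ?dt// mulrC mulrA mulfV ?dt// mul1r.
have : f a * den a = num a by exact: (cvg_unique _ h1 h2).
by rewrite da mulr0 => n0; move/eqP: na; apply; exact/esym.
Unshelve. all: by end_near. Qed.

Lemma cexp_real (t : R) : t != 0 -> cexp (t%:C%C) != 1.
Proof.
move=> t0; rewrite /cexp /= cos0 sin0 mulr1 mulr0 eq_complex /= eqxx andbT.
by rewrite -expR0 (inj_eq (@expR_inj R)).
Qed.

Lemma holomorphic_fdyn (a : R[i]) : holomorphic_at fdyn a <-> centire sinhc2 a != 0.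
Proof.
have dn (w : C) : derivable (centire fnum2 : C -> C) w 1 by exact: centire_derivable.
have dd (w : C) : derivable (centire sinhc2 : C -> C) w 1 by exact: centire_derivable.
split; last by move=> a0; have [] := holomorphic_quotient dn dd fdynE a0.
move=> /nbhs_singleton df; apply/negP => s0.
have := s0; rewrite sinhc2_eq0 => /andP[a0 /eqP ea].
apply: (not_derivable_pole dn dd fdynE _ _ _ df); first exact/eqP.
- have := fnum2M a; rewrite (eqP s0) subr0 => E; apply/eqP => n0.
  move: E; rewrite n0 mulr0 => c0.
  have := sinhc2M a; rewrite (eqP s0) mulr0 => /esym/eqP; rewrite mulf_eq0 pnatr_eq0/=.
  move=> /eqP h0; have := half_exp_pos a; rewrite -c0 h0 addr0 => /esym/eqP.
  by rewrite (negbTE (cexp_neq0 _)).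
- move=> t t0; rewrite sinhc2_eq0 negb_and; apply/orP; right.
  by rewrite cexpD ea mulr1 cexp_real.
Qed.

Lemma sinh2_eq0 (z : R[i]) : (centire sinh2 z == 0) = (cexp z == 1).
Proof.
have := congr1 (fun w => w == 0) (sinhc2M z).
rewrite !mulf_eq0 pnatr_eq0/= => <-; rewrite sinhc2_eq0.
by have [->|z0] := eqVneq z 0; rewrite ?cexp0 ?eqxx.
Qed.

Lemma holomorphic_ccoth (a : R[i]) :
  holomorphic_at ccoth a <-> centire sinh2 (2 * a) != 0.
Proof.
pose num (w : C) : C := centire cosh2 (2 * w).
pose den (w : C) : C := centire sinh2 (2 * w).
have dn w : derivable num w 1 by apply: derivable_scale; [rewrite pnatr_eq0|exact: centire_derivable].
have dd w : derivable den w 1 by apply: derivable_scale; [rewrite pnatr_eq0|exact: centire_derivable].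
have fE w : den w != 0 -> (ccoth : C -> C) w = (den w)^-1 * num w.
  by move=> _; rewrite ccothE mulrC.
split; last by move=> a0; have [] := holomorphic_quotient dn dd fE a0.
move=> /nbhs_singleton df; apply/negP => s0.
apply: (not_derivable_pole dn dd fE _ _ _ df); first exact/eqP.
- rewrite /num; apply/eqP => c0; have := half_exp_pos (2 * a).
  rewrite c0 (eqP s0) addr0 => /esym/eqP.
  by rewrite (negbTE (cexp_neq0 _)).
- move=> t t0; rewrite /den sinh2_eq0 mulrDr cexpD.
  move: s0; rewrite sinh2_eq0 => /eqP ->; rewrite mulr1.
  rewrite (_ : 2 * t%:C%C = (2 * t)%:C%C); last by rewrite rmorphM/= rmorph_nat.
  by apply: cexp_real; rewrite mulf_neq0 ?pnatr_eq0.
Qed.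

End Holomorphic.

(** * The functional calculus *)

Section Calculus.
Import passmx.
Context {R : realType} {W : vectType R}.
Local Notation C := (@cplx R).
Local Notation toC := (real_complex R).
Local Notation b := (vbasis {:W}).
Local Notation N := (\dim {:W}).
Implicit Types (A : 'End(W)) (q : {poly R}).

Definition mx_end A : 'M[R]_N := passmx.mxof b b A.

Let bP : basis_of {:W} b := vbasisP _.

Lemma mx_end_inj : injective mx_end.
Proof. exact: can_inj (passmx.mxofK bP bP). Qed.

Lemma mx_poly_lfun q A : mx_end (poly_lfun q A) = peval q (mx_end A).
Proof.
rewrite /mx_end /poly_lfun. rewrite linear_sum; apply: eq_bigr => j _.
rewrite linearZ/=; congr (_ *: _); elim: (nat_of_ord j) => [|k IHk].
  by rewrite /= passmx.mxof1// (basis_free bP).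
by rewrite iterS (mxof_comp b b bP) IHk mxXSr.
Qed.

Lemma spectrumP A (z : R[i]) :
  complex_spectrum A z <-> root (map_poly toC (char_poly (mx_end A))) z.
Proof. by rewrite map_char_poly -eigenvalue_root_char. Qed.

Lemma poly_lfun_annihilator q A (z : R[i]) : poly_lfun q A = 0 ->
  complex_spectrum A z -> root (map_poly toC q) z.
Proof.
move=> q0 /spectrumP; apply: root_peval0.
by rewrite -mx_poly_lfun q0 /mx_end linear0.
Qed.

Lemma poly_lfun_char_poly A : poly_lfun (char_poly (mx_end A)) A = 0.
Proof.
by apply: mx_end_inj; rewrite mx_poly_lfun peval_char_poly /mx_end linear0.
Qed.

Lemma dvdp_prod_roots (F : fieldType) (rs : seq F) (p : {poly F}) :
  {in rs, forall x, ('X - x%:P) ^+ size rs %| p} ->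
  \prod_(x <- rs) ('X - x%:P) %| p.
Proof.
elim: rs p => [|x rs IHrs] p h; first by rewrite big_nil dvd1p.
have /dvdpP[s ps] : 'X - x%:P %| p.
  apply: dvdp_trans (h x (mem_head _ _)); by rewrite exprS dvdp_mulr.
have x0 : 'X - x%:P != 0 by rewrite polyXsubC_eq0.
rewrite big_cons mulrC ps dvdp_mul2r//; apply: IHrs => y yrs.
have := h y; rewrite inE yrs orbT ps => /(_ isT).
have [->|yx] := eqVneq y x; first by rewrite exprSr dvdp_mul2r.
rewrite mulrC Gauss_dvdpr; last first.
  rewrite coprimep_expl// coprimep_XsubC root_XsubC.
  by rewrite eq_sym.
by move=> ?; apply: dvdp_trans (_ : _ %| _); [|eassumption]; rewrite exprS dvdp_mull.
Qed.

(** A polynomial with the Taylor expansions of [f] on the spectrum computes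
    [f(A)]: two such polynomials differ by a multiple of the characteristic
    polynomial. *)
Lemma calculus_polyE (f : R[i] -> R[i]) q A :
  (forall z : R[i], complex_spectrum A z ->
     jet N (f : C -> C) (map_poly toC q) z) ->
  calculus f A = poly_lfun q A.
Proof.
move=> fq; have mt (p : {poly R}) z j : complex_spectrum A z -> (j < N)%N ->
    jet N (f : C -> C) (map_poly toC p) z ->
    (map_poly toC p)^`(j).[z] = derive1n j (f : C -> C) z.
  by move=> _ jN jp; exact: jet_derive jp jN.
apply: xget_unique.
  by exists q; split=> // z zs j jN; apply: mt => //; exact: fq.
move=> _ [p [pf ->]]; apply: mx_end_inj; rewrite !mx_poly_lfun.
apply: (peval_mod (peval_char_poly _)).
rewrite -(dvdp_map (real_complex R)).
set chi := map_poly _ _; have [rs chiE] := closed_field_poly_normal chi.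
have cm : chi \is monic by rewrite /chi map_monic char_poly_monic.
have srs : size rs = N.
  have := size_char_poly (mx_end A); rewrite -(size_map_poly toC) -/chi chiE.
  by rewrite (monicP cm) scale1r size_prod_XsubC => -[].
move: chiE; rewrite (monicP cm) scale1r => chiE; rewrite chiE.
apply: dvdp_prod_roots => z zrs; rewrite srs.
have zs : complex_spectrum A z.
  by apply/spectrumP; rewrite -/chi chiE root_prod_XsubC.
apply: dvdp_derivn0 => j jN; rewrite rmorphB/= derivnB hornerD hornerN.
by rewrite pf// (mt q)// ?subrr//; exact: fq.
Qed.

End Calculus.

(** * Coordinates *)

Section Coordinates.
Context {R : realType} {g : vectType R} {n : nat}.
Variable E : n.-tuple g.
Hypothesis basisE : basis_of fullv E.
Implicit Types (x y : g).

Definition col_of x : 'cV[R]_n := \col_i coord E i x.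
Definition vec_of (c : 'cV[R]_n) : g := \sum_i c i 0 *: E`_i.
Definition mx_of (f : g -> g) : 'M[R]_n := \matrix_(i, j) coord E i (f E`_j).

Lemma col_of_is_linear : linear col_of.
Proof. by move=> a x y; apply/colP => i; rewrite !mxE linearP. Qed.

HB.instance Definition _ :=
  GRing.isLinear.Build R g 'cV[R]_n _ col_of col_of_is_linear.

Lemma vec_of_is_linear : linear vec_of.
Proof.
move=> a x y; rewrite /vec_of scaler_sumr -big_split; apply: eq_bigr => i _ /=.
by rewrite !mxE scalerDl scalerA.
Qed.

HB.instance Definition _ :=
  GRing.isLinear.Build R 'cV[R]_n g _ vec_of vec_of_is_linear.

Lemma col_ofK : cancel col_of vec_of.
Proof.
move=> x; rewrite [RHS](coord_basis basisE (memvf x)).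
by apply: eq_bigr => i _; rewrite mxE.
Qed.

Lemma vec_ofK : cancel vec_of col_of.
Proof.
by move=> c; apply/colP => i; rewrite mxE coord_sum_free// (basis_free basisE).
Qed.

Lemma col_of_app (f : {linear g -> g}) x : col_of (f x) = mx_of f *m col_of x.
Proof.
rewrite -{1}[x]col_ofK; apply/colP => i; rewrite !mxE !linear_sum.
by apply: eq_bigr => j _; rewrite !linearZ/= !mxE mulrC.
Qed.

Lemma mulmx_col_inj (M N : 'M[R]_n) :
  (forall x, M *m col_of x = N *m col_of x) -> M = N.
Proof.
move=> MN; apply/matrixP => i j; have := MN (vec_of (delta_mx j 0)).
by rewrite vec_ofK -!colE => /colP/(_ i); rewrite !mxE.
Qed.

Section Form.
Variable B : {bilinear g -> g -> R | *%R & *%R}.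

Definition gram : 'M[R]_n := \matrix_(i, j) B E`_i E`_j.

Lemma formE x y : B x y = form gram (col_of x) (col_of y).
Proof.
rewrite -{1}[x]col_ofK -{1}[y]col_ofK /form /vec_of linear_sumr mxE.
apply: eq_bigr => j _; rewrite linear_sumlz !mxE mulr_suml.
by apply: eq_bigr => i _; rewrite linearZr_LR linearZl_LR/= !mxE; ring.
Qed.

End Form.

Section Bracket.
Variable br : {bilinear g -> g -> g}.

Definition adm (c : 'cV[R]_n) : 'M[R]_n := mx_of (br (vec_of c)).

Lemma adm_is_linear : linear adm.
Proof.
move=> a x y; apply/matrixP => i j; rewrite !mxE !linearP/=.
by rewrite linearPl linearP.
Qed.

HB.instance Definition _ :=
  GRing.isLinear.Build R 'cV[R]_n 'M[R]_n _ adm adm_is_linear.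

Lemma adm_col x y : adm (col_of x) *m col_of y = col_of (br x y).
Proof. by rewrite /adm col_ofK -col_of_app. Qed.

End Bracket.

End Coordinates.

Section DualProjection.
Context {R : realType} {g : vectType R}.
Variable B : {bilinear g -> g -> R | *%R & *%R}.
Variables (V : {vspace g}) (m : nat) (e e' : m.-tuple g).
Hypothesis dualV : dual_bases B V e e'.
Implicit Types x y : g.

Definition dproj x : g := \sum_i B x (tnth e' i) *: tnth e i.

Lemma dproj_is_linear : linear dproj.
Proof.
move=> a x y; rewrite /dproj scaler_sumr -big_split; apply: eq_bigr => i _ /=.
by rewrite linearPl scalerDl scalerA.
Qed.

HB.instance Definition _ := GRing.isLinear.Build R g g _ dproj dproj_is_linear.

Lemma dproj_mem x : dproj x \in V.
Proof.
have [be _ _] := dualV; apply: memv_suml => i _; apply: memvZ.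
by apply: (basis_mem be); exact: mem_tnth.
Qed.

Let Be : forall i j : 'I_m, B e`_i e'`_j = (i == j)%:R.
Proof. by have [_ _ Be] := dualV => i j; rewrite -!tnth_nth Be. Qed.

Lemma dproj_id x : x \in V -> dproj x = x.
Proof.
have [be _ _] := dualV => xV; rewrite [RHS](coord_basis be xV).
apply: eq_bigr => i _; rewrite !(tnth_nth 0); congr (_ *: _).
rewrite {1}(coord_basis be xV) linear_sumlz (bigD1 i)//= big1 ?addr0.
  by rewrite linearZl_LR/= Be eqxx mulr1.
by move=> j ji; rewrite linearZl_LR/= Be (negbTE ji) mulr0.
Qed.

Lemma dual_basis : basis_of V e'.
Proof.
have [be e'V _] := dualV; rewrite basisEfree; apply/and3P; split.
- apply/freeP => c ce i; have := congr1 (B e`_i) ce.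
  rewrite linear0r linear_sumr (bigD1 i)//= big1 ?addr0 => [|j ji].
    by rewrite linearZr_LR/= Be eqxx mulr1.
  by rewrite linearZr_LR/= Be eq_sym (negbTE ji) mulr0.
- by apply/span_subvP => _ /tnthP[i ->]; exact: e'V.
- by rewrite size_tuple (size_basis be).
Qed.

Lemma dproj_form x y : y \in V -> B (dproj x) y = B x y.
Proof.
move=> /(coord_basis dual_basis) ->.
rewrite !linear_sumr; apply: eq_bigr => j _.
rewrite !linearZr_LR/=; congr (_ * _).
rewrite linear_sumlz (bigD1 j)//= big1 ?addr0 => [|i ij].
  by rewrite linearZl_LR/= (tnth_nth 0 e) Be eqxx mulr1 -tnth_nth.
by rewrite linearZl_LR/= (tnth_nth 0 e) Be (negbTE ij) mulr0.
Qed.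

End DualProjection.

Section Restriction.
Context {R : realType} {g : vectType R} {n : nat}.
Variables (E : n.-tuple g) (br : {bilinear g -> g -> g}).
Hypothesis basisE : basis_of fullv E.
Variables (V : {vspace g}) (mu : g).
Hypothesis stable : forall x, x \in V -> br mu x \in V.
Local Notation A := (adm E br (col_of E mu)).

Lemma vsval_ad_on (x : subvs_of V) :
  vsval (ad_on br V mu x) = br mu (vsval x).
Proof.
have -> : ad_on br V mu = linfun (vsproj V \o (br mu \o vsval)) by [].
rewrite lfunE/= vsprojK//; apply: stable; exact: subvsP.
Qed.

(** A polynomial in the restriction of [ad mu] to a stable subspace is the
    restriction of the polynomial in [ad mu]. *)
Lemma col_poly_lfun q (x : subvs_of V) :
  col_of E (vsval (poly_lfun q (ad_on br V mu) x)) =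
  peval q A *m col_of E (vsval x).
Proof.
rewrite /poly_lfun sum_lfunE linear_sum linear_sum /peval mulmx_suml.
apply: eq_bigr => j _; rewrite scale_lfunE linearZ/= -scalemxAl.
congr (_ *: _); elim: (nat_of_ord j) => [|k IHk].
  by rewrite /= id_lfunE expr0 mul1mx.
by rewrite iterS comp_lfunE vsval_ad_on mxXS -mulmxA -IHk adm_col.
Qed.

Lemma poly_lfun_eq0 q : (forall x, x \in V -> peval q A *m col_of E x = 0) ->
  poly_lfun q (ad_on br V mu) = 0.
Proof.
move=> qV; apply/lfunP => x; apply: val_inj; rewrite lfunE/=.
apply: (can_inj (col_ofK basisE)); rewrite col_poly_lfun linear0.
by apply: qV; exact: subvsP.
Qed.

Lemma peval_poly_lfun0 q x : x \in V -> poly_lfun q (ad_on br V mu) = 0 ->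
  peval q A *m col_of E x = 0.
Proof.
move=> xV q0; have := col_poly_lfun q (vsproj V x).
by rewrite q0 lfunE/= vsprojK// linear0 => <-.
Qed.

Lemma spectrum_ad_on (z : R[i]) : complex_spectrum (ad_on br V mu) z ->
  root (map_poly (real_complex R) (char_poly A)) z.
Proof.
apply: poly_lfun_annihilator; apply: poly_lfun_eq0 => x _.
by rewrite peval_char_poly mul0mx.
Qed.

End Restriction.

Section Spectrum.
Import passmx.
Context {R : realType} {W : vectType R}.
Local Notation C := (@cplx R).
Local Notation toC := (real_complex R).
Local Notation b := (vbasis {:W}).
Local Notation N := (\dim {:W}).
Implicit Types (A : 'End(W)) (q : {poly R}).

Let bP : basis_of {:W} b := vbasisP _.

Lemma spectrum0P A :
  complex_spectrum A (0 : R[i]) <-> exists2 x, x != 0 & A x = 0.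
Proof.
rewrite spectrumP -[0 : R[i]](rmorph0 toC) fmorph_root -eigenvalue_root_char.
split=> [/eigenvalueP[v]|[x x0 Ax]].
  rewrite scale0r /mx_end => vA v0; exists (vecof b v); first by rewrite (vecof_eq0 bP).
  by rewrite (hom_vecof b bP) vA linear0.
apply/eigenvalueP; exists (rVof b x); last by rewrite (rVof_eq0 bP).
by rewrite /mx_end -(rVof_app b bP) Ax linear0 scale0r.
Qed.

Lemma spectrum_half A (z : R[i]) :
  complex_spectrum (2^-1 *: A) z <-> complex_spectrum A (2 * z).
Proof.
have toC2 : toC 2^-1 = 2^-1 by rewrite fmorphV rmorph_nat.
rewrite /complex_spectrum/=; rewrite linearZ/= map_mxZ /= toC2.
have t0 : (2 : R[i]) != 0 by rewrite pnatr_eq0.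
split=> /eigenvalueP[v va v0]; apply/eigenvalueP; exists v => //.
  by rewrite -scalerA -va -scalemxAr scalerA mulfV// scale1r.
by rewrite -scalemxAr va scalerA mulrA mulVf// mul1r.
Qed.

Lemma peval_scale n q (k : R) (M : 'M[R]_n) : k != 0 ->
  peval (q \Po (k *: 'X)) (k^-1 *: M) = peval q M.
Proof.
move=> k0; case: n M => [|n] M; first by apply/matrixP => -[].
rewrite !peval_horner; elim/poly_ind: q => [|q c IHq].
  by rewrite comp_poly0 !rmorph0.
rewrite comp_polyD comp_polyM comp_polyX comp_polyC !rmorphD !rmorphM/= IHq.
rewrite !horner_mx_C horner_mx_X linearZ/= horner_mx_X scalerA mulfV//.
by rewrite scale1r.
Qed.

(** [ccoth w] is the quotient of [cosh(z/2)] by [sinh(z/2)] at [z = 2 w]. *)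
Lemma calculus_ccoth q A :
  (forall z : R[i], complex_spectrum A z -> centire sinh2 z != 0 /\
     jet N (fun w : C => (centire sinh2 w)^-1 * centire cosh2 w : C)
       (map_poly toC q) z) ->
  calculus ccoth (2^-1 *: A) = poly_lfun q A.
Proof.
move=> hq; have t0 : (2 : R) != 0 by rewrite pnatr_eq0.
have t0C : (2 : C) != 0 by rewrite pnatr_eq0.
rewrite (@calculus_polyE _ _ _ (q \Po (2 *: 'X))).
  apply: mx_end_inj; rewrite !mx_poly_lfun /mx_end linearZ/=.
  by rewrite -/(mx_end A) peval_scale.
move=> z /spectrum_half /hq[s0 jq].
rewrite map_comp_poly linearZ/= map_polyX rmorph_nat.
have := jet_scale t0C jq; congr (jet _ _ _ _).
by apply/funext => w /=; rewrite ccothE mulrC.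
Qed.

End Spectrum.

(** The inverse of [A] on the range of an idempotent [1 - P] commuting with
    [A], extended by zero. *)
Section PartialInverse.
Context {R : realType} {n : nat}.
Variables (P A : 'M[R]_n).
Hypotheses (PP : P *m P = P) (AP : A *m P = P *m A).
Local Notation N := (1%:M - P).
Local Notation U := (P + A *m N).

Definition partial_inv : 'M[R]_n := invmx U *m N.

Let PN : P *m N = 0. Proof. by rewrite mulmxBr mulmx1 PP subrr. Qed.
Let NP : N *m P = 0. Proof. by rewrite mulmxBl mul1mx PP subrr. Qed.
Let NN : N *m N = N. Proof. by rewrite mulmxBl mul1mx PN subr0. Qed.
Let AN : A *m N = N *m A.
Proof. by rewrite mulmxBr mulmxBl AP mulmx1 mul1mx. Qed.

Hypothesis uU : U \in unitmx.

Let NU : N *m U = U *m N.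
Proof. by rewrite (mulmxDr N P) (mulmxDl P _ N) NP PN !add0r mulmxA -AN -!mulmxA NN. Qed.

Let UN : U *m N = A *m N.
Proof. by rewrite (mulmxDl P _ N) PN add0r -mulmxA NN. Qed.

Let NJ : N *m partial_inv = partial_inv.
Proof.
have NV : N *m invmx U = invmx U *m N.
  by rewrite -[LHS](mulKmx uU) (mulmxA U N) -NU -(mulmxA N U) mulmxV// mulmx1.
by rewrite /partial_inv mulmxA NV -mulmxA NN.
Qed.

Lemma mul_partial_inv : A *m partial_inv = N.
Proof.
by rewrite -NJ mulmxA -UN -mulmxA NJ /partial_inv mulmxA mulmxV// mul1mx.
Qed.

Lemma partial_inv_mul : partial_inv *m A = N.
Proof.
have VUN := mulKmx uU N; rewrite UN in VUN.
by rewrite /partial_inv -mulmxA -[N *m A]AN VUN.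
Qed.

Lemma proj_partial_inv : N *m partial_inv = partial_inv.
Proof. exact: NJ. Qed.

End PartialInverse.

(** * The splitting of the Lie algebra *)

Section Splitting.
Context {R : realType} {g : vectType R} {n : nat}.
Variables (E : n.-tuple g) (br : {bilinear g -> g -> g}).
Variable B : {bilinear g -> g -> R | *%R & *%R}.
Variables (k p : {vspace g}) (m : nat) (e e' : m.-tuple g).
Hypothesis basisE : basis_of fullv E.
Hypothesis invB : Defs.invariant br B.
Hypothesis subk : forall x y, x \in k -> y \in k -> br x y \in k.
Hypothesis perp : orthogonal_complement B k p.
Hypothesis dualk : dual_bases B k e e'.
Local Notation toC := (real_complex R).

Definition proj_k : 'M[R]_n := mx_of E (dproj B e e').
Local Notation N := (1%:M - proj_k).
Local Notation ad_mx mu := (adm E br (col_of E mu)).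

Lemma perp_mem x : x - dproj B e e' x \in p.
Proof. by apply/perp => y yk; rewrite linearBl (dproj_form dualk)// subrr. Qed.

Lemma dproj_perp x : x \in p -> dproj B e e' x = 0.
Proof.
have [_ e'k _] := dualk; move=> /perp xp; rewrite /dproj big1// => i _.
by rewrite xp ?e'k// scale0r.
Qed.

Lemma perp_stable mu x : mu \in k -> x \in p -> br mu x \in p.
Proof.
by move=> muk /perp xp; apply/perp => y yk; rewrite invB xp ?oppr0// subk.
Qed.

Lemma dproj_br mu x : mu \in k ->
  dproj B e e' (br mu x) = br mu (dproj B e e' x).
Proof.
move=> muk; rewrite -{1}(subrK (dproj B e e' x) x) linearDr linearD/=.
rewrite dproj_perp ?perp_stable ?perp_mem// add0r (dproj_id dualk)// subk//.
exact: (dproj_mem dualk).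
Qed.

Lemma proj_k_col x : proj_k *m col_of E x = col_of E (dproj B e e' x).
Proof. by rewrite /proj_k -col_of_app. Qed.

Lemma proj_p_col x : N *m col_of E x = col_of E (x - dproj B e e' x).
Proof. by rewrite mulmxBl mul1mx proj_k_col linearB. Qed.

Lemma proj_kk : proj_k *m proj_k = proj_k.
Proof.
apply: (mulmx_col_inj basisE) => x; rewrite -mulmxA !proj_k_col.
by rewrite (dproj_id dualk)// (dproj_mem dualk).
Qed.

Lemma ad_proj_k mu : mu \in k -> ad_mx mu *m proj_k = proj_k *m ad_mx mu.
Proof.
move=> muk; apply: (mulmx_col_inj basisE) => x.
by rewrite -!mulmxA proj_k_col !adm_col// proj_k_col dproj_br.
Qed.

Section Regular.
Variable mu : g.
Hypothesis muk : mu \in k.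
Local Notation A := (ad_mx mu).
Local Notation U := (proj_k + A *m N).

Let kstable x : x \in k -> br mu x \in k. Proof. exact: subk. Qed.
Let pstable x : x \in p -> br mu x \in p. Proof. exact: perp_stable. Qed.

Lemma root_spectrum (z : R[i]) : root (map_poly toC (char_poly A)) z ->
  complex_spectrum (ad_on br k mu) z \/ complex_spectrum (ad_on br p mu) z.
Proof.
move=> rz; rewrite !spectrumP.
set ck := char_poly (mx_end (ad_on br k mu)).
set cp := char_poly (mx_end (ad_on br p mu)).
suff : peval (ck * cp) A = 0.
  by move=> /root_peval0 /(_ rz); rewrite rmorphM rootM => /orP.
apply: (mulmx_col_inj basisE) => x; rewrite mul0mx.
rewrite -(subrK (dproj B e e' x) x) linearD/= mulmxDr.
rewrite pevalM -mulmxA (peval_poly_lfun0 basisE pstable) ?perp_mem//; last first.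
  exact: poly_lfun_char_poly.
rewrite -pevalM mulrC pevalM -mulmxA mulmx0 add0r.
rewrite (peval_poly_lfun0 basisE kstable) ?(dproj_mem dualk) ?mulmx0//.
exact: poly_lfun_char_poly.
Qed.

Lemma unit_splitP :
  U \in unitmx <-> ~ complex_spectrum (ad_on br p mu) (0 : R[i]).
Proof.
split=> [uU /spectrum0P[x x0 ax]|h].
  move: x0 => /eqP; apply; apply: val_inj; apply: (can_inj (col_ofK basisE)).
  rewrite linear0 -(mulKmx uU (col_of E _)) mulmxDl -mulmxA proj_k_col proj_p_col.
  rewrite dproj_perp ?subvsP// subr0 linear0 add0r adm_col//.
  by rewrite -(vsval_ad_on pstable) ax linear0 mulmx0.
rewrite unitmxE unitfE -det_tr; apply/negP => /det0P[v v0 vU]; apply: h.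
have Uv : U *m v^T = 0 by rewrite -[U]trmxK -trmx_mul vU trmx0.
pose x := vec_of E v^T; have vx : v^T = col_of E x by rewrite vec_ofK.
move: Uv; rewrite vx mulmxDl -mulmxA proj_k_col proj_p_col adm_col// -linearD/=.
rewrite -[0](linear0 (col_of E)) => /(can_inj (col_ofK basisE)) Ux.
have pstx : br mu (x - dproj B e e' x) \in p by rewrite pstable// perp_mem.
have kx : dproj B e e' x = 0.
  have := congr1 (dproj B e e') Ux; rewrite linearD/= (dproj_perp pstx) addr0.
  by rewrite (dproj_id dualk) ?(dproj_mem dualk)// linear0.
have xp : x \in p by have := perp_mem x; rewrite kx subr0.
apply/spectrum0P; exists (vsproj p x).
  apply: contra_neq v0 => /(congr1 vsval); rewrite vsprojK// linear0 => x0.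
  by rewrite -[v]trmxK vx x0 linear0 trmx0.
apply: val_inj; rewrite [LHS](vsval_ad_on pstable) vsprojK//.
by move: Ux; rewrite kx subr0 add0r.
Qed.

Lemma sinh2_neq0 (z : R[i]) :
  centire sinh2 z != 0 <-> centire sinhc2 z != 0 /\ z != 0.
Proof.
have := sinhc2M z; have t0 : (2 : R[i]) != 0 by rewrite pnatr_eq0.
move=> /(congr1 (fun w => w != 0)); rewrite !mulf_eq0 (negbTE t0)/= => <-.
by rewrite negb_or; split=> [/andP[]|[-> ->]].
Qed.

Lemma regularP :
  regular br k p mu <-> mxentire sinhc2 A \in unitmx /\ U \in unitmx.
Proof.
rewrite (mxentire_unit_spectrum A entire_sinhc2) unit_splitP; split.
  move=> [rk rp]; have hp (z : R[i]) : complex_spectrum (ad_on br p mu) z ->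
      centire sinhc2 z != 0 /\ z != 0.
    move=> sz; apply/sinh2_neq0; have t0 : (2 : R[i]) != 0 by rewrite pnatr_eq0.
    have z2 : 2 * (2^-1 * z) = z by rewrite mulrA mulfV// mul1r.
    have := (holomorphic_ccoth (2^-1 * z)).1; rewrite z2; apply.
    by apply: rp; apply: (spectrum_half _ _).2; rewrite z2.
  split; last by move=> /hp[_]; rewrite eqxx.
  move=> a /root_spectrum[sa|/hp[]//].
  by apply: (holomorphic_fdyn _).1; exact: rk.
move=> [hA h0]; split=> z.
  move=> /(spectrum_ad_on basisE kstable) sz.
  by apply: (holomorphic_fdyn _).2; exact: hA.
move=> /(spectrum_half _ _).1 sz; apply: (holomorphic_ccoth _).2.
apply: (sinh2_neq0 _).2.
split; first by apply: hA; exact: (spectrum_ad_on basisE pstable).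
by apply/eqP => z0; apply: h0; rewrite -z0.
Qed.

End Regular.

End Splitting.

Section CalculusValues.
Context {R : realType} {g : vectType R} {n : nat}.
Variables (E : n.-tuple g) (br : {bilinear g -> g -> g}).
Variable B : {bilinear g -> g -> R | *%R & *%R}.
Variables (k p : {vspace g}) (m : nat) (e e' : m.-tuple g).
Hypothesis basisE : basis_of fullv E.
Hypothesis invB : Defs.invariant br B.
Hypothesis subk : forall x y, x \in k -> y \in k -> br x y \in k.
Hypothesis perp : orthogonal_complement B k p.
Hypothesis dualk : dual_bases B k e e'.
Local Notation C := (@cplx R).
Local Notation toC := (real_complex R).
Local Notation P := (proj_k E B e e').
Local Notation N := (1%:M - P).
Variable mu : g.
Hypothesis muk : mu \in k.
Local Notation A := (adm E br (col_of E mu)).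
Local Notation J := (partial_inv P A).
Hypothesis uA : mxentire sinhc2 A \in unitmx.
Hypothesis uU : P + A *m N \in unitmx.

Let kstable x : x \in k -> br mu x \in k. Proof. exact: subk. Qed.
Let pstable x : x \in p -> br mu x \in p.
Proof. exact: (perp_stable invB subk perp). Qed.

Lemma jet_le d d' (f : C -> C) q a : (d <= d')%N -> jet d' f q a -> jet d f q a.
Proof. by move=> /subnK <-; elim: (d' - d)%N => // i IHi /jetW. Qed.

Lemma dim_subvs (V : {vspace g}) : (\dim {: subvs_of V} <= n)%N.
Proof.
by rewrite dimvf; apply: leq_trans (dimvS (subvf V)) _; rewrite (size_basis basisE).
Qed.

Lemma jet_id d a : jet d (id : C -> C) 'X a.
Proof.
case: d => [|d] //=; split; first by rewrite hornerX.
  by near=> w; exact: derivable_id.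
have -> : derive1 (id : C -> C) = fun=> 1.
  by apply/funext => w; rewrite derive1E derive_id.
by rewrite derivX -polyC1; exact: jet_cst.
Unshelve. all: by end_near. Qed.

Lemma fmx_poly : exists q, peval q A = fmx A /\
  forall a : C, root (map_poly toC (char_poly A)) a ->
    jet n (fun w : C => (centire sinhc2 w)^-1 * centire fnum2 w : C)
      (map_poly toC q) a.
Proof.
move: (A) uA => M; case: n M => [|n'] M uM.
  by exists 0; split=> //; apply/matrixP => -[].
have [q [qM qj]] := quotient_poly (num := fnum2) entire_fnum2 entire_sinhc2 uM.
by exists q; split=> // a /qj/jetW.
Qed.

Lemma calculus_k (x : g) : x \in k ->
  col_of E (vsval (calculus fdyn (ad_on br k mu) (vsproj k x))) =
  fmx A *m col_of E x.
Proof.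
move=> xk; have [q [qA qj]] := fmx_poly.
rewrite (@calculus_polyE _ _ _ q) => [|z sz].
  by rewrite (col_poly_lfun basisE kstable) qA vsprojK.
have rz := spectrum_ad_on basisE kstable sz.
have sz0 := (mxentire_unit_spectrum A entire_sinhc2).1 uA z rz.
apply: (jet_le (dim_subvs k)); apply: jet_near (qj z rz).
have [] := @holomorphic_quotient R fdyn (centire fnum2) (centire sinhc2) z.
- by move=> w; exact: centire_derivable.
- by move=> w; exact: centire_derivable.
- by move=> w w0; rewrite fdynE.
- exact: sz0.
- by move=> h _; near do apply/esym; exact: h.
Unshelve. all: by end_near. Qed.

Lemma peval_X (M : 'M[R]_n) : peval 'X M = M.
Proof.
case: n M => [|n'] M; first by apply/matrixP => -[].
by rewrite peval_horner horner_mx_X.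
Qed.

(** [1/z] has a polynomial representative on the spectrum of the restriction to
    [p], where [0] is not an eigenvalue. *)
Lemma inverse_poly : exists v,
  (forall x, x \in p -> peval v A *m col_of E x = J *m col_of E x) /\
  forall z : C, complex_spectrum (ad_on br p mu) z ->
    jet (\dim {: subvs_of p}) (fun w : C => w^-1) (map_poly toC v) z.
Proof.
have s0 := (unit_splitP basisE invB subk perp dualk muk).1 uU.
set d := \dim _; set chi := char_poly (mx_end (ad_on br p mu)).
have cop : coprimep (chi ^+ d.+1) 'X.
  rewrite coprimep_expl// -['X]subr0 -[0]/(0%:P) coprimep_XsubC.
  apply/negP => r0; apply: s0; apply/spectrumP.
  by rewrite -[0 : R[i]](rmorph0 toC) fmorph_root.
have [[s v] /= sv] := Bezout_eq1_coprimepP _ _ cop.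
exists v; split=> [x xp|z sz].
  have vX y : y \in p -> peval (v * 'X) A *m col_of E y = col_of E y.
    move=> yp; have : peval (s * chi ^+ d.+1 + v * 'X) A = 1%:M.
      rewrite sv; case: (n) (A) => [|n'] M; first by apply/matrixP => -[].
      by rewrite peval_horner rmorph1.
    rewrite pevalD => /(congr1 (fun M => M *m col_of E y)).
    rewrite mulmxDl mul1mx exprSr mulrA pevalM -mulmxA.
    rewrite (peval_poly_lfun0 basisE pstable yp) ?mulmx0 ?add0r//.
    exact: poly_lfun_char_poly.
  pose y := vec_of E (J *m col_of E x).
  have cy : col_of E y = J *m col_of E x by rewrite /y vec_ofK.
  have AJ := mul_partial_inv (proj_kk basisE dualk)
    (ad_proj_k basisE invB subk perp dualk muk) uU.
  have PJ := proj_partial_inv (proj_kk basisE dualk)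
    (ad_proj_k basisE invB subk perp dualk muk) uU.
  have yp : y \in p.
    have : N *m col_of E y = col_of E y by rewrite cy mulmxA PJ.
    rewrite proj_p_col// => /(can_inj (col_ofK basisE)) <-.
    exact: (perp_mem perp dualk).
  rewrite -cy -(vX y yp) pevalM peval_X -mulmxA cy (mulmxA A) AJ.
  by rewrite proj_p_col// (dproj_perp perp dualk xp) subr0.
have z0 : z != 0 by apply/eqP => z0; apply: s0; rewrite -z0.
apply: (@jetV C _ id (map_poly toC 'X) _ z z0); last first.
  by rewrite map_polyX; exact: jet_id.
have -> : map_poly toC v * map_poly toC 'X - 1 =
    - (map_poly toC s * map_poly toC chi ^+ d.+1).
  by rewrite -rmorphM -rmorphXn -rmorphM -(rmorph1 (map_poly toC)) -sv rmorphD/= opprD addrC subrK.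
rewrite dvdpNr; apply: dvdp_mull; rewrite exprSr; apply: dvdp_mulr.
apply: dvdp_exp2r; rewrite dvdp_XsubCl; exact: (spectrumP _ _).1 sz.
Qed.

Lemma half_coth_split (K : numFieldType) (w f s : K) : w != 0 -> s != 0 ->
  2 * (s^-1 * f + w^-1) = (2^-1 * (w * s))^-1 * (w * f + s).
Proof. by move=> w0 s0; field; rewrite w0 s0. Qed.

Lemma calculus_p (x : g) : x \in p ->
  col_of E (vsval (calculus ccoth (2^-1 *: ad_on br p mu) (vsproj p x))) =
  2 *: (fmx A + J) *m col_of E x.
Proof.
move=> xp; have [q [qA qj]] := fmx_poly; have [v [vA vj]] := inverse_poly.
rewrite (@calculus_ccoth _ _ (2%:P * (q + v))) => [|z sz].
  rewrite (col_poly_lfun basisE pstable) vsprojK// pevalM pevalD qA.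
  have -> : peval 2%:P A = 2%:M.
    case: (n) (A) => [|n'] M; first by apply/matrixP => -[].
    by rewrite peval_horner horner_mx_C.
  by rewrite mul_scalar_mx -!scalemxAl !mulmxDl vA.
have rz := spectrum_ad_on basisE pstable sz.
have sz0 := (mxentire_unit_spectrum A entire_sinhc2).1 uA z rz.
have s0 := (unit_splitP basisE invB subk perp dualk muk).1 uU.
have z0 : z != 0 by apply/eqP => z0; apply: s0; rewrite -z0.
have s2z : centire sinh2 z != 0 by apply: (sinh2_neq0 _).2; split; [exact: sz0|exact: z0].
split; [exact: s2z|rewrite rmorphM/= [map_poly _ (q + v)]rmorphD/= [map_poly _ 2%:P]map_polyC/= rmorph_nat].
have j1 := jetM (jet_cst _ (2 : C) z)
  (jetD (jet_le (dim_subvs p) (qj z rz)) (vj z sz)).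
apply: jet_near j1.
have [] := @holomorphic_quotient R
  (fun w => 2 * ((centire sinhc2 w)^-1 * centire fnum2 w + w^-1))
  (centire cosh2) (centire sinh2) z.
- by move=> w; exact: centire_derivable.
- by move=> w; exact: centire_derivable.
- move=> w /(sinh2_neq0 _).1[c0 w0].
  have t0 : (2 : R[i]) != 0 by rewrite pnatr_eq0.
  have -> : centire sinh2 w = 2^-1 * (w * centire sinhc2 w).
    by rewrite sinhc2M (mulKf t0).
  have -> : centire cosh2 w = w * centire fnum2 w + centire sinhc2 w.
    by rewrite fnum2M subrK.
  exact: (@half_coth_split C _ _ _ w0 c0).
- exact: s2z.
- by [].
Qed.

End CalculusValues.

(** * The r-matrix as a bilinear form *)

Section RMatrix.
Context {R : realType} {g : vectType R} {n : nat}.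
Variables (E : n.-tuple g) (br : {bilinear g -> g -> g}).
Variable B : {bilinear g -> g -> R | *%R & *%R}.
Variables (k p : {vspace g}) (m l : nat) (e e' : m.-tuple g) (u u' : l.-tuple g).
Hypothesis basisE : basis_of fullv E.
Hypothesis lie : lie_bracket br.
Hypothesis symB : forall x y, B x y = B y x.
Hypothesis invB : Defs.invariant br B.
Hypothesis subk : forall x y, x \in k -> y \in k -> br x y \in k.
Hypothesis perp : orthogonal_complement B k p.
Hypothesis dualk : dual_bases B k e e'.
Hypothesis dualp : dual_bases B p u u'.
Local Notation ad := (adm E br).
Local Notation G := (gram E B).
Local Notation P := (proj_k E B e e').
Local Notation N := (1%:M - P).

Lemma lambda_form (V : {vspace g}) (q : nat) (w w' : q.-tuple g)
    (X : 'End(subvs_of V)) (a b : {scalar g}) x y :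
  a =1 B x -> b =1 B y ->
  lambda w w' X a b =
  2^-1 * (B x (vsval (X (vsproj V (dproj B w w' y))))
        - B y (vsval (X (vsproj V (dproj B w w' x))))).
Proof.
move=> ax ay; rewrite /lambda; congr (_ * _).
have h z v : B z (vsval (X (vsproj V (dproj B w w' v)))) =
    \sum_i B v (tnth w' i) * B z (vsval (X (vsproj V (tnth w i)))).
  pose f : {linear g -> g} := vsval \o (X \o vsproj V).
  rewrite -[vsval _]/(f _) /dproj linear_sum linear_sumr.
  by apply: eq_bigr => i _; rewrite linearZ linearZr_LR.
rewrite !h -sumrB; apply: eq_bigr => i _.
by rewrite /wedge !ax !ay; ring.
Qed.

Lemma gram_tr : G^T = G.
Proof. by apply/matrixP => i j; rewrite !mxE symB. Qed.

Lemma brC x y : br x y = - br y x.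
Proof.
have [alt _] := lie; apply/eqP; rewrite -addr_eq0; apply/eqP.
have := alt (x + y); rewrite linearDl !linearDr !alt add0r addr0 addrC.
by rewrite addrC.
Qed.

Lemma adm_antisym x y : ad x *m y = - (ad y *m x).
Proof.
rewrite -[x](vec_ofK basisE) -[y](vec_ofK basisE) !adm_col//.
by rewrite brC linearN.
Qed.

Lemma adm_bracket x y : ad (ad x *m y) = ad x *m ad y - ad y *m ad x.
Proof.
have [_ jac] := lie.
rewrite -[x](vec_ofK basisE) -[y](vec_ofK basisE); set v := vec_of E x.
set w := vec_of E y; apply: (mulmx_col_inj basisE) => z.
rewrite mulmxBl -!mulmxA !adm_col// -linearB/=; congr col_of.
have := jac v w z; rewrite (brC z (br v w)) (brC z v) linearNr => /eqP.
by rewrite subr_eq0 => /eqP <-.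
Qed.

Lemma adm_skew x y z : form G (ad x *m y) z = - form G y (ad x *m z).
Proof.
rewrite -[x](vec_ofK basisE) -[y](vec_ofK basisE) -[z](vec_ofK basisE).
by rewrite !adm_col// -!formE// invB.
Qed.

Lemma proj_form x y : form G (P *m x) (N *m y) = 0.
Proof.
rewrite -[x](vec_ofK basisE) -[y](vec_ofK basisE) proj_k_col// proj_p_col//.
rewrite -formE// symB; apply: (perp _).1; first exact: (perp_mem perp dualk).
exact: (dproj_mem dualk).
Qed.

Lemma dproj_p x : dproj B u u' x = x - dproj B e e' x.
Proof.
have [_ u'p _] := dualp.
rewrite -{1}(subrK (dproj B e e' x) x) linearD/=.
rewrite (dproj_id dualp) ?(perp_mem perp dualk)//.
rewrite [X in _ + X]big1 ?addr0// => i _.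
by rewrite symB (perp _).1 ?u'p ?scale0r// (dproj_mem dualk).
Qed.

Section AtPoint.
Variable mu : g.
Hypothesis muk : mu \in k.
Hypothesis reg : regular br k p mu.
Local Notation A := (ad (col_of E mu)).
Local Notation J := (partial_inv P A).

Let uA := ((regularP basisE invB subk perp dualk muk).1 reg).1.
Let uU := ((regularP basisE invB subk perp dualk muk).1 reg).2.
Let PP := proj_kk basisE dualk.
Let AP := ad_proj_k basisE invB subk perp dualk muk.

Let PkDPp : P + N = 1%:M. Proof. by rewrite addrC subrK. Qed.

Lemma rmatrix_skew x y :
  form G ((fmx A + J) *m x) y = - form G x ((fmx A + J) *m y).
Proof.
rewrite !mulmxDl formDl formDr (form_fmx adm_skew uA) opprD; congr (_ + _).
exact: (form_inverse gram_tr adm_skew PkDPp proj_form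
  (mul_partial_inv PP AP uU) (proj_partial_inv PP AP uU)).
Qed.

Lemma rmatrixE (a b : {scalar g}) x y : a =1 B x -> b =1 B y ->
  rk br k e e' mu a b + rp br p u u' mu a b =
  form G (col_of E x) ((fmx A + J) *m col_of E y).
Proof.
move=> ax ay; rewrite /rk /rp !(lambda_form _ _ _ ax ay).
have kx w : dproj B e e' w \in k by exact: (dproj_mem dualk).
have px w : dproj B u u' w \in p by exact: (dproj_mem dualp).
have hk w v : B w (vsval (calculus fdyn (ad_on br k mu) (vsproj k (dproj B e e' v))))
    = form G (col_of E w) (fmx A *m (P *m col_of E v)).
  by rewrite (formE basisE) (calculus_k basisE subk muk uA)//
    proj_k_col.
have hp w v : B w (vsval (calculus ccoth (2^-1 *: ad_on br p mu)
      (vsproj p (dproj B u u' v))))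
    = form G (col_of E w) (2 *: ((fmx A + J) *m (N *m col_of E v))).
  rewrite (formE basisE) (calculus_p basisE invB subk perp dualk muk uA uU)//.
  by rewrite dproj_p proj_p_col// scalemxAl.
rewrite !hk !hp.
have JP : J *m P = 0 by rewrite /partial_inv -mulmxA mulmxBl mul1mx PP subrr mulmx0.
have split_form (s t : 'cV[R]_n) : form G s ((fmx A + J) *m t) =
    form G s (fmx A *m (P *m t)) + form G s ((fmx A + J) *m (N *m t)).
  rewrite -formDr; congr (form _ _ _).
  have {1}-> : t = P *m t + N *m t by rewrite -mulmxDl PkDPp mul1mx.
  by rewrite mulmxDr [X in X + _]mulmxDl (mulmxA J) JP mul0mx addr0.
have skew := rmatrix_skew (col_of E y) (col_of E x).
rewrite (formC gram_tr) (split_form (col_of E x)) (split_form (col_of E y)) in skew.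
rewrite (split_form (col_of E x)) !formZr.
move: skew; move: (form G (col_of E x) _) (form G (col_of E x) _).
move: (form G (col_of E y) _) (form G (col_of E y) _) => *; lra.
Qed.

End AtPoint.

End RMatrix.

(** * Dependence on the point *)

Section LinearFamily.
Context {R : realType} {m n : nat}.
Variables (G P : 'M[R]_n) (H : 'I_m -> 'M[R]_n).
Hypothesis PP : P *m P = P.
Hypothesis HP : forall i, H i *m P = P *m H i.
Implicit Types (mu nu : 'rV[R]_m).
Local Notation N := (1%:M - P).

Definition family nu : 'M[R]_n := \sum_i nu 0 i *: H i.
Local Notation A := family.
Local Notation J nu := (partial_inv P (family nu)).

Definition unit_at nu : Prop :=
  mxentire sinhc2 (A nu) \in unitmx /\ P + A nu *m N \in unitmx.

Lemma family_proj nu : A nu *m P = P *m A nu.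
Proof.
rewrite mulmx_suml mulmx_sumr; apply: eq_bigr => i _.
by rewrite -scalemxAl -scalemxAr HP.
Qed.

Lemma familyB nu mu : A nu - A mu = \sum_i (nu 0 i - mu 0 i) *: H i.
Proof. by rewrite -sumrB; apply: eq_bigr => i _; rewrite scalerBl. Qed.

Lemma family_cvg (T : Type) (F : set_system T) (FF : Filter F)
    (f : T -> 'rV[R]_m) mu :
  (forall i, f t 0 i @[t --> F] --> mu 0 i) ->
  mxcvg F (fun t => A (f t)) (A mu).
Proof.
move=> fmu; apply: mxcvg_sum => i; apply: mxcvgZ; [exact: fmu|exact: mxcvg_cst].
Qed.

Lemma split_cvg (T : Type) (F : set_system T) (FF : Filter F)
    (f : T -> 'rV[R]_m) mu :
  (forall i, f t 0 i @[t --> F] --> mu 0 i) ->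
  mxcvg F (fun t => P + A (f t) *m N) (P + A mu *m N).
Proof.
move=> fmu; apply: mxcvgD; first exact: mxcvg_cst.
by apply: mxcvgM; [exact: family_cvg|exact: mxcvg_cst].
Qed.

Lemma unit_at_near mu : unit_at mu -> \forall nu \near mu, unit_at nu.
Proof.
move=> [uA uU]; have c := @row_coord_cvg R m mu.
have FF := nbhs_filter mu.
have h1 := mxentire_unit_near (FF := FF) entire_sinhc2 uA (family_cvg _ c).
have h2 := mxcvg_unit_near (FF := FF) uU (split_cvg _ c).
by near=> nu; split; near: nu; [exact: h1|exact: h2].
Unshelve. all: by end_near. Qed.

Definition rmat nu : 'M[R]_n := fmx (A nu) + J nu.
Definition rslope i nu mu : 'M[R]_n :=
  mxquot_slope fnum2 sinhc2 (A nu) (A mu) (H i) - J nu *m H i *m J mu.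

Lemma partial_invB nu mu : unit_at nu -> unit_at mu ->
  J nu - J mu = - (J nu *m (A nu - A mu) *m J mu).
Proof.
move=> [_ un] [_ um]; rewrite mulmxBr mulmxBl.
rewrite (partial_inv_mul PP (family_proj nu) un) -[J nu *m A mu *m _]mulmxA.
rewrite (mul_partial_inv PP (family_proj mu) um).
rewrite (proj_partial_inv PP (family_proj mu) um) opprB.
congr (_ - _); rewrite /partial_inv -mulmxA; congr (_ *m _).
by rewrite mulmxBr mulmx1 mulmxBl mul1mx PP subrr subr0.
Qed.

Lemma rmatB nu mu : unit_at nu -> unit_at mu ->
  rmat nu - rmat mu = \sum_i (nu 0 i - mu 0 i) *: rslope i nu mu.
Proof.
move=> un um; have [uAn _] := un; have [uAm _] := um.
rewrite /rmat opprD addrACA partial_invB//.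
rewrite -(mxquot_slope_diff entire_fnum2 entire_sinhc2 uAn uAm) familyB.
rewrite (mxquot_slope_sum entire_fnum2 entire_sinhc2).
rewrite mulmx_sumr mulmx_suml -sumrB; apply: eq_bigr => i _.
by rewrite -scalemxAr -scalemxAl scalerBr.
Qed.

Lemma partial_inv_cvg mu : unit_at mu ->
  mxcvg (nbhs mu) (fun nu => J nu) (J mu).
Proof.
move=> [_ um]; have c := @row_coord_cvg R m mu.
apply: mxcvgM; last exact: mxcvg_cst.
by apply: mxcvg_inv => //; exact: split_cvg.
Qed.

Lemma rslope_cvg i mu : unit_at mu ->
  mxcvg (nbhs mu) (fun nu => rslope i nu mu) (rslope i mu mu).
Proof.
move=> um; have [uAm _] := um; have c := @row_coord_cvg R m mu.
apply: mxcvgB.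
  apply: (mxquot_slope_continuous (FF := nbhs_filter mu) entire_fnum2 entire_sinhc2) => //.
  - exact: family_cvg.
  - exact: mxcvg_cst.
apply: mxcvgM; last exact: mxcvg_cst.
by apply: mxcvgM; [exact: partial_inv_cvg|exact: mxcvg_cst].
Qed.

Lemma rmat_derive (f : 'rV[R]_m -> R) x y mu :
  (forall nu, unit_at nu -> f nu = form G x (rmat nu *m y)) -> unit_at mu ->
  differentiable (f : 'rV[R]_m -> R^o) mu /\
  forall i, 'D_(delta_mx 0 i) (f : 'rV[R]_m -> R^o) mu =
    form G x (rslope i mu mu *m y).
Proof.
move=> fE um.
apply: (@caratheodory_differentiable R m f mu
  (fun i nu => form G x (rslope i nu mu *m y))).
  have near_u := unit_at_near um.
  near=> nu; have un : unit_at nu by near: nu; exact: near_u.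
  rewrite !fE// -formNr -formDr -mulmxBl rmatB// mulmx_suml.
  rewrite /form mulmx_sumr summxE; apply: eq_bigr => i _.
  by rewrite -scalemxAl -scalemxAr mxE.
move=> i; have FF := nbhs_filter mu.
apply: (@cvg_form _ _ G _ (nbhs mu) FF); first exact: mxcvg_cst.
by apply: mxcvgM; [exact: rslope_cvg|exact: mxcvg_cst].
Unshelve. all: by end_near. Qed.

End LinearFamily.

Section Scaling.
Context {R : realType}.
Local Notation C := (@cplx R).
Local Notation toC := (real_complex R).

Lemma sinhc2_neq0_near (a : C) : centire sinhc2 a != 0 ->
  \forall w \near a, centire sinhc2 w != 0.
Proof.
move=> a0; pose s : C -> C := centire sinhc2.
have dc : s w @[w --> a] --> s a.
  have ds w : derivable s w 1 by exact: centire_derivable.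
  exact/differentiable_continuous/derivable1_diffP.
exact: (cvgr_neq0 (FF := nbhs_filter a) _ dc a0).
Qed.

Lemma real_scale_cvg (a : C) (b : R) :
  ((t - b)%:C%C * a : C) @[t --> (1 : R)] --> ((1 - b)%:C%C * a : C).
Proof.
have FF := nbhs_filter (1 : R).
have l (c : R) : ((t - b) * c) @[t --> (1 : R)] --> (1 - b) * c.
  apply: cvgM; last exact: cvg_cst.
  by apply: cvgB; [exact: cvg_id|exact: cvg_cst].
case: a => x y.
have re (t : R) : complex.Re (t%:C%C * (x +i* y)%C) = t * x by rewrite /=; ring.
have im (t : R) : complex.Im (t%:C%C * (x +i* y)%C) = t * y by rewrite /=; ring.
apply: cplx_cvg; rewrite ?re ?im; [under eq_cvg do rewrite re|under eq_cvg do rewrite im].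
  exact: l.
exact: l.
Qed.

Lemma near_punctured (x : R) (Q : set R) :
  (\forall t \near x, Q t) -> \forall t \near x^', Q t.
Proof. by move=> h; near=> t; near: t; exact: cvg_within h. Unshelve. all: by end_near. Qed.

(** The zeros of [sinhc2] are isolated along a real line through the origin:
    [cexp (t a) = cexp ((t - 1) a)] when [cexp a = 1], and [sinhc2 0 = 1]. *)
Lemma sinhc2_line (a : C) :
  \forall t \near (1 : R)^', centire sinhc2 (t%:C%C * a) != 0.
Proof.
have [a0|] := boolP (centire sinhc2 a == 0); last first.
  move=> a0; have h := sinhc2_neq0_near a0.
  have := @real_scale_cvg a 0; rewrite subr0 mul1r => l.
  have l1 : \forall t \near (1 : R)^', centire sinhc2 ((t - 0)%:C%C * a) != 0.
    by apply: near_punctured; exact: (l _ h).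
  by near=> t; rewrite -[t]subr0; near: t; exact: l1.
move: a0; rewrite sinhc2_eq0 => /andP[a0 /eqP ea].
have h0 : centire sinhc2 (0 : C) != 0 by rewrite sinhc2_0 oner_neq0.
have := @real_scale_cvg a 1; rewrite subrr mul0r => l.
have l0 := l _ (sinhc2_neq0_near h0).
have l1 : \forall t \near (1 : R)^', centire sinhc2 ((t - 1)%:C%C * a) != 0.
  by apply: near_punctured; exact: l0.
near=> t.
have t1 : t != 1 by near: t; exact: nbhs_dnbhs_neq.
have s0 : centire sinhc2 ((t - 1)%:C%C * a) != 0 by near: t; exact: l1.
move: s0; rewrite !sinhc2_eq0 !negb_and !negbK => /orP[|].
  by rewrite mulf_eq0 (negbTE a0) orbF fmorph_eq0 subr_eq0 (negbTE t1).
move=> et; have -> : t%:C%C * a = (t - 1)%:C%C * a + a.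
  by rewrite rmorphB rmorph1 mulrBl mul1r subrK.
by rewrite cexpD ea mulr1 et orbT.
Unshelve. all: by end_near. Qed.

Lemma root_char_poly_scale n (M : 'M[R]_n) (t : R) (z : C) : t != 0 ->
  root (map_poly toC (char_poly (t *: M))) z ->
  exists2 a : C, z = t%:C%C * a & root (map_poly toC (char_poly M)) a.
Proof.
move=> t0; have tC : t%:C%C != 0 :> C by rewrite fmorph_eq0.
rewrite !map_char_poly -eigenvalue_root_char => /eigenvalueP[v va v0].
exists (t%:C%C^-1 * z); first by rewrite mulrA mulfV// mul1r.
rewrite -eigenvalue_root_char; apply/eigenvalueP; exists v => //.
by rewrite -scalerA -va map_mxZ -scalemxAr scalerA mulVf// scale1r.
Qed.

Lemma sinhc2_scale_near n (M : 'M[R]_n) :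
  \forall t \near (1 : R)^', mxentire sinhc2 (t *: M) \in unitmx.
Proof.
have [rs rsE] := closed_field_poly_normal (map_poly toC (char_poly M)).
have lc : lead_coef (map_poly toC (char_poly M)) != 0.
  by rewrite lead_coef_eq0 map_poly_eq0 monic_neq0// char_poly_monic.
have h : forall s : seq C, \forall t \near (1 : R)^',
    forall a : C, a \in s -> centire sinhc2 (t%:C%C * a) != 0.
  elim=> [|b s IHs]; first by apply: nearW.
  have hb := sinhc2_line b; apply: filterS2 hb IHs => t tb ts a.
  by rewrite inE => /orP[/eqP ->|/ts].
near=> t.
have t0 : t != 0.
  near: t; apply: near_punctured.
  exact: (@cvgr_neq0 R R^o R (nbhs (1 : R)) _ id 1 (@cvg_id _ _) (oner_neq0 _)).
have tr : forall a : C, a \in rs -> centire sinhc2 (t%:C%C * a) != 0.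
  by near: t; exact: h.
apply: (mxentire_unit_spectrum _ entire_sinhc2).2 => z /(root_char_poly_scale t0).
move=> [a -> ra]; apply: tr; move: ra.
by rewrite rsE rootZ// root_prod_XsubC.
Unshelve. all: by end_near. Qed.

End Scaling.

(** * Contraction of the tensors *)

Section Tensors.
Context {R : realType} {g : vectType R} {n : nat}.
Variables (E E' : n.-tuple g) (br : {bilinear g -> g -> g}).
Variable B : {bilinear g -> g -> R | *%R & *%R}.
Hypothesis symB : forall x y, B x y = B y x.
Hypothesis dualE : dual_bases B fullv E E'.
Implicit Types (a b c : {scalar g}).
Local Notation ad := (adm E br).
Local Notation G := (gram E B).

Let basisE : basis_of fullv E. Proof. by case: dualE. Qed.

Lemma dual_bases_sym (V : {vspace g}) (m : nat) (e e' : m.-tuple g) :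
  dual_bases B V e e' -> dual_bases B V e' e.
Proof.
move=> d; have [be _ Be] := d; split; first exact: dual_basis d.
  by move=> i; apply: (basis_mem be); exact: mem_tnth.
by move=> i j; rewrite symB Be eq_sym.
Qed.

Definition covec a : g := \sum_i a (tnth E i) *: tnth E' i.

Lemma covecE a : a =1 B (covec a).
Proof.
move=> z; rewrite -{1}(dproj_id dualE (memvf z)) /dproj linear_sum linear_sumlz.
by apply: eq_bigr => i _; rewrite linearZ/= linearZl_LR/= symB mulrC.
Qed.

Lemma covec_coord (i : 'I_n) : coord E i =1 B (tnth E' i).
Proof.
have [_ _ Be] := dualE; move=> z.
rewrite -{1}(dproj_id dualE (memvf z)) /dproj linear_sum (bigD1 i)//= big1.
  rewrite linearZ/= (tnth_nth 0 E) coord_free ?(basis_free basisE)// eqxx.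
  by rewrite mulr1 addr0 symB.
move=> j ji; rewrite linearZ/= (tnth_nth 0 E) coord_free ?(basis_free basisE)//.
by rewrite (negbTE ji) mulr0.
Qed.

Definition tensor3 (w : 'I_n -> 'I_n -> 'I_n -> R) a b c : R :=
  \sum_i \sum_j \sum_k w i j k * (a (tnth E i) * b (tnth E j) * c (tnth E k)).

Lemma wedge3_sum w a b c :
  \sum_i \sum_j \sum_k
     w i j k * wedge3 (tnth E i) (tnth E j) (tnth E k) a b c =
  tensor3 w a b c - tensor3 w b a c + tensor3 w b c a - tensor3 w c b a
  + tensor3 w c a b - tensor3 w a c b.
Proof.
rewrite /tensor3 -sumrB -big_split -sumrB -big_split -sumrB; apply: eq_bigr => i _ /=.
rewrite -sumrB -big_split -sumrB -big_split -sumrB; apply: eq_bigr => j _ /=.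
rewrite -sumrB -big_split -sumrB -big_split -sumrB; apply: eq_bigr => k _ /=.
by rewrite /wedge3 /wedge2v /wedge; ring.
Qed.

Lemma cubicE a b c :
  (forall x y, br x y = - br y x) -> Defs.invariant br B ->
  cubic br B E E' a b c = - B (covec a) (br (covec b) (covec c)).
Proof.
move=> brC invB; rewrite /cubic wedge3_sum.
have T x y z : tensor3
    (fun i j k => B (tnth E' i) (br (tnth E' j) (tnth E' k))) x y z =
    B (covec x) (br (covec y) (covec z)).
  rewrite /covec linear_sumlz; apply: eq_bigr => i _; rewrite linearZl_LR/=.
  rewrite linear_sumlz linear_sumr mulr_sumr; apply: eq_bigr => j _.
  rewrite linearZl_LR/= linear_sumr linearZr_LR/= linear_sumr !mulr_sumr.
  apply: eq_bigr => k _; rewrite !linearZr_LR/= /GRing.scale/=; ring.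
rewrite !T; move: (covec a) (covec b) (covec c) => x y z.
have s1 u v w : B u (br v w) = - B u (br w v) by rewrite brC linearNr.
have s2 u v w : B u (br v w) = - B v (br u w).
  by rewrite -[LHS]opprK -invB (brC v u) linearNl opprK invB.
rewrite (s1 z y x) (s1 y z x) (s2 z x y) (s2 y x z) (s1 x z y).
by field.
Qed.

Lemma schoutenE (r : ext2 g) (M : 'M[R]_n) a b c :
  (forall x y, br x y = - br y x) ->
  (forall x y, form G (M *m x) y = - form G x (M *m y)) ->
  (forall a b x y, a =1 B x -> b =1 B y ->
     r a b = form G (col_of E x) (M *m col_of E y)) ->
  2^-1 * schouten br E r a b c =
  cform G ad (col_of E (covec a)) (M *m col_of E (covec b)) (M *m col_of E (covec c))
  + cform G ad (col_of E (covec b)) (M *m col_of E (covec c)) (M *m col_of E (covec a))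
  + cform G ad (col_of E (covec c)) (M *m col_of E (covec a)) (M *m col_of E (covec b)).
Proof.
move=> brC skew rE; pose Mv x := vec_of E (M *m col_of E x).
have cMv x : col_of E (Mv x) = M *m col_of E x by rewrite vec_ofK.
pose w i j k := \sum_p \sum_q r (coord E i) (coord E p) *
  coord E j (br (tnth E p) (tnth E q)) * r (coord E q) (coord E k).
have -> : schouten br E r a b c = \sum_i \sum_j \sum_k
     w i j k * wedge3 (tnth E i) (tnth E j) (tnth E k) a b c.
  do 3!apply: eq_bigr => ? _; rewrite /w mulr_suml; apply: eq_bigr => p _.
  by rewrite mulr_suml.
have T x y z : tensor3 w x y z = - B (covec y) (br (Mv (covec x)) (Mv (covec z))).
  have left p : \sum_i x (tnth E i) * r (coord E i) (coord E p) =
      - coord E p (Mv (covec x)).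
    rewrite covec_coord (formE basisE) cMv /covec linear_sum mulmx_sumr.
    rewrite /form mulmx_sumr summxE -sumrN; apply: eq_bigr => i _.
    rewrite (rE _ _ _ _ (covec_coord i) (covec_coord p)) linearZ/=.
    rewrite -!scalemxAr mxE -/(form G _ (M *m _)) -mulrN -skew; congr (_ * _).
    by rewrite formC// gram_tr.
  have right q : \sum_k r (coord E q) (coord E k) * z (tnth E k) =
      coord E q (Mv (covec z)).
    rewrite covec_coord (formE basisE) cMv /covec linear_sum mulmx_sumr.
    rewrite /form mulmx_sumr summxE; apply: eq_bigr => k _.
    rewrite (rE _ _ _ _ (covec_coord q) (covec_coord k)) linearZ/=.
    by rewrite -!scalemxAr mxE -/(form G _ (M *m _)) mulrC.
  have expand v : v = \sum_p coord E p v *: tnth E p.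
    rewrite {1}(coord_basis basisE (memvf v)); apply: eq_bigr => p _.
    by rewrite (tnth_nth 0).
  rewrite [in RHS](expand (Mv (covec x))) [in RHS](expand (Mv (covec z))).
  rewrite -covecE linear_sumlz linear_sum -sumrN.
  transitivity (\sum_p \sum_q
      (\sum_i x (tnth E i) * r (coord E i) (coord E p)) *
      y (br (tnth E p) (tnth E q)) *
      (\sum_k r (coord E q) (coord E k) * z (tnth E k))); last first.
    apply: eq_bigr => p _; rewrite left linearZl_LR/= linearZ/= linear_sumr.
    rewrite [y _]linear_sum mulr_sumr -sumrN; apply: eq_bigr => q _.
    rewrite right; move: (coord E p _) (coord E q _) => cp cq.
    by rewrite linearZr_LR/= [y (_ *: _)]linearZ/=; ring.
  have ye v : y v = \sum_j coord E j v * y (tnth E j).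
    rewrite {1}(expand v) linear_sum; apply: eq_bigr => j _.
    by rewrite linearZ.
  rewrite /tensor3 /w.
  under eq_bigr do under eq_bigr do under eq_bigr do
    (rewrite mulr_suml; under eq_bigr do rewrite mulr_suml).
  under eq_bigr do under eq_bigr do rewrite exchange_big.
  under eq_bigr do rewrite exchange_big.
  rewrite exchange_big; apply: eq_bigr => p _.
  under eq_bigr do under eq_bigr do rewrite exchange_big.
  under eq_bigr do rewrite exchange_big.
  rewrite exchange_big; apply: eq_bigr => q _.
  rewrite ye !mulr_suml; apply: eq_bigr => i _.
  rewrite -mulrA mulr_suml mulr_sumr; apply: eq_bigr => j _.
  by rewrite !mulr_sumr; apply: eq_bigr => k _; ring.
rewrite wedge3_sum !T.
have C x y z : cform G ad (col_of E x) (M *m col_of E y) (M *m col_of E z) =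
    B x (br (Mv y) (Mv z)).
  by rewrite (formE basisE) -(adm_col basisE) !cMv.
rewrite !C; move: (covec a) (covec b) (covec c) => x y z.
have s u v t : B u (br v t) = - B u (br t v) by rewrite brC linearNr.
rewrite (s y (Mv x)) (s z (Mv y)) (s x (Mv z)); by field.
Qed.

End Tensors.

(** * The theorem *)

Section DynamicalRMatrix.
Context {R : realType} {g : vectType R}.
Variables (br : {bilinear g -> g -> g}).
Variable B : {bilinear g -> g -> R | *%R & *%R}.
Variables (k p : {vspace g}) (m l n : nat).
Variables (e e' : m.-tuple g) (u u' : l.-tuple g) (E E' : n.-tuple g).
Hypothesis lie : lie_bracket br.
Hypothesis symB : forall x y, B x y = B y x.
Hypothesis invB : Defs.invariant br B.
Hypothesis subk : forall x y, x \in k -> y \in k -> br x y \in k.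
Hypothesis perp : orthogonal_complement B k p.
Hypothesis dualk : dual_bases B k e e'.
Hypothesis dualp : dual_bases B p u u'.
Hypothesis dualE : dual_bases B fullv E E'.
Implicit Types (mu nu : 'rV[R]_m) (a b c : {scalar g}).

Local Notation ad := (adm E br).
Local Notation G := (gram E B).
Local Notation P := (proj_k E B e e').
Local Notation N := (1%:M - P).
Local Notation H := (fun i => ad (col_of E (tnth e' i))).
Local Notation pt := (of_coords e').
Local Notation r := (fun mu a b => rk br k e e' (pt mu) a b + rp br p u u' (pt mu) a b).

Let basisE : basis_of fullv E. Proof. by case: dualE. Qed.

Lemma of_coords_mem mu : pt mu \in k.
Proof. by have [_ e'k _] := dualk; apply: memv_suml => i _; apply: memvZ. Qed.

Lemma family_ad mu : family H mu = ad (col_of E (pt mu)).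
Proof.
by rewrite /of_coords !linear_sum; apply: eq_bigr => i _; rewrite !linearZ.
Qed.

Let PP : P *m P = P. Proof. exact: (proj_kk basisE dualk). Qed.

Let HP i : H i *m P = P *m H i.
Proof.
have [_ e'k _] := dualk.
by rewrite (ad_proj_k basisE invB subk perp dualk).
Qed.

Lemma regular_unit_at mu : regular br k p (pt mu) <-> unit_at P H mu.
Proof.
rewrite /unit_at family_ad.
exact: (regularP basisE invB subk perp dualk (of_coords_mem mu)).
Qed.

Lemma regular_open : open [set mu | regular br k p (pt mu)].
Proof.
rewrite openE => mu /= reg; rewrite /interior.
have h := unit_at_near ((regular_unit_at mu).1 reg).
by near=> nu; apply: (regular_unit_at nu).2; near: nu; exact: h.
Unshelve. all: by end_near. Qed.

(** Where [ad mu] is invertible on [p], the other points of the line through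
    [mu] that are close to [mu] are regular. *)
Lemma regular_near_line mu : bijective (ad_on br p (pt mu)) ->
  \forall t \near (1 : R)^', regular br k p (pt (t *: mu)).
Proof.
move=> bij; have muk := of_coords_mem mu.
have uU : P + family H mu *m N \in unitmx.
  rewrite family_ad; apply: (unit_splitP basisE invB subk perp dualk muk).2.
  move=> /spectrum0P[x x0 ax]; move: x0 => /eqP; apply.
  by apply: (bij_inj bij); rewrite ax linear0.
have c (i : 'I_m) : (t *: mu) 0 i @[t --> (1 : R)] --> mu 0 i.
  have -> : mu 0 i = 1 * mu 0 i by rewrite mul1r.
  under eq_cvg do rewrite mxE.
  by apply: cvgM; [exact: cvg_id|exact: cvg_cst].
have h1 := sinhc2_scale_near (family H mu).
have h2 : \forall t \near (1 : R)^', P + family H (t *: mu) *m N \in unitmx.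
  apply: near_punctured; have FF := nbhs_filter (1 : R).
  have sc : mxcvg (nbhs (1 : R)) (fun t => P + family H (t *: mu) *m N)
      (P + family H mu *m N) by exact: split_cvg.
  exact: (mxcvg_unit_near (FF := FF) uU sc).
near=> t; apply: (regular_unit_at _).2; split.
  have -> : family H (t *: mu) = t *: family H mu.
    rewrite /family scaler_sumr; apply: eq_bigr => i _.
    by rewrite mxE scalerA.
  by near: t; exact: h1.
by near: t; exact: h2.
Unshelve. all: by end_near. Qed.

Lemma regular_dense (U : set 'rV[R]_m) : open U -> dense U ->
  (forall mu, U mu -> bijective (ad_on br p (pt mu))) ->
  dense [set mu | regular br k p (pt mu)].
Proof.
move=> oU dU bU O O0 oO; have [mu [Omu Umu]] := dU O O0 oO.
have h := regular_near_line (bU mu Umu).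
have c : (t *: mu) @[t --> (1 : R)] --> (1 : R) *: mu.
  exact: scalel_continuous.
rewrite scale1r in c.
have hO : \forall t \near (1 : R)^', O (t *: mu).
  apply: near_punctured; apply: c; exact: open_nbhs_nbhs.
have [t [Ot rt]] := filter_ex (filterI hO h).
by exists (t *: mu).
Qed.

Lemma rmatrix_rmat mu a b x y : unit_at P H mu -> a =1 B x -> b =1 B y ->
  r mu a b = form G (col_of E x) (rmat P H mu *m col_of E y).
Proof.
move=> /(regular_unit_at mu).2 reg ax ay; rewrite /rmat family_ad.
exact: (rmatrixE basisE symB invB subk perp dualk dualp (of_coords_mem mu) reg ax ay).
Qed.

Lemma rmatrix_derive mu a b : regular br k p (pt mu) ->
  differentiable (fun nu => r nu a b : R^o) mu /\
  forall i, partial2 i r mu a b =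
    form G (col_of E (covec E E' a)) (rslope P H i mu mu *m col_of E (covec E E' b)).
Proof.
move=> /(regular_unit_at mu).1 um; apply: (rmat_derive PP HP) => // nu un.
by apply: rmatrix_rmat => //; exact: (covecE symB dualE).
Qed.

(** The gradient in the direction dual to a covector is the derivative of the
    r-matrix along the projection of that covector to [k]. *)
Lemma rslope_dual mu z : \sum_i B z (tnth e i) *: rslope P H i mu mu =
  let A := family H mu in
  mxquot_slope fnum2 sinhc2 A A (ad (P *m col_of E z)) -
  partial_inv P A *m ad (P *m col_of E z) *m partial_inv P A.
Proof.
rewrite /=; have -> : P *m col_of E z = \sum_i B z (tnth e i) *: col_of E (tnth e' i).
  have dk := dual_bases_sym symB dualk.
  have -> : \sum_i B z (tnth e i) *: col_of E (tnth e' i) = col_of E (dproj B e' e z).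
    by rewrite /dproj linear_sum; apply: eq_bigr => i _; rewrite linearZ.
  rewrite proj_k_col//; congr col_of.
  rewrite -[in RHS](subrK (dproj B e e' z) z) linearD/= (dproj_perp perp dk).
    by rewrite add0r (dproj_id dk)// (dproj_mem dualk).
  exact: (perp_mem perp dualk).
have -> : ad (\sum_i B z (tnth e i) *: col_of E (tnth e' i)) =
    \sum_i B z (tnth e i) *: H i.
  by rewrite linear_sum; apply: eq_bigr => i _; rewrite linearZ.
rewrite (mxquot_slope_sum entire_fnum2 entire_sinhc2) mulmx_sumr mulmx_suml.
rewrite -sumrB; apply: eq_bigr => i _.
by rewrite /rslope scalerBr -scalemxAr -scalemxAl.
Qed.

Lemma cdybe mu a b c : regular br k p (pt mu) ->
  cdybe_lhs br e E r mu a b c = 4^-1 * cubic br B E E' a b c.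
Proof.
move=> reg; have um := (regular_unit_at mu).1 reg; have muk := of_coords_mem mu.
have [uA uU] := (regularP basisE invB subk perp dualk muk).1 reg.
have AP := ad_proj_k basisE invB subk perp dualk muk.
have brC := brC lie.
have skew x y : form G (rmat P H mu *m x) y = - form G x (rmat P H mu *m y).
  by rewrite /rmat family_ad;
    exact: (rmatrix_skew basisE symB invB subk perp dualk muk reg).
rewrite (cubicE E E' a b c brC invB) /cdybe_lhs.
rewrite (schoutenE symB dualE a b c brC skew); last first.
  by move=> a' b' x y; exact: rmatrix_rmat.
have grad a1 a2 a3 : \sum_i partial2 i r mu a1 a2 * a3 (tnth e i) =
    form G (col_of E (covec E E' a1))
      ((\sum_i B (covec E E' a3) (tnth e i) *: rslope P H i mu mu) *m
       col_of E (covec E E' a2)).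
  rewrite mulmx_suml /form mulmx_sumr summxE; apply: eq_bigr => i _.
  rewrite (rmatrix_derive a1 a2 reg).2 (covecE symB dualE a3).
  by rewrite -scalemxAl -scalemxAr mxE mulrC.
have -> : \sum_i wedge2v (partial2 i r mu) (tnth e i) a b c =
    \sum_i partial2 i r mu a b * c (tnth e i)
    + \sum_i partial2 i r mu b c * a (tnth e i)
    + \sum_i partial2 i r mu c a * b (tnth e i) by rewrite -!big_split.
rewrite !grad !rslope_dual /= family_ad.
have PkDPp : P + N = 1%:M by rewrite addrC subrK.
have := dressed_identity (gram_tr E symB) (adm_antisym basisE lie)
  (adm_bracket basisE lie) (adm_skew basisE invB) PkDPp
  (proj_form basisE symB perp dualk) (mul_partial_inv PP AP uU)
  (proj_partial_inv PP AP uU) uA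
  (col_of E (covec E E' a)) (col_of E (covec E E' b)) (col_of E (covec E E' c)).
rewrite /= /rmat family_ad (formE basisE) -(adm_col basisE) -/(cform _ _ _ _ _).
rewrite mulrN => <-; ring.
Qed.

End DynamicalRMatrix.

Theorem theorem4p3 (R : realType) (g : vectType R)
    (br : {bilinear g -> g -> g}) (Q : g -> R)
    (k p : {vspace g}) (m l n : nat)
    (e e' : m.-tuple g) (u u' : l.-tuple g) (E E' : n.-tuple g)
    (hg : quadratic_lie_algebra br Q)
    (hk : quadratic_subalgebra br Q k)
    (hp : orthogonal_complement (polar Q) k p)
    (he : dual_bases (polar Q) k e e')
    (hu : dual_bases (polar Q) p u u')
    (hE : dual_bases (polar Q) fullv E E')
    (hinv : exists U : set 'rV[R]_m, [/\ open U, dense U &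
       forall mu : 'rV[R]_m, U mu -> bijective (ad_on br p (of_coords e' mu))]) :
  let r : 'rV[R]_m -> ext2 g := fun mu a b =>
    rk br k e e' (of_coords e' mu) a b + rp br p u u' (of_coords e' mu) a b in
  let D : set 'rV[R]_m := [set mu | regular br k p (of_coords e' mu)] in
  [/\ open D, dense D,
      forall (mu : 'rV[R]_m) (a b : {scalar g}), D mu ->
        differentiable (fun nu => r nu a b : R^o) mu &
      forall (mu : 'rV[R]_m) (a b c : {scalar g}), D mu ->
        cdybe_lhs br e E r mu a b c = 4^-1 * cubic br (polar Q) E E' a b c].
Proof.
have [lie [_ polB] nondeg inv] := hg; have [subk _] := hk.
pose B : {bilinear g -> g -> R | *%R & *%R} :=
  HB.pack (polar Q) (bilinear_isBilinear.Build R g g R *%R *%R (polar Q) polB).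
have symB x y : B x y = B y x.
  by rewrite /B /= /polar (addrC x y); congr (_ * _); rewrite -!addrA; congr (_ + _); exact: addrC.
move=> r D; split.
- exact: (regular_open (B := B) inv subk hp he hE).
- have [U [oU dU bU]] := hinv.
  exact: (regular_dense (B := B) inv subk hp he hE oU dU bU).
- move=> mu a b reg.
  exact: (rmatrix_derive (B := B) symB inv subk hp he hu hE a b reg).1.
- move=> mu a b c reg.
  exact: (cdybe (B := B) lie symB inv subk hp he hu hE a b c reg).
Qed.
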